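(* For every integer $n \geq 5$ and every collection of non-trivial groups $\mathcal{G}=\{G_i \mid i\in\mathbb{Z}/n\mathbb{Z}\}$, the group $\mathrm{Aut}(C_n\mathcal{G})$ does not have Property (T).
   Context: The cyclic product $C_n\mathcal{G}$ is the quotient of the free product $\ast_{i} G_i$ by the relations $gh=hg$ for all $g\in G_i$, $h\in G_{i+1}$, $i \in \mathbb{Z}/n\mathbb{Z}$ (indices modulo $n$). A (discrete) group has Kazhdan's Property (T) if every unitary action on a Hilbert space with almost invariant vectors has a non-trivial (i.e. non-zero) invariant vector. *)

(* Defs.v *)
From HB Require Import structures.
From mathcomp Require Import all_boot all_order all_algebra.
From mathcomp Require Import all_classical all_reals all_analysis.
From mathcomp.real_closed Require Export complex.

Set Implicit Arguments.
Unset Strict Implicit.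
Unset Printing Implicit Defensive.

Import Order.TTheory GRing.Theory Num.Theory.
Import numFieldNormedType.Exports.

Local Open Scope quotient_scope.

Inductive congr_closure (M : monoidType) (r : M -> M -> Prop) : M -> M -> Prop :=
| congr_base x y : r x y -> congr_closure r x y
| congr_refl x : congr_closure r x x
| congr_sym x y : congr_closure r x y -> congr_closure r y x
| congr_trans y x z :
    congr_closure r x y -> congr_closure r y z -> congr_closure r x z
| congr_mul x x' y y' :
    congr_closure r x x' -> congr_closure r y y' ->
    congr_closure r (x * y)%g (x' * y')%g.

Definition congr_rel (M : monoidType) (r : M -> M -> Prop) : rel M :=
  fun x y => `[< congr_closure r x y >].

Section CongrEquiv.
Context (M : monoidType) (r : M -> M -> Prop).

Lemma congr_rel_refl : reflexive (congr_rel r).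
Proof. by move=> x; apply/asboolP; exact: congr_refl. Qed.

Lemma congr_rel_sym : symmetric (congr_rel r).
Proof. by move=> x y; apply/asboolP/asboolP; exact: congr_sym. Qed.

Lemma congr_rel_trans : transitive (congr_rel r).
Proof.
move=> y x z /asboolP xy /asboolP yz; apply/asboolP.
exact: congr_trans xy yz.
Qed.

Canonical congr_equiv :=
  EquivRel (congr_rel r) congr_rel_refl congr_rel_sym congr_rel_trans.

(** When [M] is a group this is its quotient by the normal closure of the
    elements [x * y^-1] with [r x y]. *)
Definition congr_quot := {eq_quot congr_equiv}.

HB.instance Definition _ : EqQuotient M congr_equiv congr_quot :=
  EqQuotient.on congr_quot.
HB.instance Definition _ := Choice.on congr_quot.

Lemma congr_quotP (x y : M) :
  reflect (\pi_congr_quot x = \pi_congr_quot y) (congr_rel r x y).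
Proof. by apply: (iffP idP) => [|/eqquotP //]; move=> xy; apply/eqquotP. Qed.

Lemma congr_quot_reprP (x : M) : congr_closure r (repr (\pi_congr_quot x)) x.
Proof. by apply/asboolP/congr_quotP; rewrite reprK. Qed.

Definition congr_quot_mul (a b : congr_quot) : congr_quot :=
  \pi_congr_quot (repr a * repr b)%g.

Lemma congr_quot_pi_mul (x y : M) :
  congr_quot_mul (\pi_congr_quot x) (\pi_congr_quot y) = \pi_congr_quot (x * y)%g.
Proof.
by apply/congr_quotP/asboolP; apply: congr_mul; exact: congr_quot_reprP.
Qed.

Lemma congr_quot_mulA : associative congr_quot_mul.
Proof.
elim/quotW=> x; elim/quotW=> y; elim/quotW=> z.
rewrite (congr_quot_pi_mul x y) (congr_quot_pi_mul y z).
by rewrite (congr_quot_pi_mul x) (congr_quot_pi_mul _ z) mulgA.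
Qed.

Lemma congr_quot_mul1 : left_id (\pi_congr_quot 1%g) congr_quot_mul.
Proof. by elim/quotW=> x; rewrite (congr_quot_pi_mul 1%g x) mul1g. Qed.

Lemma congr_quot_1mul : right_id (\pi_congr_quot 1%g) congr_quot_mul.
Proof. by elim/quotW=> x; rewrite (congr_quot_pi_mul x 1%g) mulg1. Qed.

HB.instance Definition _ := isMonoid.Build congr_quot
  congr_quot_mulA congr_quot_mul1 congr_quot_1mul.

Lemma congr_quot_piM (x y : M) :
  \pi_congr_quot (x * y)%g = (\pi_congr_quot x * \pi_congr_quot y)%g.
Proof. by rewrite -congr_quot_pi_mul. Qed.

End CongrEquiv.

Section CongrGroup.
Context (H : groupType) (r : H -> H -> Prop).

Definition congr_quot_inv (a : congr_quot r) : congr_quot r :=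
  \pi_(congr_quot r) (repr a)^-1%g.

HB.instance Definition _ := hasInv.Build (congr_quot r) congr_quot_inv.

Lemma congr_quot_mulVg : left_inverse 1%g congr_quot_inv *%g.
Proof. by move=> a; rewrite -{2}[a]reprK -congr_quot_piM mulVg. Qed.

Lemma congr_quot_mulgV : right_inverse 1%g congr_quot_inv *%g.
Proof. by move=> a; rewrite -{1}[a]reprK -congr_quot_piM mulgV. Qed.

HB.instance Definition _ := Monoid_isGroup.Build (congr_quot r)
  congr_quot_mulVg congr_quot_mulgV.

End CongrGroup.

Section FreeProduct.
Context (I : choiceType) (G : I -> groupType).

Definition fp_word := seq {i : I & G i}.

HB.instance Definition _ := Choice.on fp_word.
HB.instance Definition _ :=
  isMonoid.Build fp_word (@catA _) (@cat0s _) (@cats0 _).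

Definition fp_letter (i : I) (g : G i) : fp_word := [:: Tagged G g].

Inductive fp_rel : fp_word -> fp_word -> Prop :=
| fp_rel1 i : fp_rel (fp_letter (1%g : G i)) 1%g
| fp_relM i (g h : G i) :
    fp_rel (fp_letter g * fp_letter h)%g (fp_letter (g * h)%g).

Definition free_product := congr_quot fp_rel.

HB.instance Definition _ := EqQuotient.on free_product.
HB.instance Definition _ := Monoid.on free_product.

Definition fp_word_inv (w : fp_word) : fp_word :=
  rev [seq Tagged G (projT2 a : G _)^-1%g | a : {i : I & G i} <- w].

Lemma fp_word_mulV (w : fp_word) :
  congr_closure fp_rel (w * fp_word_inv w)%g 1%g.
Proof.
elim: w => [|[i g] w IH]; first exact: congr_refl.
rewrite /fp_word_inv /= rev_cons -cats1 -/(fp_word_inv w).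
have -> : (((existT _ i g :: w) : fp_word) *
  (fp_word_inv w ++ [:: Tagged G g^-1] : fp_word)
  = fp_letter g * ((w : fp_word) * fp_word_inv w) * fp_letter g^-1)%g.
  by rewrite !mulgA.
apply: (@congr_trans _ _ (fp_letter g * 1 * fp_letter g^-1)%g).
  by do 2?apply: congr_mul => //; exact: congr_refl.
rewrite mulg1; apply: congr_trans (congr_base (fp_relM _ _)) _.
by rewrite mulgV; apply/congr_base/fp_rel1.
Qed.

Lemma fp_word_invK : involutive fp_word_inv.
Proof.
move=> w; rewrite /fp_word_inv map_rev revK -map_comp -[RHS]map_id.
by apply: eq_map => -[i g] /=; rewrite invgK.
Qed.

Lemma fp_word_Vmul (w : fp_word) :
  congr_closure fp_rel (fp_word_inv w * w)%g 1%g.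
Proof. by rewrite -{2}[w]fp_word_invK; exact: fp_word_mulV. Qed.

Definition free_product_inv (a : free_product) : free_product :=
  \pi_free_product (fp_word_inv (repr a)).

HB.instance Definition _ := hasInv.Build free_product free_product_inv.

Lemma free_product_mulVg :
  left_inverse 1%g free_product_inv *%g.
Proof.
move=> a; rewrite -{2}[a]reprK -[LHS]congr_quot_piM.
by apply/congr_quotP/asboolP; exact: fp_word_Vmul.
Qed.

Lemma free_product_mulgV :
  right_inverse 1%g free_product_inv *%g.
Proof.
move=> a; rewrite -{1}[a]reprK -[LHS]congr_quot_piM.
by apply/congr_quotP/asboolP; exact: fp_word_mulV.
Qed.

HB.instance Definition _ := Monoid_isGroup.Build free_product
  free_product_mulVg free_product_mulgV.

Definition fp_in (i : I) (g : G i) : free_product := \pi_free_product (fp_letter g).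

End FreeProduct.

(** ['Z_n] is the ring of integers modulo [n] only for [n > 1]. *)
Inductive cyclic_rel (n : nat) (G : 'Z_n -> groupType) :
    free_product G -> free_product G -> Prop :=
| CyclicRel (i : 'Z_n) (g : G i) (h : G (i + 1)%R) :
    cyclic_rel (fp_in g * fp_in h)%g (fp_in h * fp_in g)%g.

Definition cyclic_product (n : nat) (G : 'Z_n -> groupType) : groupType :=
  congr_quot (@cyclic_rel n G).

Section Automorphisms.
Context (G : groupType).

Record group_aut := GroupAut {
  aut_fun :> G -> G;
  autM : {morph aut_fun : x y / (x * y)%g};
  aut_bij : bijective aut_fun }.

HB.instance Definition _ := gen_eqMixin group_aut.
HB.instance Definition _ := gen_choiceMixin group_aut.

Lemma group_autP (f g : group_aut) : f =1 g -> f = g.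
Proof.
case: f g => [f fM fb] [g gM gb] /= /funext fg; subst g.
by congr GroupAut; exact: Prop_irrelevance.
Qed.

Lemma aut_one_subproof : {morph @id G : x y / (x * y)%g}.
Proof. by []. Qed.

Definition aut_one := GroupAut aut_one_subproof (Bijective (frefl _) (frefl _)).

Lemma aut_mul_subproof (f g : group_aut) : {morph f \o g : x y / (x * y)%g}.
Proof. by move=> x y /=; rewrite !autM. Qed.

Definition aut_mul (f g : group_aut) :=
  GroupAut (aut_mul_subproof f g) (bij_comp (aut_bij f) (aut_bij g)).

Lemma aut_inv_subproof (f : group_aut) :
  {h : group_aut | cancel f h /\ cancel h f}.
Proof.
have /cid[h [fK hK]] : exists h, cancel f h /\ cancel h f.
  by case: (aut_bij f) => h; exists h.
have hM : {morph h : x y / (x * y)%g}.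
  by move=> x y; apply: (can_inj fK); rewrite autM !hK.
by exists (GroupAut hM (Bijective hK fK)).
Qed.

Definition aut_inv (f : group_aut) := sval (aut_inv_subproof f).

Lemma aut_mulA : associative aut_mul.
Proof. by move=> f g h; exact: group_autP. Qed.

Lemma aut_mul1 : left_id aut_one aut_mul.
Proof. by move=> f; exact: group_autP. Qed.

Lemma aut_1mul : right_id aut_one aut_mul.
Proof. by move=> f; exact: group_autP. Qed.

Lemma aut_mulV : left_inverse aut_one aut_inv aut_mul.
Proof.
move=> f; apply: group_autP => x /=; rewrite /aut_inv.
by case: (aut_inv_subproof f) => h [fK hK] /=.
Qed.

Lemma aut_Vmul : right_inverse aut_one aut_inv aut_mul.
Proof.
move=> f; apply: group_autP => x /=; rewrite /aut_inv.
by case: (aut_inv_subproof f) => h [fK hK] /=.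
Qed.

HB.instance Definition _ := isGroup.Build group_aut
  aut_mulA aut_mul1 aut_1mul aut_mulV aut_Vmul.

End Automorphisms.

Local Open Scope ring_scope.
Local Open Scope complex_scope.

(** [inner] is linear on the left and conjugate-linear on the right. *)
Record hilbertType (R : realType) := Hilbert {
  hilbert_sort :> completeNormedModType R[i];
  inner : {dot hilbert_sort for Num.conj};
  inner_norm : forall v : hilbert_sort, `|v| ^+ 2 = inner v v }.

(** The operators are invertible, hence unitary, because [G] is a group. *)
Record unitary_action (R : realType) (G : groupType) (H : hilbertType R) :=
  UnitaryAction {
    unitary_fun :> G -> {linear H -> H};
    unitary1 : forall v : H, unitary_fun 1%g v = v;
    unitaryM : forall (g h : G) (v : H),
      unitary_fun (g * h)%g v = unitary_fun g (unitary_fun h v);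
    unitary_inner : forall (g : G) (u v : H),
      inner H (unitary_fun g u) (unitary_fun g v) = inner H u v }.

(** [G] is discrete, so its compact subsets are the finite ones. *)
Definition almost_invariant_vectors (R : realType) (G : groupType)
    (H : hilbertType R) (pi : unitary_action G H) : Prop :=
  forall (K : seq G) (eps : R), 0 < eps ->
  exists v : H, v != 0 /\
    forall g : G, g \in K -> `|pi g v - v| < eps%:C * `|v|.

Definition property_T (R : realType) (G : groupType) : Prop :=
  forall (H : hilbertType R) (pi : unitary_action G H),
    almost_invariant_vectors pi ->
    exists v : H, v != 0 /\ forall g : G, pi g v = v.

(* Main.v *)
(** A group acting on a set [E] cannot have Property (T) if some subset of [E]
    is commensurated by the action, with symmetric differences of unbounded size
    under translation.  Here [Aut W], for [W] the cyclic product, acts on the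
    half-spaces of [W], and the subset consists of the half-spaces through [1].

    The point is that [Aut W] does act.  The graph product [W] has hyperplanes,
    one for each coset of a star subgroup, whose stabilizers are the conjugates of
    the star subgroups.  When the graph has no triangle and no square, has no
    separating star or clique, and every vertex has two neighbours, automorphisms
    permute these stabilizers, crossing of hyperplanes can be read off from them,
    and so every automorphism permutes the hyperplanes and respects crossing.  The
    images of the hyperplanes through [1] then have a common chamber, so that an
    automorphism [a] maps every vertex group [G i] to [w (G (s i)) w^-1] where [w]
    does not depend on [i], and [x |-> a x * w] permutes the half-spaces.  Finitely
    many half-spaces separate [1] from [w]; conjugation by [y ^ N], with [y] the
    product of elements of two nonadjacent vertex groups, has [w = y ^ N] and shows
    that their number is unbounded. *)

From HB Require Import structures.
Require Import Defs.
From mathcomp Require Import all_boot all_order all_algebra finmap.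
From mathcomp Require Import all_classical all_reals all_analysis ring lra zify.

Set Implicit Arguments.
Unset Strict Implicit.
Unset Printing Implicit Defensive.

Import Order.TTheory GRing.Theory Num.Theory.
Import numFieldNormedType.Exports.

(** * Square-summable functions *)

Section NetSum.
Local Open Scope ring_scope.
Local Open Scope classical_set_scope.
Local Open Scope complex_scope.
Context (R : realType) (T : choiceType).
Implicit Types (a b : T -> R) (A : {fset T}).

(** The obstacle is that an automorphism is given without geometry: the image of a vertex group
    might fix no hyperplane at all. Elements fixing none are [generic], and are excluded through the
    half-spaces that they translate strictly into or out of themselves. What other elements fix is
    found through centralizers: everything commuting with an element that rotates a hyperplane fixes
    that hyperplane. The absence of squares enters by way of intersections: the stabilizers of two
    hyperplanes that neither coincide nor cross meet inside a conjugate of one vertex group, which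
    is why stabilizers detect crossing. The representation behind the criterion is explicit. Its
    space consists of square-summable functions on pairs of a natural number and a finite subset of
    [E]. The fibre over [k] is the tensor product of copies of the plane indexed by [E], almost all
    factors being at the reference vector [absent]; each element of [D g] contributes a reflection
    in its own factor, by an angle shrinking with [k]. Stacking all [k] gives one representation
    with almost invariant vectors, though no fibre has invariant ones. *)

Definition fset_filter : set_system {fset T} :=
  filter_from setT (fun A => [set B | (A `<=` B)%fset]).

Global Instance fset_filter_proper : ProperFilter fset_filter.
Proof.
apply: filter_from_proper => [|A _]; last by exists A; exact: fsubset_refl.
apply: filter_from_filter; first by exists fset0.
move=> A B _ _; exists (A `|` B)%fset => // C /= ABC.
by split; apply: fsubset_trans ABC; rewrite ?fsubsetUl ?fsubsetUr.
Qed.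

(** Unconditional summation: the limit is along the finite subsets of [T] ordered by inclusion, so
    no enumeration is chosen. *)
Definition has_sum a (l : R) : Prop :=
  (fun A => \sum_(x <- A) a x) @ fset_filter --> l.

Lemma has_sum_unique a l l' : has_sum a l -> has_sum a l' -> l = l'.
Proof. exact: norm_cvg_unique. Qed.

Lemma has_sumD a b l l' : has_sum a l -> has_sum b l' ->
  has_sum (fun x => a x + b x) (l + l').
Proof.
move=> al bl; rewrite /has_sum.
under eq_fun do rewrite big_split.
exact: cvgD.
Qed.

Lemma has_sumZ c a l : has_sum a l -> has_sum (fun x => c * a x) (c * l).
Proof.
move=> al; rewrite /has_sum; under eq_fun do rewrite -mulr_sumr.
exact: cvgMl_tmp.
Qed.

Lemma has_sum_le_near a l (M : R) A : has_sum a l ->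
  (forall B, (A `<=` B)%fset -> \sum_(x <- B) a x <= M) -> l <= M.
Proof.
move=> al aM; rewrite leNgt; apply/negP => Ml.
have [C _ CP] := (cvgr_gt _ al) _ Ml.
have := CP (A `|` C)%fset; rewrite /= fsubsetUr => /(_ isT).
by rewrite ltNge aM// fsubsetUl.
Qed.

Lemma has_sum_ge_near a l (M : R) A : has_sum a l ->
  (forall B, (A `<=` B)%fset -> M <= \sum_(x <- B) a x) -> M <= l.
Proof.
move=> al aM; rewrite leNgt; apply/negP => Ml.
have [C _ CP] := (cvgr_lt _ al) _ Ml.
have := CP (A `|` C)%fset; rewrite /= fsubsetUr => /(_ isT).
by rewrite ltNge aM// fsubsetUl.
Qed.

Lemma ler_sum_fset a A B : (forall x, 0 <= a x) -> (A `<=` B)%fset ->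
  \sum_(x <- A) a x <= \sum_(x <- B) a x.
Proof.
move=> a0 AB; rewrite [leRHS](perm_big (A ++ (B `\` A)%fset)) /=.
  by rewrite big_cat /= lerDl sumr_ge0.
apply: uniq_perm; rewrite ?fset_uniq//.
  rewrite cat_uniq !fset_uniq andbT /=; apply/hasPn => x /=.
  by rewrite !inE => /andP[].
move=> x; rewrite mem_cat !inE; case: (boolP (x \in A)) => //= xA.
exact: (fsubsetP AB).
Qed.

Lemma has_sum_ge_part a l A : (forall x, 0 <= a x) -> has_sum a l ->
  \sum_(x <- A) a x <= l.
Proof.
by move=> a0 al; apply: (has_sum_ge_near al) => B; exact: ler_sum_fset.
Qed.

Lemma has_sum_le_bound a l (M : R) : has_sum a l ->
  (forall A, \sum_(x <- A) a x <= M) -> l <= M.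
Proof. by move=> al aM; apply: (@has_sum_le_near _ _ _ fset0 al) => A _. Qed.

Lemma bounded_has_sum a (M : R) : (forall x, 0 <= a x) ->
  (forall A, \sum_(x <- A) a x <= M) -> exists l, has_sum a l.
Proof.
move=> a0 aM; pose S := range (fun A : {fset T} => \sum_(x <- A) a x).
have Sub : has_ubound S by exists M => _ [A _ <-].
have Ssup : has_sup S by split => //; exists (\sum_(x <- fset0) a x), fset0.
exists (sup S); apply/cvgrPdist_le => e e0.
have [_ [A _ <-] Ae] := sup_adherent e0 Ssup.
exists A => // B /= AB; have BS : \sum_(x <- B) a x <= sup S.
  by apply: ub_le_sup => //; exists B.
rewrite ger0_norm ?subr_ge0// lerBlDl -lerBlDr.
by apply: (le_trans (ltW Ae)); exact: ler_sum_fset.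
Qed.

Lemma dominated_has_sum a b (M : R) : (forall x, `|a x| <= b x) ->
  (forall A, \sum_(x <- A) b x <= M) -> exists l, has_sum a l.
Proof.
move=> ab bM.
have b0 x : 0 <= b x by apply: le_trans (ab x).
have [lb blb] := bounded_has_sum b0 bM.
(* [a + b] is nonnegative and at most [2 * b]; the sum of [b] is subtracted afterwards. *)
have [l abl] : exists l, has_sum (fun x => a x + b x) l.
  apply: (@bounded_has_sum _ (2 * M)) => [x|A].
    by have := ab x; rewrite ler_norml => /andP[+ _]; rewrite -subr_ge0 opprK.
  apply: (@le_trans _ _ (\sum_(x <- A) 2 * b x)).
    apply: ler_sum => x _; rewrite mulr_natl mulr2n lerD2r.
    exact: le_trans (ler_norm _) (ab x).
  by rewrite -mulr_sumr ler_pM2l.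
exists (l + (-1) * lb); rewrite (_ : a = fun x => (a x + b x) + (-1) * b x).
  exact/has_sumD/has_sumZ.
by apply/funext => x; rewrite mulN1r addrK.
Qed.

End NetSum.

(** * Cauchy-Schwarz and the norm of a Hermitian dot product *)

Section DotNorm.
Local Open Scope ring_scope.
Local Open Scope classical_set_scope.
Local Open Scope complex_scope.
Context (C : numClosedFieldType) (U : lmodType C) (form : {dot U for Num.conj}).
Local Notation "'[ u , v ]" := (form u v).

Lemma dot_CauchySchwarz u v : `|'[u, v]| ^+ 2 <= '[u, u] * '[v, v].
Proof.
have [->|v0] := eqVneq v 0; first by rewrite !linear0r normr0 expr0n.
have vv0 : 0 < '[v, v] by exact: neq0_dnorm_gt0.
pose a := '[u, v] / '[v, v]; pose w := u - a *: v.
have wv : '[w, v] = 0 by rewrite linearBl linearZl_LR /= divfK ?subrr ?gt_eqF.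
have -> : u = w + a *: v by rewrite subrK.
rewrite linearDl /= wv add0r linearZl_LR /= hnormDd /=; last first.
  by rewrite linearZr_LR /= wv mulr0.
rewrite dnormZ normrM exprMn (ger0_norm (ltW vv0)) expr2 mulrA mulrDl.
rewrite -[leLHS]add0r lerD ?mulr_ge0 ?dnorm_ge0//.
Qed.

Definition dot_norm (u : U) : C := sqrtC '[u, u].

Lemma dot_norm_ge0 u : 0 <= dot_norm u. Proof. exact: sqrt_dnorm_ge0. Qed.

Lemma dot_normD u v : dot_norm (u + v) <= dot_norm u + dot_norm v.
Proof.
rewrite -(@ler_pXn2r _ 2)// ?nnegrE ?addr_ge0 ?dot_norm_ge0// sqrtCK dnormD /=.
rewrite sqrrD !sqrtCK [leRHS]addrAC lerD2l.
apply: (@le_trans _ _ (`|'[u, v]| *+ 2)).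
  apply: le_trans (real_ler_norm _) _.
    by rewrite CrealE rmorphD /= conjCK addrC.
  by apply: le_trans (ler_normD _ _) _; rewrite norm_conjC mulr2n.
rewrite lerMn2r /= -(@ler_pXn2r _ 2)// ?nnegrE ?mulr_ge0 ?dot_norm_ge0//.
by rewrite exprMn !sqrtCK dot_CauchySchwarz.
Qed.

Lemma dot_normZ c u : dot_norm (c *: u) = `|c| * dot_norm u.
Proof.
rewrite /dot_norm dnormZ sqrtCM ?nnegrE ?exprn_ge0 ?dnorm_ge0//.
by rewrite sqrCK.
Qed.

Lemma dot_norm_eq0 u : dot_norm u = 0 -> u = 0.
Proof. by move=> /eqP; rewrite sqrt_dnorm_eq0 => /eqP. Qed.

End DotNorm.

(** * The inner product on square-summable functions *)

Section SquareSummable.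
Local Open Scope ring_scope.
Local Open Scope classical_set_scope.
Local Open Scope complex_scope.
Context (R : realType) (T : choiceType).
Local Notation C := R[i].
Local Notation Re := complex.Re.
Local Notation Im := complex.Im.

Definition sqnormc (z : C) : R := Re z ^+ 2 + Im z ^+ 2.

Lemma sqnormc_ge0 z : 0 <= sqnormc z.
Proof. by rewrite addr_ge0 ?sqr_ge0. Qed.

Lemma sqnormcD z w : sqnormc (z + w) <= 2 * (sqnormc z + sqnormc w).
Proof.
case: z w => [a b] [c d]; rewrite /sqnormc /=.
have := sqr_ge0 (a - c); have := sqr_ge0 (b - d); nra.
Qed.

Lemma sqnormcM z w : sqnormc (z * w) = sqnormc z * sqnormc w.
Proof. by case: z w => [a b] [c d]; rewrite /sqnormc /=; ring. Qed.

Definition l2_pred : {pred T -> C} := fun f =>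
  `[< exists M : R, forall A : {fset T}, \sum_(x <- A) sqnormc (f x) <= M >].

Lemma l2_submod_closed : submod_closed l2_pred.
Proof.
split.
  apply/asboolP; exists 0 => A; rewrite big1// => x _.
  by rewrite /sqnormc /= expr0n addr0.
move=> c f g /asboolP[M fM] /asboolP[N gN]; apply/asboolP.
exists (2 * (sqnormc c * M + N)) => A.
apply: (@le_trans _ _ (\sum_(x <- A) 2 * (sqnormc c * sqnormc (f x) + sqnormc (g x)))).
  by apply: ler_sum => x _; rewrite -sqnormcM; exact: sqnormcD.
rewrite -mulr_sumr ler_pM2l// big_split /= -mulr_sumr lerD//.
by rewrite ler_wpM2l// sqnormc_ge0.
Qed.

HB.instance Definition _ := GRing.isSubmodClosed.Build _ _ l2_pred
  l2_submod_closed.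

Record l2 := L2 { l2_fun :> T -> C; l2_funP : l2_fun \in l2_pred }.

HB.instance Definition _ := [isSub for l2_fun].
HB.instance Definition _ := [Choice of l2 by <:].
HB.instance Definition _ := [SubChoice_isSubLmodule of l2 by <:].

Implicit Types f g h : l2.

Lemma l2P f g : f =1 g -> f = g.
Proof. by move=> fg; apply/val_inj/funext. Qed.

Lemma l2DE f g x : (f + g) x = f x + g x. Proof. by []. Qed.
Lemma l2NE f x : (- f) x = - f x. Proof. by []. Qed.
Lemma l2ZE c f x : (c *: f) x = c * f x. Proof. by []. Qed.

Lemma l2_bounded f : exists M : R, forall A : {fset T}, \sum_(x <- A) sqnormc (f x) <= M.
Proof. exact/asboolP/(l2_funP f). Qed.

(** This and [dotIm] are the real and imaginary parts of [z] times the conjugate of [w], summed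
    separately because [has_sum] takes real families. *)
Definition dotRe (z w : C) : R := Re z * Re w + Im z * Im w.
Definition dotIm (z w : C) : R := Im z * Re w - Re z * Im w.

Lemma has_sum_l2 (p : C -> C -> R) f g :
  (forall z w, `|p z w| <= sqnormc z + sqnormc w) ->
  exists l, has_sum (fun x => p (f x) (g x)) l.
Proof.
move=> pP; have [M fM] := l2_bounded f; have [N gN] := l2_bounded g.
apply: (@dominated_has_sum _ _ _ (fun x => sqnormc (f x) + sqnormc (g x)) (M + N)).
  by move=> x.
by move=> A; rewrite big_split lerD.
Qed.

Lemma dotRe_le z w : `|dotRe z w| <= sqnormc z + sqnormc w.
Proof.
case: z w => [a b] [c d]; rewrite /dotRe /sqnormc /= ler_norml.
have := sqr_ge0 (a - c); have := sqr_ge0 (b - d).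
have := sqr_ge0 (a + c); have := sqr_ge0 (b + d).
have := sqr_ge0 a; have := sqr_ge0 b; have := sqr_ge0 c; have := sqr_ge0 d.
move=> *; apply/andP; split; nra.
Qed.

Lemma dotIm_le z w : `|dotIm z w| <= sqnormc z + sqnormc w.
Proof.
case: z w => [a b] [c d]; rewrite /dotIm /sqnormc /= ler_norml.
have := sqr_ge0 (b - c); have := sqr_ge0 (a - d).
have := sqr_ge0 (b + c); have := sqr_ge0 (a + d).
have := sqr_ge0 a; have := sqr_ge0 b; have := sqr_ge0 c; have := sqr_ge0 d.
move=> *; apply/andP; split; nra.
Qed.

Definition l2_dotRe f g : R := sval (cid (has_sum_l2 f g dotRe_le)).
Definition l2_dotIm f g : R := sval (cid (has_sum_l2 f g dotIm_le)).
Definition l2_dot f g : C := l2_dotRe f g +i* l2_dotIm f g.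

Lemma l2_dotReP f g : has_sum (fun x => dotRe (f x) (g x)) (l2_dotRe f g).
Proof. exact: svalP (cid _). Qed.

Lemma l2_dotImP f g : has_sum (fun x => dotIm (f x) (g x)) (l2_dotIm f g).
Proof. exact: svalP (cid _). Qed.

Lemma l2_dotE f g l m : has_sum (fun x => dotRe (f x) (g x)) l ->
  has_sum (fun x => dotIm (f x) (g x)) m -> l2_dot f g = l +i* m.
Proof.
move=> fl fm; rewrite /l2_dot (has_sum_unique (@l2_dotReP f g) fl).
by rewrite (has_sum_unique (@l2_dotImP f g) fm).
Qed.

Lemma l2_dot_linearl g : scalar (l2_dot^~ g).
Proof.
move=> c f f'; set l := l2_dotRe f g; set m := l2_dotIm f g.
rewrite (@l2_dotE _ _ (Re c * l + (- Im c) * m + l2_dotRe f' g)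
   (Re c * m + Im c * l + l2_dotIm f' g)).
- rewrite /l2_dot -/l -/m; case: c => a b /=.
  by apply/eqP; rewrite eq_complex /=; apply/andP; split; apply/eqP; ring.
- rewrite (_ : (fun x => _) = fun x => Re c * dotRe (f x) (g x) +
     (- Im c) * dotIm (f x) (g x) + dotRe (f' x) (g x)).
    exact: (has_sumD (has_sumD (has_sumZ (c := Re c) (@l2_dotReP f g))
      (has_sumZ (c := - Im c) (@l2_dotImP f g))) (@l2_dotReP f' g)).
  apply/funext => x; rewrite l2DE l2ZE /dotRe /dotIm.
  by case: c (f x) (f' x) (g x) => [? ?] [? ?] [? ?] [? ?] /=; ring.
- rewrite (_ : (fun x => _) = fun x => Re c * dotIm (f x) (g x) +
     Im c * dotRe (f x) (g x) + dotIm (f' x) (g x)).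
    exact: (has_sumD (has_sumD (has_sumZ (c := Re c) (@l2_dotImP f g))
      (has_sumZ (c := Im c) (@l2_dotReP f g))) (@l2_dotImP f' g)).
  apply/funext => x; rewrite l2DE l2ZE /dotRe /dotIm.
  by case: c (f x) (f' x) (g x) => [? ?] [? ?] [? ?] [? ?] /=; ring.
Qed.

Lemma l2_dotC f g : l2_dot f g = (l2_dot g f)^*.
Proof.
apply: l2_dotE.
  rewrite (_ : (fun x => _) = fun x => dotRe (g x) (f x)); first exact: l2_dotReP.
  by apply/funext => x; rewrite /dotRe; ring.
rewrite (_ : (fun x => _) = fun x => (-1) * dotIm (g x) (f x)).
  by rewrite -[X in has_sum _ X]mulN1r; apply/has_sumZ/l2_dotImP.
by apply/funext => x; rewrite /dotIm; ring.
Qed.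

Lemma l2_dot_linearr g : linear_for (Num.conj \; *%R) (l2_dot g).
Proof.
have conjE a b : Num.conj (l2_dot a b) = l2_dot b a by rewrite [RHS]l2_dotC.
move=> c f f' /=; rewrite -(conjE _ g) (l2_dot_linearl g c f f') rmorphD rmorphM /=.
by rewrite !conjE.
Qed.

HB.instance Definition _ := @bilinear_isBilinear.Build C l2 l2 C
  *%R (Num.conj \; *%R) l2_dot (l2_dot_linearl, l2_dot_linearr).

Lemma l2_dot_hermitian f g : l2_dot f g = (-1) ^+ false * Num.conj (l2_dot g f).
Proof. by rewrite mul1r l2_dotC. Qed.

HB.instance Definition _ := @isHermitianSesquilinear.Build C l2 false Num.conj
  l2_dot l2_dot_hermitian.

Lemma l2_dotff f : exists2 l, l2_dot f f = l%:C & has_sum (sqnormc \o f) l.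
Proof.
exists (l2_dotRe f f).
  apply: l2_dotE; first exact: l2_dotReP.
  rewrite (_ : (fun x => _) = fun x => 0 * dotRe (f x) (f x)).
    by have := has_sumZ (c := 0) (@l2_dotReP f f); rewrite mul0r.
  by apply/funext => x; rewrite /dotIm; ring.
rewrite (_ : _ \o _ = fun x => dotRe (f x) (f x)); first exact: l2_dotReP.
by apply/funext => x; rewrite /dotRe /sqnormc /=; ring.
Qed.

Lemma sqnormc_eq0 z : sqnormc z <= 0 -> z = 0.
Proof.
case: z => a b; rewrite /sqnormc /= => ab0.
have a0 := sqr_ge0 a; have b0 := sqr_ge0 b.
have : a ^+ 2 == 0 by apply/eqP; lra.
have : b ^+ 2 == 0 by apply/eqP; lra.
by rewrite !sqrf_eq0 => /eqP -> /eqP ->.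
Qed.

Lemma l2_dot_gt0 f : f != 0 -> 0 < l2_dot f f.
Proof.
move=> f0; have [l -> fl] := l2_dotff f; rewrite ltcR ltNge.
apply: contra f0 => l0; apply/eqP/l2P => x; apply/sqnormc_eq0.
apply: le_trans l0.
have := @has_sum_ge_part _ _ _ _ [fset x]%fset (fun x => sqnormc_ge0 (f x)) fl.
by rewrite big_seq_fset1.
Qed.

HB.instance Definition _ := isDotProduct.Build C l2 l2_dot l2_dot_gt0.

HB.instance Definition _ := @Lmodule_isNormed.Build C l2
  (dot_norm l2_dot) (dot_normD l2_dot) (dot_normZ l2_dot)
  (dot_norm_eq0 (form := l2_dot)).

Lemma l2_normE f : `|f| = sqrtC (l2_dot f f). Proof. by []. Qed.

(** Norm estimates become bounds on finite partial sums, the form in which limits and contractions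
    are handled below. *)
Lemma l2_norm_le f (e : R) : 0 <= e ->
  (`|f| <= e%:C) <-> (forall A : {fset T}, \sum_(x <- A) sqnormc (f x) <= e ^+ 2).
Proof.
move=> e0; have [l fE fl] := l2_dotff f.
have -> : (`|f| <= e%:C) = (l <= e ^+ 2).
  by rewrite -(@ler_pXn2r _ 2)// ?nnegrE ?lecR// l2_normE sqrtCK fE -rmorphXn lecR.
split=> [le A|]; last exact: has_sum_le_bound.
by apply: le_trans le; apply: has_sum_ge_part fl => x; exact: sqnormc_ge0.
Qed.

End SquareSummable.

(** * Completeness of the space of square-summable functions *)

Section SquareSummableComplete.
Local Open Scope ring_scope.
Local Open Scope classical_set_scope.
Local Open Scope complex_scope.
Context (R : realType) (T : choiceType).
Local Notation C := R[i].
Local Notation Re := complex.Re.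
Local Notation Im := complex.Im.
Implicit Types f g h : @l2 R T.
Local Notation l2 := (@l2 R T).
Lemma gtc0_real (e : C) : 0 < e -> exists2 r : R, e = r%:C & 0 < r.
Proof.
move=> e0; exists (Re e); last by move: e0; rewrite ltcE => /andP[].
by rewrite RRe_real// ger0_real// ltW.
Qed.

Lemma sqnormc_re (z : C) : Re z ^+ 2 <= sqnormc z.
Proof. by rewrite lerDl sqr_ge0. Qed.

Lemma sqnormc_im (z : C) : Im z ^+ 2 <= sqnormc z.
Proof. by rewrite lerDr sqr_ge0. Qed.

Lemma sqnormc_l2_le f t (e : R) : 0 <= e -> `|f| <= e%:C -> sqnormc (f t) <= e ^+ 2.
Proof.
move=> e0 /((l2_norm_le f e0).1)/(_ [fset t]%fset).
by rewrite big_seq_fset1.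
Qed.

Lemma sqnormc_l2_lt f t (e : R) : `|f| < e%:C -> sqnormc (f t) < e ^+ 2.
Proof.
have : `|f| \is Num.real by rewrite normr_real.
move=> /complex_realP[r fr]; rewrite fr ltcR => re.
have r0 : 0 <= r by rewrite -ler0c -fr.
apply: (@le_lt_trans _ _ (r ^+ 2)); first by apply: sqnormc_l2_le; rewrite ?fr.
by rewrite ltr_pXn2r// ?nnegrE// ltW// (le_lt_trans r0).
Qed.

Section L2Complete.
Context (F : set_system l2) (FF : ProperFilter F) (Fc : cauchy F).

Lemma l2_cauchy_ball (e : R) : 0 < e -> exists f, \forall g \near F, `|f - g| < e%:C.
Proof.
move=> e0; have /cauchyP := Fc.
by move=> /(_ e%:C); rewrite ltcR => /(_ e0).
Qed.

Lemma l2_coord_cvg (p : C -> R) t : {morph p : z w / z - w} ->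
  (forall z, p z ^+ 2 <= sqnormc z) -> cvg ((p (f t) : R) @[f --> F]).
Proof.
move=> pB ple; apply: cauchy_cvg; apply: cauchy_exP => e e0.
have [f fP] := l2_cauchy_ball e0; exists (p (f t)).
apply: filterS fP => g fge; rewrite /ball /= -pB.
rewrite -(@ltr_pXn2r _ 2)// ?nnegrE ?ltW// real_normK ?num_real//.
exact: le_lt_trans (ple _) (sqnormc_l2_lt t fge).
Qed.

Let lim_fun t : C :=
  lim (Re (f t) @[f --> F]) +i* lim (Im (f t) @[f --> F]).

(** The bound passes to the coordinatewise limit one finite sum at a time, so no infinite sum is
    exchanged with a limit. *)
Lemma lim_fun_near f0 (e : R) (A : {fset T}) : 0 <= e -> (\forall g \near F, `|f0 - g| < e%:C) ->
  \sum_(x <- A) sqnormc (f0 x - lim_fun x) <= e ^+ 2.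
Proof.
move=> e0 fe.
have cvgS : \sum_(x <- A) sqnormc (f0 x - f x) @[f --> F] -->
   \sum_(x <- A) sqnormc (f0 x - lim_fun x).
  elim: (enum_fset A) => [|t s IH].
    by rewrite big_nil; under eq_fun do rewrite big_nil; exact: cvg_cst.
  rewrite big_cons; under eq_fun do rewrite big_cons; apply: cvgD IH.
  have cRe : Re (f0 t - f t) @[f --> F] --> Re (f0 t - lim_fun t).
    rewrite raddfB; under eq_fun do rewrite raddfB.
    apply: cvgB; first exact: cvg_cst.
    by apply: l2_coord_cvg; [exact: raddfB | exact: sqnormc_re].
  have cIm : Im (f0 t - f t) @[f --> F] --> Im (f0 t - lim_fun t).
    rewrite raddfB; under eq_fun do rewrite raddfB.
    apply: cvgB; first exact: cvg_cst.
    by apply: l2_coord_cvg; [exact: raddfB | exact: sqnormc_im].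
  by apply: cvgD; rewrite expr2; apply: cvgM.
apply: (cvgr_to_le cvgS); apply: filterS fe => g /ltW ge.
exact: ((l2_norm_le (f0 - g) e0).1 ge A).
Qed.

Lemma l2_complete : cvg F.
Proof.
have [f0 f0P] := l2_cauchy_ball ltr01.
have limP : lim_fun \in @l2_pred R T.
  (* The coordinatewise limit is [f0] minus a function whose finite sums are bounded. *)
  rewrite -[lim_fun](subKr (f0 : T -> C)) rpredB ?l2_funP//.
  apply/asboolP; exists (1 ^+ 2) => A.
  exact: lim_fun_near f0P.
apply/cvg_ex; exists (L2 limP); apply/cvgrPdist_lt => e /gtc0_real[r -> r0].
have r2 : 0 < r / 2 by rewrite divr_gt0.
have [f fP] := l2_cauchy_ball r2.
apply: filterS (fP) => g fg.
have lf : `|f - L2 limP| <= (r / 2)%:C.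
  by apply/(l2_norm_le _ (ltW r2)) => A; exact: lim_fun_near (ltW r2) fP.
rewrite (_ : _ - g = (f - g) - (f - L2 limP)); last first.
  by rewrite opprB [RHS]addrC addrA subrK.
apply: le_lt_trans (ler_normB _ _) _.
have -> : r%:C = (r / 2)%:C + (r / 2)%:C :> C by rewrite -rmorphD /= -splitr.
exact: ltr_leD.
Qed.

End L2Complete.

HB.instance Definition _ := Uniform_isComplete.Build l2 l2_complete.

Definition l2_hilbert : hilbertType R.
Proof.
apply: (@Hilbert R l2 (@l2_dot R T)) => v.
by rewrite l2_normE sqrtCK.
Defined.

End SquareSummableComplete.

(** * Polarization *)

Section Isometry.
Local Open Scope ring_scope.
Local Open Scope classical_set_scope.
Local Open Scope complex_scope.
Context (C : numClosedFieldType) (U : lmodType C) (form : {dot U for Num.conj}).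

(** The norms of [u], [v] and [u + v] determine twice the real part of [form u v]; replacing [v] by
    ['i *: v] recovers the imaginary part. *)
Lemma isometry_dot (V : {linear U -> U}) :
  (forall u, form (V u) (V u) = form u u) ->
  forall u v, form (V u) (V v) = form u v.
Proof.
move=> Viso; pose re u v := form u v + (form u v)^*.
have reV u v : re (V u) (V v) = re u v.
  have := Viso (u + v); rewrite linearD !dnormD !Viso; exact: addrI.
have reE u v : form u v *+ 2 = re u v + 'i * re u ('i *: v).
  rewrite /re !linearZr_LR /= rmorphM /= !conjCK conjCi mulrDr !mulrA mulrN.
  rewrite -expr2 sqrCi opprK mul1r mulN1r addrACA subrr addr0 mulr2n //.
move=> u v; apply: (@pmulrnI _ 2) => //.
by rewrite !reE -linearZ !reV.
Qed.
End Isometry.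

(** * Contractions, delta functions and finite approximation *)

Section Contractive.
Local Open Scope ring_scope.
Local Open Scope classical_set_scope.
Local Open Scope complex_scope.
Context (R : realType) (T : choiceType).
Local Notation C := R[i].
Local Notation Re := complex.Re.
Local Notation Im := complex.Im.
Local Notation l2 := (@l2 R T).
Implicit Types (U V : (T -> C) -> (T -> C)).

(** Comparing finite sums keeps the notion meaningful for arbitrary functions, and yields at once
    both stability of square-summability and the norm bound. *)
Definition contractive U := forall f (A : {fset T}), exists B : {fset T},
  \sum_(x <- A) sqnormc (U f x) <= \sum_(x <- B) sqnormc (f x).

Lemma contractive_comp U V : contractive U -> contractive V -> contractive (U \o V).
Proof.
move=> cU cV f A; have [B AB] := cU (V f) A; have [D BD] := cV f B.
by exists D; exact: le_trans AB BD.
Qed.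

Lemma contractive_l2 U (f : l2) : contractive U -> U f \in @l2_pred R T.
Proof.
move=> cU; have [M fM] := l2_bounded f; apply/asboolP; exists M => A.
by have [B AB] := cU f A; exact: le_trans AB (fM B).
Qed.

Definition l2_map U (cU : contractive U) (f : l2) : l2 := L2 (contractive_l2 f cU).

Lemma l2_map_norm U (cU : contractive U) f : `|l2_map cU f| <= `|f|.
Proof.
have : `|f| \is Num.real by rewrite normr_real.
move=> /complex_realP[r fr].
have r0 : 0 <= r by rewrite -ler0c -fr.
rewrite fr; apply/(l2_norm_le _ r0) => A; have [B AB] := cU f A.
by apply: le_trans AB _; apply: ((l2_norm_le f r0).1 _ B); rewrite fr.
Qed.

Definition delta_fun (w x : T) : C := (x == w)%:R.

Lemma sum_sqnormc_delta w (A : {fset T}) :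
  \sum_(x <- A) sqnormc (delta_fun w x) <= 1.
Proof.
have d x : x != w -> sqnormc (delta_fun w x) = 0.
  by move=> xw; rewrite /sqnormc /delta_fun (negbTE xw) /= expr0n addr0.
have [wA|wA] := boolP (w \in A).
  rewrite (bigD1_seq w)//= big1 => [|x]; last exact: d.
  by rewrite /sqnormc /delta_fun eqxx /= expr1n expr0n !addr0.
rewrite big_seq big1// => x xA; apply: d; by apply: contraNneq wA => <-.
Qed.

Lemma delta_l2P w : delta_fun w \in @l2_pred R T.
Proof. by apply/asboolP; exists 1; exact: sum_sqnormc_delta. Qed.

Definition delta w : l2 := L2 (delta_l2P w).

Lemma deltaE w x : delta w x = (x == w)%:R. Proof. by []. Qed.

Lemma norm_delta_le w : `|delta w| <= 1.
Proof.
by apply/(l2_norm_le _ ler01) => A; rewrite expr1n; exact: sum_sqnormc_delta.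
Qed.

Lemma dot_delta (f : l2) w : l2_dot f (delta w) = f w.
Proof.
have sum1 (p : C -> R) : (has_sum (fun x => p (f x) * (x == w)%:R) (p (f w))).
  apply/cvgrPdist_le => e e0; exists [fset w]%fset => // A /= wA.
  rewrite (bigD1_seq w)//=; last by apply: (fsubsetP wA); rewrite inE.
  rewrite eqxx mulr1 big1 => [|x /negbTE ->]; last by rewrite mulr0.
  by rewrite addr0 subrr normr0 ltW.
rewrite (@l2_dotE _ _ _ _ (Re (f w)) (Im (f w))); first by case: (f w).
  rewrite (_ : (fun x => _) = fun x => Re (f x) * (x == w)%:R); first exact: sum1.
  by apply/funext => x; rewrite /dotRe deltaE; case: (x == w); rewrite /= !(mulr0, addr0).
rewrite (_ : (fun x => _) = fun x => Im (f x) * (x == w)%:R); first exact: sum1.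
by apply/funext => x; rewrite /dotIm deltaE; case: (x == w); rewrite /= !(mulr0, subr0).
Qed.

Lemma l2_finite_approx (f : l2) (e : R) : 0 < e ->
  exists A : {fset T}, `|f - \sum_(w <- A) f w *: delta w| <= e%:C.
Proof.
move=> e0; have [l _ fl] := l2_dotff f.
have f0 x : 0 <= (@sqnormc R \o f) x by exact: sqnormc_ge0.
have e20 : 0 < e ^+ 2 by rewrite exprn_gt0.
have /cvgrPdist_le/(_ _ e20)[A _ AP] := fl.
have sumE (x : T) : (\sum_(w <- A) f w *: delta w) x = if x \in A then f x else 0.
  transitivity (\sum_(w <- A) f w * (x == w)%:R).
    by elim/big_rec2: _ => // w y z _ <-.
  have [xA|xA] := ifPn.
    rewrite (bigD1_seq x)//= eqxx mulr1 big1 ?addr0// => w.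
    by rewrite eq_sym => /negbTE ->; rewrite mulr0.
  rewrite big_seq big1// => w wA; rewrite (_ : x == w = false) ?mulr0//.
  by apply: contraNF xA => /eqP ->.
exists A; apply/(l2_norm_le _ (ltW e0)) => B.
have := AP A; rewrite /= fsubset_refl => /(_ isT).
rewrite ler_norml lerBlDr => /andP[_ lA].
rewrite -(lerD2r (\sum_(x <- A) sqnormc (f x))); apply: le_trans lA.
apply: le_trans (has_sum_ge_part (A `|` B)%fset f0 fl).
have -> : \sum_(x <- A) sqnormc (f x) =
    \sum_(x <- (A `|` B)%fset) (if x \in A then sqnormc (f x) else 0).
  rewrite -big_mkcond -big_filter; apply: perm_big; apply: uniq_perm.
  - exact: fset_uniq.
  - by rewrite filter_uniq ?fset_uniq.
  - by move=> x; rewrite mem_filter inE; case: (x \in A).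
have leAB : \sum_(x <- B) sqnormc ((f - \sum_(w <- A) f w *: delta w) x) <=
    \sum_(x <- (A `|` B)%fset) sqnormc ((f - \sum_(w <- A) f w *: delta w) x).
  by apply: ler_sum_fset => [x|]; [exact: sqnormc_ge0 | exact: fsubsetUr].
rewrite -lerBrDr; apply: le_trans leAB _; rewrite -sumrB; apply: ler_sum => x _.
rewrite l2DE l2NE sumE; case: (x \in A); last by rewrite !subr0.
by rewrite !subrr /sqnormc /= expr0n addr0.
Qed.

End Contractive.

(** * Property (T) and commensurated subsets *)

Section CommensuratedSubset.
Local Open Scope ring_scope.
Local Open Scope classical_set_scope.
Local Open Scope complex_scope.
Context (R : realType) (Gam : groupType) (E : choiceType).
Context (act : Gam -> E -> E) (act1 : act 1%g =1 id)
  (actM : forall g h, act (g * h)%g =1 act g \o act h).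
Context (chi : E -> bool) (D : Gam -> seq E) (D_uniq : forall g, uniq (D g))
  (D_mem : forall g e, (e \in D g) = chi e (+) chi (act g^-1%g e)).

Local Notation C := R[i].
Local Notation Om := (nat * {fset E})%type.
Implicit Types (f : Om -> C) (e : E) (S : {fset E}) (g h : Gam).

Lemma actK g : cancel (act g) (act g^-1%g).
Proof. by move=> e; rewrite -[LHS]/((act g^-1%g \o act g) e) -actM mulVg act1. Qed.

Lemma actVK g : cancel (act g^-1%g) (act g).
Proof. by move=> e; rewrite -[LHS]/((act g \o act g^-1%g) e) -actM mulgV act1. Qed.

Definition toggle e S : {fset E} := if e \in S then (S `\ e)%fset else (e |` S)%fset.

Lemma in_toggle e S x : (x \in toggle e S) = (x \in S) (+) (x == e).
Proof.
rewrite /toggle; case: ifPn => eS; rewrite !inE; case: eqVneq => [->|] /=.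
- by rewrite eS.
- by rewrite addbF.
- by rewrite (negbTE eS).
- by rewrite addbF.
Qed.

Lemma toggleK e : involutive (toggle e).
Proof. by move=> S; apply/fsetP => x; rewrite !in_toggle -addbA addbb addbF. Qed.

Lemma toggleC e e' S : toggle e (toggle e' S) = toggle e' (toggle e S).
Proof. by apply/fsetP => x; rewrite !in_toggle addbAC. Qed.

(** [(cos_ k, sin_ k)] are unit vectors tending to [(1, 0)], with [cos_ k < 1]. *)
Definition tt_ k : R := k.+1%:R^-1.
Definition cos_ k : R := (1 - tt_ k ^+ 2) / (1 + tt_ k ^+ 2).
Definition sin_ k : R := (2 * tt_ k) / (1 + tt_ k ^+ 2).

Lemma tt_gt0 k : 0 < tt_ k. Proof. by rewrite invr_gt0. Qed.

Lemma tt_le1 k : tt_ k <= 1. Proof. by rewrite invf_le1// ler1n. Qed.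

Lemma cos2Dsin2_ k : cos_ k ^+ 2 + sin_ k ^+ 2 = 1.
Proof.
rewrite /cos_ /sin_; have : 1 + tt_ k ^+ 2 != 0 by rewrite gt_eqF// ltr_wpDr ?sqr_ge0.
by move: (tt_ k) => t t0; field.
Qed.

Lemma cos_ge0 k : 0 <= cos_ k.
Proof.
apply: divr_ge0; last by rewrite addr_ge0 ?sqr_ge0.
by rewrite subr_ge0 exprn_ile1 ?tt_le1// ltW// tt_gt0.
Qed.

Lemma cos_lt1 k : cos_ k < 1.
Proof.
rewrite ltr_pdivrMr ?ltr_wpDr ?sqr_ge0// mul1r.
by have := exprn_gt0 2 (tt_gt0 k); lra.
Qed.

Lemma sin_ge0 k : 0 <= sin_ k.
Proof. by rewrite divr_ge0 ?addr_ge0 ?sqr_ge0// mulr_ge0// ltW// tt_gt0. Qed.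

Lemma sin_le1 k : sin_ k <= 1.
Proof.
rewrite ler_pdivrMr ?ltr_wpDr ?sqr_ge0// mul1r.
by have := sqr_ge0 (1 - tt_ k); lra.
Qed.

Lemma one_sub_cos_le k : 1 - cos_ k <= 2 * tt_ k.
Proof.
rewrite lerBlDr -lerBlDl ler_pdivlMr ?ltr_wpDr ?sqr_ge0//.
have := tt_le1 k; have := tt_gt0 k; move: (tt_ k) => t t0 t1.
rewrite -subr_ge0 (_ : _ - _ = 2 * (t * (1 - t + t ^+ 2))); last by ring.
by rewrite !mulr_ge0 ?(ltW t0)// addr_ge0 ?sqr_ge0// subr_ge0.
Qed.

Lemma sin_le k : sin_ k <= 2 * tt_ k.
Proof.
rewrite ler_pdivrMr ?ltr_wpDr ?sqr_ge0//; apply: ler_peMr.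
  by rewrite mulr_ge0// ltW// tt_gt0.
by rewrite lerDl sqr_ge0.
Qed.

(** On functions of the sets [S] not containing [e] and of [e |` S], the matrix of
    [refl e] is the reflection [[cos, sin], [sin, - cos]]; reflections for different
    [e] commute. *)
Definition refl e f : Om -> C := fun w =>
  ((-1) ^+ (e \in w.2) * cos_ w.1)%:C * f w + (sin_ w.1)%:C * f (w.1, toggle e w.2).

Lemma refl_linear e : linear (refl e).
Proof.
move=> c f f'; apply/funext => w; rewrite /refl !fctE /=.
by move: (_%:C) (_%:C) => a b; rewrite /GRing.scale /=; ring.
Qed.

Lemma reflK e f : refl e (refl e f) = f.
Proof.
apply/funext => -[k S]; rewrite /refl /= toggleK in_toggle eqxx addbT.
have cs : (cos_ k)%:C ^+ 2 + (sin_ k)%:C ^+ 2 = 1 :> C.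
  by rewrite -!rmorphXn -rmorphD /= cos2Dsin2_.
rewrite -[RHS]mul1r -cs.
by case: (e \in S); rewrite /= ?expr0 ?expr1 ?mul1r ?mulN1r ?rmorphN; ring.
Qed.

Lemma reflC e e' f : refl e (refl e' f) = refl e' (refl e f).
Proof.
have [->//|ee'] := eqVneq e e'.
apply/funext => -[k S]; rewrite /refl /= toggleC !in_toggle (negbTE ee') eq_sym (negbTE ee').
by rewrite !addbF; ring.
Qed.

(** After closing [A] under toggling [e], the sum runs over pairs of points on which [refl e] acts
    by an orthogonal matrix. *)
Lemma refl_contractive e : contractive (refl e).
Proof.
move=> f A; pose tau (w : Om) : Om := (w.1, toggle e w.2).
have tauK : involutive tau by move=> [k S]; rewrite /tau /= toggleK.
pose B := (A `|` [fset tau w | w in A])%fset; exists B.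
have tauB : perm_eq (map tau B) B.
  apply: uniq_perm; rewrite ?map_inj_uniq ?fset_uniq//; first exact: can_inj tauK.
  move=> w; apply/mapP/idP => [[v vB ->]|wB].
    move: vB; rewrite !inE => /orP[vA|/imfsetP[u /= uA ->]].
      by apply/orP; right; apply/imfsetP; exists v.
    by rewrite tauK uA.
  exists (tau w); rewrite ?tauK//; move: wB; rewrite !inE => /orP[vA|/imfsetP[u /= uA ->]].
      by apply/orP; right; apply/imfsetP; exists w.
    by rewrite tauK uA.
have sumtau (F : Om -> R) : \sum_(w <- B) F (tau w) = \sum_(w <- B) F w.
  by rewrite -[RHS](perm_big _ tauB) big_map.
apply: le_trans (_ : \sum_(w <- B) sqnormc (refl e f w) <= _).
  by apply: ler_sum_fset; [move=> x; exact: sqnormc_ge0 | exact: fsubsetUl].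
(* Doubling the sum through [tau] pairs [w] with [tau w] without choosing representatives of the
   orbits. *)
rewrite -(@ler_pMn2r _ 2)// !mulr2n -{2}sumtau -{2}[in leRHS]sumtau -!big_split /=.
apply: ler_sum => -[k S] _; rewrite /refl /tau /= toggleK in_toggle eqxx addbT.
have := cos2Dsin2_ k; move: (f (k, S)) (f (k, toggle e S)) (cos_ k) (sin_ k).
move=> [a b] [a' b'] c s cs.
rewrite le_eqVlt; apply/orP; left; apply/eqP.
rewrite -[RHS]mul1r -[X in _ = X * _]cs /sqnormc /=.
by case: (e \in S); rewrite /= ?expr0 ?expr1; ring.
Qed.

Definition perm_fun g f : Om -> C :=
  fun w => f (w.1, [fset act g^-1%g x | x in w.2]%fset).

Lemma in_act_fset g e S :
  (e \in [fset act g^-1%g x | x in S]%fset) = (act g e \in S).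
Proof.
apply/imfsetP/idP => [[x xS ->]|gS]; first by rewrite actVK.
by exists (act g e); rewrite ?actK.
Qed.

Lemma perm_fun_linear g : linear (perm_fun g).
Proof. by move=> c f f'. Qed.

Lemma perm_fun1 f : perm_fun 1%g f = f.
Proof.
apply/funext => -[k S]; rewrite /perm_fun /=; congr (f (k, _)).
by apply/fsetP => x; rewrite in_act_fset act1.
Qed.

Lemma perm_funM g h f : perm_fun (g * h)%g f = perm_fun g (perm_fun h f).
Proof.
apply/funext => -[k S]; rewrite /perm_fun /=; congr (f (k, _)).
by apply/fsetP => x; rewrite !in_act_fset actM.
Qed.

Lemma perm_fun_refl g e f :
  perm_fun g (refl e f) = refl (act g e) (perm_fun g f).
Proof.
apply/funext => -[k S]; rewrite /perm_fun /refl /= in_act_fset.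
congr (_ + _ * f (k, _)); apply/fsetP => x; rewrite in_toggle !in_act_fset in_toggle.
by rewrite (can_eq (actK g)).
Qed.

Lemma perm_fun_contractive g : contractive (perm_fun g).
Proof.
move=> f A; pose sg (w : Om) : Om := (w.1, [fset act g^-1%g x | x in w.2]%fset).
have sgI : injective sg.
  move=> [k S] [k' S'] [-> SS']; congr (_, _); apply/fsetP => x.
  by rewrite -[x](actVK g) -!in_act_fset SS'.
exists [fset sg w | w in A]%fset.
have sgA : perm_eq [fset sg w | w in A]%fset (map sg A).
  apply: uniq_perm; rewrite ?map_inj_uniq ?fset_uniq// => w.
  by apply/imfsetP/mapP => -[v vA ->]; exists v.
by rewrite (perm_big _ sgA) big_map.
Qed.

Definition refls (l : seq E) f := foldr refl f l.

Lemma refls_cat l l' f : refls (l ++ l') f = refls l (refls l' f).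
Proof. exact: foldr_cat. Qed.

Lemma refls_perm l l' f : perm_eq l l' -> refls l f = refls l' f.
Proof.
elim: l l' => [|e l IH] l'; first by rewrite perm_sym => /perm_nilP ->.
move=> ll'; have : e \in l' by rewrite -(perm_mem ll') mem_head.
move: ll' => /[swap] /path.splitPr[l1 l2]; rewrite perm_sym.
rewrite -cat1s perm_catCA /= perm_cons perm_sym => /IH {}IH.
rewrite /= IH; elim: l1 {IH} => //= e' l1 <-; exact: reflC.
Qed.

Lemma refls_even l f : (forall e, ~~ odd (count_mem e l)) -> refls l f = f.
Proof.
move: {2}(size l).+1 (ltnSn (size l)) => n; elim: n l => // n IH [//|e l] /= ln even.
have el : e \in l.
  have := even e; rewrite eqxx /= negbK => /odd_gt0.
  by rewrite -has_count has_pred1.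
rewrite (refls_perm f (perm_to_rem el)) /= reflK; apply: IH.
  by rewrite size_rem//; case: l el ln {even} => //= x l _ /ltnW.
move=> x; have := even x; rewrite (permP (perm_to_rem el)) /=.
by rewrite addnA oddD; case: (e == x).
Qed.

(** Reflections are commuting involutions, so only the parity of each multiplicity matters;
    concatenating lists thus computes symmetric differences. *)
Lemma refls_parity l l' f :
  (forall e, odd (count_mem e l) = odd (count_mem e l')) -> refls l f = refls l' f.
Proof.
move=> ll'; transitivity (refls (l ++ (l ++ l')) f).
  rewrite refls_cat; congr refls; rewrite refls_even// => e.
  by rewrite count_cat oddD ll' addbb.
rewrite catA refls_cat refls_even// => e.
by rewrite count_cat oddD addbb.
Qed.

Lemma perm_fun_refls g l f :
  perm_fun g (refls l f) = refls (map (act g) l) (perm_fun g f).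
Proof. by elim: l => //= e l IH; rewrite perm_fun_refl IH. Qed.

Lemma refls_contractive l : contractive (refls l).
Proof.
elim: l => [|e l IH] f A; first by exists A.
exact: (contractive_comp (@refl_contractive e) IH).
Qed.

Lemma refls_linear l : linear (refls l).
Proof.
elim: l => // e l IH c f f'.
by rewrite -[LHS]/(refl e (refls l _)) IH refl_linear.
Qed.

(** The product of the reflections over [D g] is a cocycle, because [D (g * h)] is
    the symmetric difference of [D g] and [act g (D h)].  As [k] grows the delta
    functions at [(k, fset0)] become almost invariant, while a factor [cos_ k] for
    each element of [D g] makes matrix coefficients vanish along [g]. *)
Definition rep_fun g f := refls (D g) (perm_fun g f).

Lemma rep_funM g h f : rep_fun (g * h)%g f = rep_fun g (rep_fun h f).
Proof.
rewrite /rep_fun perm_fun_refls -refls_cat perm_funM; apply: refls_parity => e.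
rewrite count_cat oddD !count_uniq_mem ?map_inj_uniq//; last exact: can_inj (actK g).
have -> : (e \in map (act g) (D h)) = (act g^-1%g e \in D h).
  by rewrite -[e in LHS](actVK g) mem_map//; exact: can_inj (actK g).
by rewrite !oddb !D_mem invgM actM /= addbA addbK.
Qed.

Lemma rep_fun1 f : rep_fun 1%g f = f.
Proof.
rewrite /rep_fun perm_fun1 (_ : D 1%g = [::])//.
apply/eqP; rewrite -size_eq0 -leqn0 leqNgt; apply/negP; case: (D _) (D_mem 1%g) => // e l.
by move=> /(_ e); rewrite mem_head invg1 act1 addbb.
Qed.

Lemma rep_fun_contractive g : contractive (rep_fun g).
Proof. exact: contractive_comp (@refls_contractive _) (@perm_fun_contractive g). Qed.

Local Notation Hs := (@l2 R Om).

Definition rep g : Hs -> Hs := l2_map (@rep_fun_contractive g).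

Lemma rep_linear g : linear (rep g).
Proof.
move=> c u v; apply: l2P => w.
by rewrite /rep /l2_map /= /rep_fun perm_fun_linear refls_linear.
Qed.

HB.instance Definition _ g :=
  GRing.isLinear.Build C Hs Hs *:%R (rep g) (rep_linear g).

Lemma repM g h u : rep (g * h)%g u = rep g (rep h u).
Proof. by apply: l2P => w; rewrite /rep /= rep_funM. Qed.

Lemma rep1 u : rep 1%g u = u.
Proof. by apply: l2P => w; rewrite /rep /= rep_fun1. Qed.

Lemma rep_norm g u : `|rep g u| = `|u|.
Proof.
apply/eqP; rewrite eq_le l2_map_norm /= -{1}[u]rep1 -(mulVg g) repM.
exact: l2_map_norm.
Qed.

Lemma rep_dot g u v : l2_dot (rep g u) (rep g v) = l2_dot u v.
Proof.
apply: (isometry_dot (form := @l2_dot R Om)) => {}u.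
have := congr1 (fun z => z ^+ 2) (rep_norm g u).
by rewrite !l2_normE !sqrtCK.
Qed.

Definition urep : unitary_action Gam (@l2_hilbert R Om) :=
  @UnitaryAction R Gam (@l2_hilbert R Om) rep rep1 repM rep_dot.

Lemma delta_perm g k S : perm_fun g (delta_fun R (k, S)) =
  delta_fun R (k, [fset act g x | x in S]%fset).
Proof.
apply/funext => -[k' S']; rewrite /perm_fun /delta_fun /= !xpair_eqE.
congr ((_ && _)%:R); apply/eqP/eqP => [<-|->].
  apply/fsetP => x; rewrite -[RHS]/(x \in [fset act g x | x in _]%fset).
  apply/idP/imfsetP => [xS|[y /= + ->]]; last by rewrite in_act_fset.
  by exists (act g^-1%g x); rewrite ?in_act_fset ?actVK.
apply/fsetP => x; rewrite in_act_fset; apply/imfsetP/idP => [[y yS /(can_inj (actK g)) ->]//|xS].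
by exists x.
Qed.

Definition reflL e : Hs -> Hs := l2_map (@refl_contractive e).

Lemma reflLE e u w : reflL e u w = refl e u w. Proof. by []. Qed.

Lemma reflL_delta e w : reflL e (delta R w) =
  ((-1) ^+ (e \in w.2) * cos_ w.1)%:C *: delta R w +
  (sin_ w.1)%:C *: delta R (w.1, toggle e w.2).
Proof.
apply: l2P => -[k' S']; rewrite l2DE !l2ZE reflLE /refl !deltaE /=.
case: w => k S /=; rewrite !xpair_eqE; case: (eqVneq k' k) => [->|] /=; last by rewrite !mulr0.
congr (_ + _).
  by case: (eqVneq S' S) => [->//|]; rewrite !mulr0.
by rewrite (can2_eq (toggleK e) (toggleK e)).
Qed.

Lemma reflL_delta_le e k : `|reflL e (delta R (k, fset0)) - delta R (k, fset0)| <= (4 * tt_ k)%:C.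
Proof.
rewrite reflL_delta in_fset0 expr0 mul1r addrAC -[X in _ - X]scale1r -scalerBl.
apply: le_trans (ler_normD _ _) _; rewrite !normrZ /=.
apply: (@le_trans _ _ (`|(cos_ k)%:C - 1| * 1 + `|(sin_ k)%:C| * 1)).
  by rewrite lerD// ler_wpM2l// norm_delta_le.
rewrite !mulr1 distrC -(rmorph1 (real_complex R)) -rmorphB /=.
rewrite !ger0_norm ?lecR ?ler0c ?sin_ge0 ?subr_ge0 ?(ltW (cos_lt1 k))//.
rewrite -rmorphD lecR (_ : 4 * tt_ k = 2 * tt_ k + 2 * tt_ k); last by ring.
by rewrite lerD ?one_sub_cos_le ?sin_le.
Qed.

Definition reflsL (l : seq E) (u : Hs) : Hs := foldr reflL u l.

Lemma reflsLE l u : reflsL l u = refls l u :> (Om -> C).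
Proof. by elim: l => //= e l <-. Qed.

Lemma reflsL_le (a : R) l u : (forall e, `|reflL e u - u| <= a%:C) ->
  `|reflsL l u - u| <= ((size l)%:R * a)%:C.
Proof.
move=> ua; elim: l => [|e l IH] /=; first by rewrite subrr normr0 mul0r.
have -> : reflL e (reflsL l u) - u = reflL e (reflsL l u - u) + (reflL e u - u).
  apply: l2P => w; rewrite !(l2DE, l2NE) !reflLE /refl !(l2DE, l2NE).
  by move: (_%:C) (_%:C) => x y; ring.
apply: le_trans (ler_normD _ _) _.
rewrite -natr1 mulrDl mul1r rmorphD /= lerD//.
exact: le_trans (l2_map_norm _ _) IH.
Qed.

Lemma refls_delta_eq0 (l : seq E) (k k' : nat) (T S : {fset E}) e :
  e \notin l -> (e \in S) != (e \in T) ->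
  refls l (delta_fun R (k, T)) (k', S) = 0.
Proof.
elim: l S => [|e' l IH] S /=.
  move=> _ ST; rewrite /delta_fun xpair_eqE (_ : S == T = false) ?andbF//.
  by apply: contraNF ST => /eqP ->.
rewrite inE negb_or => /andP[ee' el] ST; rewrite /refl !IH ?mulr0 ?addr0//.
by rewrite in_toggle (negbTE ee') addbF.
Qed.

Lemma refls_delta_fiber (l : seq E) (k k' : nat) (T S : {fset E}) : k' != k ->
  refls l (delta_fun R (k, T)) (k', S) = 0.
Proof.
move=> kk'; elim: l S => [|e l IH] S /=; last by rewrite /refl !IH ?mulr0 ?addr0.
by rewrite /delta_fun xpair_eqE (negbTE kk').
Qed.

(** The coefficient is a product of matrix entries, one for each element of [l]: up to sign [cos_ k]
    where [S] and [T] agree, [sin_ k] where they differ. All entries are at most 1, and only those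
    of elements outside both sets are kept. *)
Lemma refls_delta_le_count (l : seq E) (k : nat) (T S : {fset E}) : uniq l ->
  `|refls l (delta_fun R (k, T)) (k, S)| <=
    (cos_ k ^+ count [pred e | (e \notin S) && (e \notin T)] l)%:C.
Proof.
have c1 := ltW (cos_lt1 k); have c0 := cos_ge0 k.
elim: l S => [|e l IH] S /=.
  by move=> _; rewrite expr0 /delta_fun; case: eqP => _; rewrite ?normr1 ?normr0 ?ler01.
move=> /andP[el ul]; rewrite /refl /=.
have [ST|ST] := eqVneq (e \in S) (e \in T).
  rewrite (@refls_delta_eq0 l k k T (toggle e S) e)//; last first.
    by rewrite in_toggle eqxx addbT ST; case: (_ \in _).
  have -> : `|((-1) ^+ (e \in S) * cos_ k)%:C * refls l (delta_fun R (k, T)) (k, S) +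
      (sin_ k)%:C * 0| = (cos_ k)%:C * `|refls l (delta_fun R (k, T)) (k, S)|.
    rewrite mulr0 addr0 normrM rmorphM /= normrM rmorph_sign normr_sign mul1r.
    by rewrite ger0_norm ?ler0c.
  rewrite exprD [leRHS](rmorphM (real_complex R)) /=.
  apply: ler_pM; [by rewrite ler0c|exact: normr_ge0| |exact: IH].
  by rewrite lecR ST; case: (_ \in _); rewrite /= ?expr0 ?expr1.
rewrite (@refls_delta_eq0 l k k T S e)// mulr0 add0r normrM.
have -> : ((e \notin S) && (e \notin T)) = false.
  by move: ST; case: (e \in S); case: (e \in T).
rewrite add0n ger0_norm ?ler0c ?sin_ge0//.
apply: le_trans (_ : 1 * `|refls l (delta_fun R (k, T)) (k, toggle e S)| <= _).
  by rewrite ler_wpM2r// -(rmorph1 (real_complex R)) lecR sin_le1.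
rewrite mul1r; apply: le_trans (IH _ ul) _; rewrite lecR le_eqVlt; apply/orP; left.
apply/eqP; congr (_ ^+ _); apply: eq_in_count => x xl /=; rewrite in_toggle.
by rewrite (_ : x == e = false) ?addbF//; apply: contraNF el => /eqP <-.
Qed.

Lemma count_fset_le (S : {fset E}) l : uniq l -> (count (mem S) l <= #|` S|)%N.
Proof.
move=> ul; rewrite -size_filter; apply: uniq_leq_size; first exact: filter_uniq.
by move=> x; rewrite mem_filter => /andP[].
Qed.

Lemma refls_delta_le (l : seq E) (k : nat) (T S : {fset E}) N :
  uniq l -> (N + #|` S| + #|` T| <= size l)%N ->
  `|refls l (delta_fun R (k, T)) (k, S)| <= (cos_ k ^+ N)%:C.
Proof.
move=> ul lN; apply: le_trans (refls_delta_le_count _ _ _ ul) _; rewrite lecR.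
apply: ler_wiXn2l; rewrite ?cos_ge0 ?(ltW (cos_lt1 k))//.
have := count_predC [pred e | (e \notin S) && (e \notin T)] l.
have : (count (predC [pred e | (e \notin S) && (e \notin T)]) l <= #|` S| + #|` T|)%N.
  rewrite (eq_count (a2 := predU (mem S) (mem T))); last first.
    by move=> x /=; rewrite negb_and !negbK.
  apply: (@leq_trans (count (mem S) l + count (mem T) l)).
    by rewrite -count_predUI leq_addr.
  by rewrite leq_add ?count_fset_le.
lia.
Qed.

Context (D_unbounded : forall m, exists g, (m <= size (D g))%N).

Lemma l2_CauchySchwarz (u v : Hs) : `|l2_dot u v| <= `|u| * `|v|.
Proof.
rewrite -(@ler_pXn2r _ 2)// ?nnegrE ?mulr_ge0// exprMn !l2_normE !sqrtCK.
exact: (dot_CauchySchwarz (@l2_dot R Om)).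
Qed.

Lemma rep_delta_le g (k : nat) (S0 : {fset E}) (w : Om) N :
  (N + #|` w.2| + #|` S0| <= size (D g))%N ->
  `|rep g (delta R (k, S0)) w| <= (cos_ k ^+ N)%:C.
Proof.
move=> gN; rewrite -[rep g _ w]/(refls (D g) (perm_fun g (delta_fun R (k, S0))) w).
rewrite delta_perm; case: w gN => [k' S] /= gN; have [->|kk'] := eqVneq k' k.
  apply: refls_delta_le => //; rewrite card_imfset//=; exact: can_inj (actK g).
by rewrite refls_delta_fiber// normr0 ler0c exprn_ge0// cos_ge0.
Qed.

(** For every [g], the coordinate [v w0] of an invariant vector is its inner product with
    [rep g (delta R w0)]. That vector becomes small at any finite set of points as [D g] grows, and
    [v] is nearly supported on such a set. *)
Lemma rep_invariant0 (v : Hs) : (forall g, rep g v = v) -> v = 0.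
Proof.
move=> vinv; apply: l2P => -[k S0]; apply/eqP; apply: contraT => v0.
set w0 := (k, S0) in v0 *.
have /gtc0_real[a va a0] : 0 < `|v w0| by rewrite normr_gt0.
have a3 : 0 < a / 3 by rewrite divr_gt0.
have [A vA] := l2_finite_approx v a3.
pose m := \sum_(w <- A) Normc.normc (v w).
have [N Nm] : exists N, m * cos_ k ^+ N < a / 3.
  have : m * cos_ k ^+ n @[n --> \oo] --> m * 0.
    by apply: cvgMl_tmp; apply: cvg_expr; rewrite ger0_norm ?cos_ge0 ?cos_lt1.
  move=> /cvgrPdist_lt/(_ _ a3)[N _ /(_ N (leqnn N))] /=.
  rewrite mulr0 sub0r normrN => /(le_lt_trans (ler_norm _)) ?.
  by exists N.
(* At every point of [A], at least [N] elements of [D g] then avoid both finite sets of the matrix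
   coefficient. *)
have [g gN] := D_unbounded (N + \sum_(w <- A) #|` w.2| + #|` S0|).
pose u := rep g (delta R w0).
have vwE : v w0 = l2_dot v u by rewrite -dot_delta -(rep_dot g) vinv.
pose vs := \sum_(w <- A) v w *: delta R w.
have : `|v w0| < a%:C.
  have -> : v w0 = l2_dot (v - vs) u + l2_dot vs u.
    by rewrite vwE -linearDl subrK.
  apply: le_lt_trans (ler_normD _ _) _.
  have -> : a%:C = (a / 3)%:C + (a / 3 + a / 3)%:C :> C.
    by rewrite -rmorphD /=; congr (_%:C); field.
  apply: ler_ltD.
    apply: le_trans (l2_CauchySchwarz _ _) _.
    rewrite -[leRHS]mulr1; apply: ler_pM => //.
    by rewrite rep_norm norm_delta_le.
  have -> : l2_dot vs u = \sum_(w <- A) v w * l2_dot (delta R w) u.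
    rewrite /vs; elim/big_rec2: _ => [|w x y _ <-]; first exact: linear0l.
    by rewrite linearDl linearZl_LR.
  apply: le_lt_trans (ler_norm_sum _ _ _) _.
  apply: (@le_lt_trans _ _ (m * cos_ k ^+ N)%:C); last first.
    by rewrite ltcR (lt_trans Nm)// ltrDl.
  rewrite /m mulr_suml rmorph_sum /= big_seq [leRHS]big_seq.
  apply: ler_sum => w wA; rewrite rmorphM /= normrM ler_wpM2l//.
  rewrite l2_dotC dot_delta normcJ; apply: rep_delta_le.
  apply: leq_trans gN; rewrite leq_add2r leq_add2l (big_fsetD1 w)//=.
  exact: leq_addr.
by rewrite va ltxx.
Qed.

Lemma norm_delta (w : Om) : `|delta R w| = 1 :> C.
Proof. by rewrite l2_normE dot_delta deltaE eqxx sqrtC1. Qed.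

Theorem not_property_T : ~ property_T R Gam.
Proof.
move=> /(_ _ urep)[K eps eps0|v [v0 vinv]]; last first.
  by move/eqP: v0; apply; apply: rep_invariant0.
pose M := \max_(g <- K) size (D g).
(* At most [M] reflections act for [g] in [K], and each moves the delta function by at most
   [4 * tt_ k]. *)
have [k kP] : exists k, M%:R * (4 * tt_ k) < eps.
  exists (Num.bound (eps^-1 * (M%:R * 4))); rewrite /tt_ mulrA ltr_pdivrMr ?ltr0n//.
  rewrite -ltr_pdivrMl//; apply: lt_trans (archi_boundP _) _.
    by rewrite mulr_ge0 ?mulr_ge0// invr_ge0 ltW.
  by rewrite ltr_nat.
exists (delta R (k, fset0)); split.
  by rewrite -normr_eq0 norm_delta oner_eq0.
move=> g gK; rewrite norm_delta mulr1.
have -> : urep g (delta R (k, fset0)) = reflsL (D g) (delta R (k, fset0)).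
  apply: l2P => w; rewrite reflsLE.
  rewrite -[LHS]/(refls (D g) (perm_fun g (delta_fun R (k, fset0))) w) delta_perm.
  by rewrite imfset0.
apply: le_lt_trans (reflsL_le _ (reflL_delta_le ^~ k)) _.
rewrite ltcR; apply: le_lt_trans kP.
rewrite ler_wpM2r ?mulr_ge0// ?(ltW (tt_gt0 k))// ler_nat.
exact: leq_bigmax_seq.
Qed.

End CommensuratedSubset.

Local Open Scope group_scope.

(** * Normal forms in graph products *)

Section TraceModel.
Context (I : choiceType) (G : I -> groupType) (adj : rel I).
Context (adj_irr : irreflexive adj) (adj_sym : symmetric adj).

Local Notation letter := {i : I & G i}.
Local Notation word := (seq letter).
Local Notation table := (I -> I -> word).
Implicit Types (T : table) (w : word) (i j k : I).

(** The table of a word records, for all nonadjacent [i] and [j] (possibly equal),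
    the word obtained by keeping its letters in [G i] and [G j]; it is unchanged
    when neighbouring letters of adjacent types are swapped. *)
Definition touches i j k := ~~ adj i j && ((i == k) || (j == k)).

Definition tcons (a : letter) T : table :=
  fun i j => if touches i j (tag a) then a :: T i j else T i j.

Definition tstrip k T : table :=
  fun i j => if touches i j k then behead (T i j) else T i j.

Definition tnil : table := fun _ _ => [::].

Definition trace w := foldr tcons tnil w.

(** In the table of a word, such a letter can be shuffled to the front: nothing of its own or of a
    nonadjacent type precedes it. *)
Definition is_head T (a : letter) :=
  forall j, ~~ adj (tag a) j -> ohead (T (tag a) j) = Some a.

Definition headless i T := forall g : G i, ~ is_head T (Tagged G g).

Definition thead i T : G i :=
  if pselect (exists g : G i, is_head T (Tagged G g)) is left e
  then sval (cid e) else 1.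

Definition tcons1 i (g : G i) T := if g == 1 then T else tcons (Tagged G g) T.

Fixpoint reduced w : Prop :=
  if w is a :: w' then
    [/\ tagged a != 1, headless (tag a) (trace w') & reduced w'] else True.

(** The action laws of [tact] are proved on these tables, where a head can be stripped and put back
    without loss. *)
Definition reachable T := exists2 w, reduced w & T = trace w.

Lemma is_head_inj i T (g h : G i) :
  is_head T (Tagged G g) -> is_head T (Tagged G h) -> g = h.
Proof.
move=> gT hT; have /= := gT i; have /= := hT i; rewrite adj_irr.
move=> /(_ isT) -> /(_ isT) e; have /= := congr1 (odflt (Tagged G g)) e.
by move/eqP; rewrite eq_Tagged => /eqP.
Qed.

Lemma theadE i T (g : G i) : is_head T (Tagged G g) -> thead i T = g.
Proof.
move=> gT; rewrite /thead; case: pselect => [e|[]]; last by exists g.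
by case: (cid e) => h /= hT; exact: is_head_inj hT gT.
Qed.

Lemma thead_headless i T : headless i T -> thead i T = 1.
Proof. by move=> T0; rewrite /thead; case: pselect => // -[g gT]; case: (T0 g gT). Qed.

Lemma headless_trace0 i : headless i tnil.
Proof. by move=> g /(_ i) /=; rewrite adj_irr => /(_ isT). Qed.

Lemma is_head_tcons i T (g : G i) : is_head (tcons (Tagged G g) T) (Tagged G g).
Proof. by move=> j /= ij; rewrite /tcons /touches /= ij eqxx. Qed.

Lemma thead_tcons1 i T (g : G i) : headless i T -> thead i (tcons1 g T) = g.
Proof.
rewrite /tcons1; case: eqP => [->|_] T0; first exact: thead_headless.
by apply: theadE; exact: is_head_tcons.
Qed.

Lemma tstrip_tcons i (g : G i) T : tstrip i (tcons (Tagged G g) T) = T.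
Proof.
by apply/funext => j; apply/funext => k; rewrite /tstrip /tcons /=; case: touches.
Qed.

Lemma adj_neq i j : adj i j -> i != j.
Proof. by apply: contraTneq => ->; rewrite adj_irr. Qed.

Lemma is_head_adj i j T (g : G i) (h : G j) : adj i j ->
  is_head (tcons1 h T) (Tagged G g) <-> is_head T (Tagged G g).
Proof.
move=> ij; rewrite /tcons1; case: eqP => // _.
split=> gT k /= ik; have := gT k ik; rewrite /= /tcons /touches /= ik (negbTE (adj_neq ij)) /=;
  by rewrite (_ : k == j = false)//; apply: contraNF ik => /eqP ->.
Qed.

Lemma headless_adj i j T (h : G j) : adj i j ->
  headless i (tcons1 h T) <-> headless i T.
Proof. by move=> ij; split=> T0 g /(is_head_adj _ _ _ ij)/T0. Qed.

Lemma thead_adj i j T (h : G j) : adj i j -> thead i (tcons1 h T) = thead i T.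
Proof.
move=> ij; have [[g gT]|T0] := pselect (exists g : G i, is_head T (Tagged G g)).
  by rewrite (theadE gT); apply/theadE/(is_head_adj _ _ _ ij).
have {}T0 : headless i T by move=> g gT; apply: T0; exists g.
by rewrite !thead_headless//; apply/(headless_adj _ _ ij).
Qed.

Lemma headless_nonadj i j T (h : G j) : i != j -> ~~ adj i j -> h != 1 ->
  headless i (tcons1 h T).
Proof.
move=> ij Nij h1 g /(_ j Nij); rewrite /tcons1 (negbTE h1) /tcons /touches /= Nij eqxx orbT /=.
by move=> [ji _]; rewrite ji eqxx in ij.
Qed.

Lemma tcons1C i j T (g : G i) (h : G j) : adj i j ->
  tcons1 g (tcons1 h T) = tcons1 h (tcons1 g T).
Proof.
move=> ij; rewrite /tcons1; case: eqP; case: eqP => // _ _.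
apply/funext => k; apply/funext => l; rewrite /tcons /=.
(* Adjacent types never share a row, so the two insertions change different entries. *)
have : ~~ (touches k l i && touches k l j).
  apply/negP => /andP[/andP[kl ki] /andP[_ kj]]; move: kl ki kj.
  have ij' := adj_neq ij; case: (eqVneq k i) => [->|_] /=.
    move=> Nil _; rewrite (negbTE ij') => /eqP lj; by rewrite lj ij in Nil.
  move=> Nkl /eqP li; rewrite li (negbTE ij') orbF => /eqP kj.
  by rewrite kj li adj_sym ij in Nkl.
by case: (touches k l i); case: (touches k l j).
Qed.

Lemma reachable_tcons1 i T (g : G i) : reachable T -> headless i T ->
  reachable (tcons1 g T).
Proof.
move=> [w rw ->] T0; rewrite /tcons1; case: eqP => [_|/eqP g1]; first by exists w.
by exists (Tagged G g :: w).
Qed.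

(** The letters in front of [g] have types adjacent to [i], so [g] moves past them one at a time. *)
Lemma reachable_is_head i T (g : G i) : reachable T -> is_head T (Tagged G g) ->
  [/\ g != 1, reachable (tstrip i T), headless i (tstrip i T) &
      T = tcons1 g (tstrip i T)].
Proof.
move=> [w rw ->]; elim: w rw => [|[j h] w IH] /=.
  by move=> _ /(_ i) /=; rewrite adj_irr => /(_ isT).
move=> [h1 w0 rw] gT.
have [ij|ij] := eqVneq i j.
  move: h h1 w0 gT; rewrite -ij /= => h h1 w0 gT.
  have -> : g = h by apply: is_head_inj gT _; exact: is_head_tcons.
  rewrite tstrip_tcons; split=> //; first by exists w.
  by rewrite /tcons1 (negbTE h1).
have [Aij|Nij] := boolP (adj i j); last first.
  have := @headless_nonadj i j (trace w) h ij Nij h1 g.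
  by rewrite /tcons1 (negbTE h1) => /(_ gT).
have consE T' : tcons (existT _ j h) T' = tcons1 h T' by rewrite /tcons1 (negbTE h1).
move: gT; rewrite consE => /(is_head_adj _ _ _ Aij) /(IH rw)[g1 rS S0 wE].
have -> : tstrip i (tcons1 h (trace w)) = tcons1 h (tstrip i (trace w)).
  by rewrite {1}wE tcons1C 1?adj_sym// /tcons1 (negbTE g1) tstrip_tcons.
split=> //.
- apply: reachable_tcons1 => //; have ji : adj j i by rewrite adj_sym.
  by apply/(@headless_adj j i _ g ji); rewrite -wE.
- by apply/(headless_adj _ _ Aij).
- by rewrite tcons1C// -wE.
Qed.

(** Van der Waerden's device: the vertex groups act on normal forms, so that heads become
    well-defined functions on the group. A headless table is not stripped, since [tstrip] would drop
    letters of other types from the rows it shares with them. *)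
Definition tact i (g : G i) T :=
  tcons1 (g * thead i T) (if thead i T == 1 then T else tstrip i T).

Lemma tact_tcons1 i (g h : G i) T : headless i T ->
  tact g (tcons1 h T) = tcons1 (g * h) T.
Proof.
move=> T0; rewrite /tact thead_tcons1//; case: eqP => [->|/eqP h1].
  by rewrite /tcons1 eqxx.
by rewrite {2}/tcons1 (negbTE h1) tstrip_tcons.
Qed.

Lemma reachable_dec i T : reachable T ->
  exists (h : G i) T', [/\ reachable T', headless i T' & T = tcons1 h T'].
Proof.
move=> rT; have [[g gT]|T0] := pselect (exists g : G i, is_head T (Tagged G g)).
  by have [_ ? ? ?] := reachable_is_head rT gT; exists g, (tstrip i T).
exists 1, T; split=> //; last by rewrite /tcons1 eqxx.
by move=> g gT; apply: T0; exists g.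
Qed.

Lemma reachable_tact i (g : G i) T : reachable T -> reachable (tact g T).
Proof.
move=> /(reachable_dec i)[h [T' [rT' T'0 ->]]].
by rewrite tact_tcons1//; exact: reachable_tcons1.
Qed.

Lemma tact1 i T : reachable T -> tact (1 : G i) T = T.
Proof. by move=> /(reachable_dec i)[h [T' [? ? ->]]]; rewrite tact_tcons1// mul1g. Qed.

Lemma tactM i (g h : G i) T : reachable T -> tact (g * h) T = tact g (tact h T).
Proof. by move=> /(reachable_dec i)[k [T' [? ? ->]]]; rewrite !tact_tcons1// mulgA. Qed.

Lemma tactC i j (g : G i) (h : G j) T : adj i j -> reachable T ->
  tact g (tact h T) = tact h (tact g T).
Proof.
move=> ij; have ji : adj j i by rewrite adj_sym.
move=> /(reachable_dec i)[a [T1 [/(reachable_dec j)[b [T2 [rT2 T2j ->]]] T1i ->]]].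
have T2i : headless i T2 by exact: (@headless_adj i j T2 b ij).1 T1i.
have hl (k : G i) : headless j (tcons1 k T2) by apply/(@headless_adj j i T2 k ji).
have hl' (k : G j) : headless i (tcons1 k T2) by apply/(@headless_adj i j T2 k ij).
rewrite [in RHS](tact_tcons1 g a)// tcons1C// (tact_tcons1 h b)// -tcons1C//.
by rewrite (tact_tcons1 g a)// [in RHS]tcons1C// tact_tcons1// tcons1C.
Qed.

Lemma thead_tact i (g : G i) T : reachable T -> thead i (tact g T) = g * thead i T.
Proof.
by move=> /(reachable_dec i)[k [T' [? ? ->]]]; rewrite tact_tcons1// !thead_tcons1.
Qed.

Lemma thead_tact_adj i j (g : G j) T : adj i j -> reachable T ->
  thead i (tact g T) = thead i T.
Proof.
move=> ij /(reachable_dec j)[k [T' [? ? ->]]].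
by rewrite tact_tcons1// !thead_adj.
Qed.

Lemma thead_tact_nonadj i j (g : G j) T : i != j -> ~~ adj i j -> reachable T ->
  thead j T = 1 -> g != 1 -> thead i (tact g T) = 1.
Proof.
move=> ij Nij /(reachable_dec j)[k [T' [rT' T'0 ->]]]; rewrite thead_tcons1// => -> g1.
by rewrite tact_tcons1// mulg1; apply/thead_headless/headless_nonadj.
Qed.

Definition tacts w T := foldr (fun a => tact (tagged a)) T w.

Lemma reachable_tacts w T : reachable T -> reachable (tacts w T).
Proof. by move=> rT; elim: w => //= a w; exact: reachable_tact. Qed.

Lemma tacts_cat w w' T : tacts (w ++ w') T = tacts w (tacts w' T).
Proof. exact: foldr_cat. Qed.

Lemma tacts_congr (w w' : fp_word G) T : congr_closure (@fp_rel I G) w w' ->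
  reachable T -> tacts w T = tacts w' T.
Proof.
move=> ww'; elim: ww' T => {w w'} [w w' [i|i g h]|//|w w' _ IH|w w' w'' _ IH _ IH'
  |w w' v v' _ IH _ IH'] T rT.
- exact: tact1.
- by rewrite /= tactM.
- by rewrite IH.
- by rewrite IH// IH'.
- rewrite -[LHS]/(tacts (w ++ v) T) -[RHS]/(tacts (w' ++ v') T) !tacts_cat.
  by rewrite IH'// IH//; exact: reachable_tacts.
Qed.

Definition fp_act (x : free_product G) T := tacts (repr x) T.

Lemma fp_act_pi (w : fp_word G) T : reachable T ->
  fp_act (\pi_(free_product G)%qT w) T = tacts w T.
Proof. by move=> rT; apply: tacts_congr rT; exact: congr_quot_reprP. Qed.

Lemma fp_actM x y T : reachable T -> fp_act (x * y) T = fp_act x (fp_act y T).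
Proof.
move=> rT; rewrite -[x]reprK -[y]reprK -congr_quot_piM !fp_act_pi//; last first.
  exact: reachable_tacts.
by rewrite -tacts_cat.
Qed.

Lemma reachable_fp_act x T : reachable T -> reachable (fp_act x T).
Proof. exact: reachable_tacts. Qed.

Lemma fp_act_in i (g : G i) T : reachable T -> fp_act (fp_in g) T = tact g T.
Proof. by move=> rT; rewrite fp_act_pi. Qed.

Lemma reachable0 : reachable tnil.
Proof. by exists [::]. Qed.

Lemma fp_ind (P : free_product G -> Prop) : P 1 ->
  (forall i (g : G i) x, P x -> P (fp_in g * x)) -> forall x, P x.
Proof.
move=> P1 PM x; rewrite -[x]reprK; elim: (repr x) => [|[i g] w IH]; first exact: P1.
have -> : (existT _ i g :: w : fp_word G) = (fp_letter g * w :> fp_word G)%g by [].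
by rewrite congr_quot_piM; apply: PM.
Qed.

End TraceModel.

(** [head i x] is the letter in [G i] that a reduced word for [x] can be made to
    start with, and [1] if there is none. *)
Record graph_product (I : finType) (G : I -> groupType) (adj : rel I)
    (W : groupType) := GraphProduct {
  inc : forall i, G i -> W;
  head : forall i, W -> G i;
  incM : forall i (g h : G i), inc (g * h) = inc g * inc h;
  incC : forall i j (g : G i) (h : G j), adj i j -> inc g * inc h = inc h * inc g;
  inc_ind : forall P : W -> Prop, P 1 ->
    (forall i (g : G i) x, P x -> P (inc g * x)) -> forall x, P x;
  head1 : forall i, head i 1 = 1;
  head_inc : forall i (g : G i) x, head i (inc g * x) = g * head i x;
  head_adj : forall i j (g : G j) x, adj i j -> head i (inc g * x) = head i x;
  head_nonadj : forall i j (g : G j) x, i != j -> ~~ adj i j -> g != 1 ->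
    head j x = 1 -> head i (inc g * x) = 1 }.

(** * Standard subgroups and word length *)

Section Words.
Context (I : finType) (G : I -> groupType) (adj : rel I).
Context (adj_irr : irreflexive adj) (adj_sym : symmetric adj).
Context (W : groupType) (gp : graph_product G adj W).
Local Notation inc := (inc gp).
Local Notation head := (head gp).
Implicit Types (i j k : I) (x y z s : W) (A B : pred I).

Lemma inc1 i : inc (1 : G i) = 1.
Proof. by apply: (mulgI (inc (1 : G i))); rewrite -incM !mulg1. Qed.

Lemma incV i (g : G i) : inc g^-1 = (inc g)^-1.
Proof. by apply: (mulgI (inc g)); rewrite -incM !mulgV inc1. Qed.

Lemma head_self i (g : G i) : head i (inc g) = g.
Proof. by rewrite -[inc g]mulg1 head_inc head1 mulg1. Qed.

Lemma head_other i j (g : G j) : i != j -> head i (inc g) = 1.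
Proof.
move=> ij; rewrite -[inc g]mulg1; have [Aij|Nij] := boolP (adj i j).
  by rewrite head_adj// head1.
have [->|g1] := eqVneq g 1; first by rewrite inc1 mulg1 head1.
by apply: head_nonadj => //; rewrite head1.
Qed.

Lemma inc_eq1 i (g : G i) : (inc g == 1) = (g == 1).
Proof.
apply/eqP/eqP => [g1|->]; last exact: inc1.
by rewrite -(head_self g) g1 head1.
Qed.

(** Elements of the subgroup spanned by the vertex groups in [A], given with a
    syllable decomposition without cancellation. *)
Inductive par A : W -> Prop :=
| par1 : par A 1
| parM i (g : G i) x : A i -> g != 1 -> head i x = 1 -> par A x -> par A (inc g * x).

Lemma par_head A x i : par A x -> head i x != 1 ->
  A i /\ par A (inc (head i x)^-1 * x).
Proof.
move=> Ax; elim: Ax i => [i|k g {}x Ak g1 xk Ax IH i]; first by rewrite head1 eqxx.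
have [->|ik] := eqVneq i k.
  by rewrite head_inc xk mulg1 => _; rewrite incV mulKg.
have [Aik|Nik] := boolP (adj i k); last by rewrite head_nonadj// eqxx.
rewrite head_adj// => /IH[Ai Ax']; split=> //.
rewrite mulgA incC// -mulgA; apply: parM => //.
by rewrite head_adj// adj_sym.
Qed.

Lemma par_cons A i (g : G i) x : A i -> par A x -> par A (inc g * x).
Proof.
move=> Ai Ax; have [xi|xi] := eqVneq (head i x) 1.
  by have [->|g1] := eqVneq g 1; [rewrite inc1 mul1g | apply: parM].
have [_ Ax'] := par_head Ax xi.
have -> : inc g * x = inc (g * head i x) * (inc (head i x)^-1 * x).
  by rewrite incM incV -!mulgA mulVKg.
have [->|g1] := eqVneq (g * head i x) 1; first by rewrite inc1 mul1g.
by apply: parM => //; rewrite head_inc mulVg.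
Qed.

Lemma par_mul A x y : par A x -> par A y -> par A (x * y).
Proof.
move=> Ax Ay; elim: Ax => [|i g {}x Ai _ _ _ IH]; first by rewrite mul1g.
by rewrite -mulgA; apply: par_cons.
Qed.

Lemma par_inc A i (g : G i) : A i -> par A (inc g).
Proof. by move=> Ai; rewrite -[inc g]mulg1; apply: par_cons => //; exact: par1. Qed.

Lemma par_inv A x : par A x -> par A x^-1.
Proof.
elim=> [|i g {}x Ai _ _ _ IH]; first by rewrite invg1; exact: par1.
by rewrite invgM -incV; apply: par_mul => //; exact: par_inc.
Qed.

Lemma parT x : par predT x.
Proof.
elim/(inc_ind (g0 := gp)): x => [|i g x]; first exact: par1.
exact: par_cons.
Qed.

Lemma par_sub A B x : (forall i, A i -> B i) -> par A x -> par B x.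
Proof. by move=> AB; elim=> [|i g {}x /AB Bi ? ? _ ?]; [exact: par1 | exact: parM]. Qed.

Lemma par_headE A x i : par A x -> ~~ A i -> head i x = 1.
Proof.
move=> Ax; apply: contraNeq => xi; by have [] := par_head Ax xi.
Qed.

(** The first syllable of a decomposition over [A] is a head of [x], hence has its type in [B] too
    and can be removed inside both subgroups. *)
Lemma parI A B x : par A x -> par B x -> par (predI A B) x.
Proof.
elim=> [|i g {}x Ai g1 xi _ IH] Bx; first exact: par1.
have [|Bi] := @par_head B (inc g * x) i Bx; rewrite head_inc xi mulg1//.
by rewrite incV mulKg => /IH; apply: parM => //; apply/andP.
Qed.

Lemma par0 A x : par A x -> (forall i, ~~ A i) -> x = 1.
Proof. by case=> // i g {}x Ai _ _ _ /(_ i); rewrite Ai. Qed.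

Lemma par_pred1 a x : par (pred1 a) x -> exists g : G a, x = inc g.
Proof.
elim=> [|i g {}x /eqP ia _ _ _ [h ->]]; first by exists 1; rewrite inc1.
by move: g; rewrite ia => g; exists (g * h); rewrite incM.
Qed.

(** Induction from the right follows paths of chambers [x], [x * inc g], whereas [par] and [inc_ind]
    build elements from the left. *)
Lemma par_rind A (P : W -> Prop) : P 1 ->
  (forall i (g : G i) x, A i -> par A x -> P x -> P (x * inc g)) ->
  forall x, par A x -> P x.
Proof.
move=> P1 PM x /par_inv; rewrite -{2}[x]invgK; elim=> [|i g {}x Ai _ _ Ax IH].
  by rewrite invg1.
by rewrite invgM -incV; apply: PM => //; exact: par_inv.
Qed.

Lemma exists_head x : x != 1 -> exists i, head i x != 1.
Proof.
have := parT x; case=> [|i g {}x _ g1 xi _]; first by rewrite eqxx.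
by move=> _; exists i; rewrite head_inc xi mulg1.
Qed.

(** No letter of [v] can come forward to merge with one of [s], so a decomposition of [s] stays free
    of cancellation in [s * v]. *)
Lemma head_par_mul A s v k : par A s -> (forall a, A a -> head a v = 1) -> A k ->
  head k (s * v) = head k s.
Proof.
move=> As vA; elim: As k => [|i g {}s Ai g1 si As IH] k Ak.
  by rewrite mul1g vA// head1.
rewrite -mulgA; have [->|ki] := eqVneq k i; first by rewrite !head_inc IH.
have [Aki|Nki] := boolP (adj k i); first by rewrite !head_adj// IH.
by rewrite !head_nonadj// IH.
Qed.

Lemma par_mul_cancel A B s v : par A s -> (forall a, A a -> head a v = 1) ->
  par B (s * v) -> par B s /\ par B v.
Proof.
move=> As vA; elim: As => [|i g {}s Ai g1 si As IH].
  by rewrite mul1g => Bv; split=> //; exact: par1.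
rewrite -mulgA => Bx; have [|Bi] := @par_head B _ i Bx.
  by rewrite head_inc (head_par_mul As vA Ai) si mulg1.
rewrite head_inc (head_par_mul As vA Ai) si mulg1 incV mulKg => /IH[Bs Bv].
by split=> //; exact: par_cons.
Qed.

(** A letter of type [t] heading [z * g] comes from [g], so it passes in front of every letter of
    [z]. *)
Lemma par_head_link A g z t : par A z -> (forall a, A a -> head a g = 1) ->
  ~~ A t -> head t (z * g) != 1 -> par (predI A (adj t)) z.
Proof.
move=> Az gA tA; elim: Az => [|b a {}z Ab a1 zb Az IH]; first by move=> _; exact: par1.
rewrite -mulgA; have zgb : head b (z * g) = 1 by rewrite (head_par_mul Az gA).
have tb : t != b by apply: contraNneq tA => ->.
have [Atb|Ntb] := boolP (adj t b); last by rewrite head_nonadj// eqxx.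
by rewrite head_adj// => /IH zA; apply: parM => //; apply/andP.
Qed.

Fixpoint word_eval (w : seq {i : I & G i}) : W :=
  if w is a :: w' then inc (tagged a) * word_eval w' else 1.

Lemma word_eval_cat w w' : word_eval (w ++ w') = word_eval w * word_eval w'.
Proof. by elim: w => [|a w IH] /=; rewrite ?mul1g// IH mulgA. Qed.

Lemma word_eval_surj x : exists w, word_eval w = x.
Proof.
elim/(inc_ind (g0 := gp)): x => [|i g x [w <-]]; first by exists [::].
by exists (Tagged G g :: w).
Qed.

(** The exchange property, which makes [len] drop when a head is removed. The induction is on the
    length because a cancellation replaces the tail by a shorter word that is not a subterm. *)
Lemma word_exchange w i : head i (word_eval w) != 1 ->
  exists2 w', (size w' < size w)%N &
    word_eval w' = inc (head i (word_eval w))^-1 * word_eval w.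
Proof.
move: {2}(size w).+1 (ltnSn (size w)) => m; elim: m w i => // m IH [|[k g] w] i wm /=.
  by rewrite head1 eqxx.
have [ik|ik] := eqVneq i k.
  move: g wm; rewrite -ik => g wm; rewrite head_inc.
  have [wi|wi] := eqVneq (head i (word_eval w)) 1.
    by move=> _; exists w; rewrite // wi mulg1 incV mulKg.
  have [w' w'w w'E] := IH w i wm wi; exists w'; first exact: ltnW.
  by rewrite w'E invgM incM -!mulgA [inc g^-1]incV mulKg.
have [Aik|Nik] := boolP (adj i k).
  rewrite head_adj// => /(IH w i wm)[w' w'w w'E].
  by exists (Tagged G g :: w') => //=; rewrite w'E mulgA -incC// mulgA.
have [->|g1] := eqVneq g 1.
  rewrite inc1 mul1g => /(IH w i wm)[w' w'w w'E].
  by exists w' => //; exact: ltnW.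
have [wk|wk] := eqVneq (head k (word_eval w)) 1; first by rewrite head_nonadj// eqxx.
have [w' w'w w'E] := IH w k wm wk.
have w'k : head k (word_eval w') = 1 by rewrite w'E head_inc mulVg.
have -> : inc g * word_eval w = inc (g * head k (word_eval w)) * word_eval w'.
  by rewrite w'E incM incV -!mulgA mulVKg.
have [->|gw1] := eqVneq (g * head k (word_eval w)) 1; last first.
  by rewrite head_nonadj// eqxx.
rewrite inc1 mul1g => /(IH w' i (leq_trans w'w (ltnW wm)))[w'' w''w' w''E].
by exists w'' => //; apply: (ltn_trans w''w'); exact: ltnW.
Qed.

Lemma len_exists x : exists m, `[< exists2 w, word_eval w = x & size w = m >].
Proof.
by have [w <-] := word_eval_surj x; exists (size w); apply/asboolP; exists w.
Qed.

Definition len x := ex_minn (len_exists x).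

Lemma lenP x : exists2 w, word_eval w = x & size w = len x.
Proof. by rewrite /len; case: ex_minnP => m /asboolP. Qed.

Lemma len_le w : (len (word_eval w) <= size w)%N.
Proof. by rewrite /len; case: ex_minnP => m _; apply; apply/asboolP; exists w. Qed.

Lemma len1 : len 1 = 0%N.
Proof. by apply/eqP; rewrite -leqn0 (len_le [::]). Qed.

Lemma len_cons_le i (g : G i) x : (len (inc g * x) <= (len x).+1)%N.
Proof. by have [w <- <-] := lenP x; exact: (len_le (Tagged G g :: w)). Qed.

Lemma len_head i x : head i x != 1 -> len x = (len (inc (head i x)^-1 * x)).+1.
Proof.
move=> xi; apply/eqP; rewrite eqn_leq; apply/andP; split.
  by rewrite -{1}[x](mulVKg (inc (head i x))) -incV len_cons_le.
have [w wx <-] := lenP x; move: xi; rewrite -wx => /word_exchange[w' w'w <-].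
exact: leq_ltn_trans (len_le w') w'w.
Qed.

Lemma lenV_le x : (len x^-1 <= len x)%N.
Proof.
have [w <- <-] := lenP x.
suff [w' ww' <-] : exists2 w', word_eval w' = (word_eval w)^-1 & size w' = size w.
  by rewrite -ww' len_le.
elim: w => [|[i g] w [w' w'E w'S]]; first by exists [::]; rewrite //= invg1.
exists (w' ++ [:: Tagged G g^-1]); last by rewrite size_cat w'S addn1.
by rewrite word_eval_cat /= mulg1 w'E incV invgM.
Qed.

Lemma lenV x : len x^-1 = len x.
Proof. by apply/eqP; rewrite eqn_leq lenV_le -{1}[x]invgK lenV_le. Qed.

Definition star i : pred I := fun k => (k == i) || adj i k.
Definition link i : pred I := adj i.

Lemma star_self i : star i i. Proof. by rewrite /star eqxx. Qed.

Lemma star_link i x : par (link i) x -> par (star i) x.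
Proof. by apply: par_sub => k ik; rewrite /star (ik : adj i k) orbT. Qed.

Lemma star_headless i x : par (star i) x -> head i x = 1 -> par (link i) x.
Proof.
elim=> [|k g {}x ik g1 xk _ IH]; first by move=> _; exact: par1.
have [->|ki] := eqVneq i k; first by rewrite head_inc xk mulg1 => /eqP; rewrite (negbTE g1).
have Aik : adj i k by move: ik; rewrite /star eq_sym (negbTE ki).
by rewrite head_adj// => /IH; exact: parM.
Qed.

Lemma star_split i x : par (star i) x ->
  par (link i) (inc (head i x)^-1 * x).
Proof.
move=> ix; apply: star_headless; last by rewrite head_inc mulVg.
by apply: par_cons => //; exact: star_self.
Qed.

Lemma link_head i x : par (link i) x -> head i x = 1.
Proof. by move=> /par_headE; apply; rewrite /link adj_irr. Qed.

Lemma link_comm i (g : G i) x : par (link i) x -> inc g * x = x * inc g.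
Proof.
elim=> [|k h {}x ik _ _ _ IH]; first by rewrite mulg1 mul1g.
by rewrite mulgA incC// -mulgA IH mulgA.
Qed.

Lemma head_link_mul i l x : par (link i) l -> head i (l * x) = head i x.
Proof.
elim=> [|k h {}l ik _ _ _ IH]; first by rewrite mul1g.
by rewrite -mulgA head_adj.
Qed.

Lemma head_star_mul i s x : par (star i) s -> head i (s * x) = head i s * head i x.
Proof.
move=> is_; rewrite -{1}[s](mulVKg (inc (head i s))) -incV -mulgA head_inc.
by rewrite head_link_mul//; exact: star_split.
Qed.

(** Only a letter that commutes all the way to the front can change a head; geometrically, an edge
    crosses only the hyperplane dual to it. *)
Lemma head_mulr x i j (s : G j) :
  head i (x * inc s) = head i x \/ i = j /\ par (star i) x.
Proof.
elim: (parT x) i => [|k t {}x _ t1 xk _ IH] i.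
  rewrite mul1g head1; have [ij|ij] := eqVneq i j; last by left; exact: head_other.
  by right; split=> //; exact: par1.
rewrite -mulgA; have [ik|ik] := eqVneq i k.
  move: t t1; rewrite -ik => t t1; rewrite !head_inc; have [->|[ij ix]] := IH i; first by left.
  by right; split=> //; apply: par_cons => //; exact: star_self.
have [Aik|Nik] := boolP (adj i k).
  rewrite !head_adj//; have [->|[ij ix]] := IH i; first by left.
  by right; split=> //; apply: par_cons => //; rewrite /star Aik orbT.
left; rewrite [RHS]head_nonadj//.
have [xsk|[kj kx]] := IH k; first by rewrite head_nonadj// xsk.
have lx := star_headless kx xk.
move: s {IH}; rewrite -kj => s.
rewrite -link_comm// mulgA -incM; have [->|ts1] := eqVneq (t * s) 1.
  by rewrite inc1 mul1g (par_headE lx)// /link adj_sym.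
by rewrite head_nonadj.
Qed.

End Words.

(** * Hyperplanes and half-spaces *)

Section Hyperplanes.
Context (I : finType) (G : I -> groupType) (adj : rel I).
Context (adj_irr : irreflexive adj) (adj_sym : symmetric adj).
Context (W : groupType) (gp : graph_product G adj W).
Local Notation inc := (inc gp).
Local Notation head := (head gp).
Local Notation par := (par gp).
Local Notation star := (star adj).
Local Notation link := (link adj).
Implicit Types (i j k : I) (x y z s : W) (J K : (I * W)%type).

(** The pair [(i, g)] stands for the hyperplane dual to the coset of the [i]-th
    vertex group at [g], and [car] is its carrier, a coset of a star subgroup. *)
Definition car J x := par (star J.1) (J.2^-1 * x).
(** The label of the sector of [J] containing [x]. A hyperplane has one sector for each element of
    its vertex group, and [J.2] lies in the sector [1]. *)
Definition sec J x : G J.1 := head J.1 (J.2^-1 * x).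
Definition tr g J : I * W := (J.1, g * J.2).
Definition meets J K := exists2 z, car J z & car K z.
Definition same J K := J.1 = K.1 /\ meets J K.
Definition cross J K := adj J.1 K.1 /\ meets J K.
(** The conjugate by [J.2] of a star subgroup, hence the product of the commuting subgroups [ver J]
    and [lnk J]; [lnk J] preserves every sector, and [rot J] holds for the elements that permute the
    sectors nontrivially. *)
Definition stab J y := car J (y * J.2).
Definition rot J y := stab J y /\ sec J (y * J.2) != 1.
Definition lnk J y := par (link J.1) (J.2^-1 * (y * J.2)).
Definition ver J y := exists g : G J.1, y = J.2 * inc g * J.2^-1.

Lemma car_self J : car J J.2.
Proof. by rewrite /car mulVg; exact: par1. Qed.

Lemma car_mul J x s : car J x -> par (star J.1) s -> car J (x * s).
Proof. by move=> Jx Js; rewrite /car mulgA; exact: par_mul. Qed.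

Lemma car_div J x y : car J x -> car J y -> par (star J.1) (x^-1 * y).
Proof.
move=> Jx Jy; have -> : x^-1 * y = (J.2^-1 * x)^-1 * (J.2^-1 * y).
  by rewrite invgM invgK -mulgA mulVKg.
by apply: par_mul Jy => //; exact: par_inv.
Qed.

Lemma car_tr g J x : car (tr g J) x = car J (g^-1 * x).
Proof. by rewrite /car /= invgM mulgA. Qed.

Lemma sec_tr g J x : sec (tr g J) x = sec J (g^-1 * x).
Proof. by rewrite /sec /= invgM mulgA. Qed.

Lemma same_refl J : same J J.
Proof. by split=> //; exists J.2; exact: car_self. Qed.

Lemma same_sym J K : same J K -> same K J.
Proof. by move=> [JK [z Jz Kz]]; split=> //; exists z. Qed.

Lemma cross_sym J K : cross J K -> cross K J.
Proof. by move=> [JK [z Jz Kz]]; split; [rewrite adj_sym|exists z]. Qed.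

Lemma same_car J K x : same J K -> car J x -> car K x.
Proof.
case: J K => i g [j h] [/= ij [z Jz Kz]] Jx; move: Jz Jx; rewrite /car /= ij => Jz Jx.
have -> : h^-1 * x = (h^-1 * z) * ((g^-1 * z)^-1 * (g^-1 * x)).
  by rewrite invgM invgK -!mulgA mulVKg mulVKg.
by apply: par_mul Kz _ => //; apply: par_mul => //; exact: par_inv.
Qed.

Lemma same_trans J K L : same J K -> same K L -> same J L.
Proof.
move=> JK KL; split; first by rewrite JK.1 KL.1.
by have [z Kz Lz] := KL.2; exists z => //; apply: same_car Kz; exact: same_sym.
Qed.

Lemma same_cross J J' K : same J J' -> cross J K -> cross J' K.
Proof.
move=> JJ' [JK [z Jz Kz]]; split; first by rewrite -JJ'.1.
by exists z => //; exact: same_car Jz.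
Qed.

Lemma same_not_cross J K : same J K -> ~ cross J K.
Proof. by move=> [JK _] []; rewrite JK adj_irr. Qed.

Lemma same_rep J z : car J z -> same J (J.1, z).
Proof. by move=> Jz; split=> //; exists z => //; exact: car_self. Qed.

Lemma cross_at i j z : adj i j -> cross (i, z) (j, z).
Proof. by split=> //; exists z; exact: (@car_self (_, z)). Qed.

Lemma stab_same J y : stab J y <-> same J (tr y J).
Proof.
split=> [Jy|[_ [z Jz]]].
  by split=> //; exists (y * J.2) => //; rewrite car_tr mulKg; exact: car_self.
rewrite car_tr => Jyz; rewrite /stab.
have -> : y * J.2 = z * ((y^-1 * z)^-1 * J.2) by rewrite invgM invgK -!mulgA mulVKg.
by apply: car_mul => //; apply: car_div => //; exact: car_self.
Qed.

Lemma stab_car J x y : stab J y -> car J x -> car J (y * x).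
Proof.
move=> Jy Jx; rewrite -[x](mulVKg J.2) mulgA; apply: car_mul => //.
Qed.

Lemma stab1 J : stab J 1.
Proof. by rewrite /stab mul1g; exact: car_self. Qed.

Lemma stab_mul J x y : stab J x -> stab J y -> stab J (x * y).
Proof. by move=> Jx Jy; rewrite /stab -mulgA; exact: stab_car. Qed.

Lemma stab_inv J y : stab J y -> stab J y^-1.
Proof.
move=> Jy; rewrite /stab /car.
have -> : J.2^-1 * (y^-1 * J.2) = (J.2^-1 * (y * J.2))^-1.
  by rewrite !invgM invgK mulgA.
exact: par_inv.
Qed.

Lemma same_stab J K y : same J K -> stab J y -> stab K y.
Proof.
move=> JK Jy; apply: (same_car JK); apply: stab_car => //.
by apply: same_car (same_sym JK) _; exact: car_self.
Qed.

Lemma stab_tr g J y : stab (tr g J) y = stab J (g^-1 * y * g).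
Proof. by rewrite /stab car_tr /= !mulgA. Qed.

Lemma stab_tr_conj g J y : stab J y -> stab (tr g J) (g * y * g^-1).
Proof. by rewrite stab_tr -!mulgA mulKg mulVg mulg1. Qed.

Lemma stab_sec J y x : stab J y -> sec J (y * x) = sec J (y * J.2) * sec J x.
Proof.
move=> Jy; rewrite /sec -head_star_mul//; congr (head _ _).
by rewrite -!mulgA mulVKg.
Qed.

Lemma rotP J y x : stab J y -> rot J y <-> sec J (y * x) <> sec J x.
Proof.
move=> Jy; rewrite /rot (@stab_sec J y x Jy); split=> [[_ /eqP yJ] e|e].
  by apply: yJ; rewrite -[LHS](mulgK (sec J x)) e mulgV.
by split=> //; apply/eqP => yJ; apply: e; rewrite yJ mul1g.
Qed.

(** Another base point multiplies the labels on the left by a fixed element: equality of sectors is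
    intrinsic, the labels are not. *)
Lemma same_sec J K x y : same J K -> sec J x = sec J y -> sec K x = sec K y.
Proof.
case: J K => i g [j h] JK; have := same_car (same_sym JK) (car_self _).
move: JK.1 => /= ij; case: _ / ij h {JK} => h; rewrite /car /sec /= => gh xy.
have hx u : h^-1 * u = (g^-1 * h)^-1 * (g^-1 * u) by rewrite invgM invgK -mulgA mulVKg.
have sg := par_inv adj_sym gh.
by rewrite !hx (head_star_mul adj_sym _ sg) (head_star_mul adj_sym _ sg) xy.
Qed.

Lemma rot_same J K y : same J K -> rot J y -> rot K y.
Proof.
move=> JK rJ; have Jy := rJ.1; have Ky := same_stab JK Jy.
apply/(rotP 1 Ky) => e; apply: (iffLR (rotP 1 Jy) rJ).
by apply: same_sec (same_sym JK) e.
Qed.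

Lemma lnk_stab J y : lnk J y -> stab J y.
Proof. exact: star_link. Qed.

Lemma stab_lnk J y : stab J y -> ~ rot J y -> lnk J y.
Proof.
move=> Jy nr; apply: star_headless => //; apply/eqP; apply/negP => /negP r.
by apply: nr.
Qed.

Lemma lnk_not_rot J y : lnk J y -> ~ rot J y.
Proof. by move=> ly [_]; rewrite /sec link_head// eqxx. Qed.

Lemma lnk_sec J y x : lnk J y -> sec J (y * x) = sec J x.
Proof.
by move=> ly; rewrite (stab_sec _ (lnk_stab ly)) [X in X * _]/sec link_head// mul1g.
Qed.

Lemma sec_edge J x j (s : G j) : sec J (x * inc s) <> sec J x -> J.1 = j /\ car J x.
Proof. by rewrite /sec mulgA => e; have [] := head_mulr adj_sym gp (J.2^-1 * x) J.1 s. Qed.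

(** A path inside the carrier of [J] uses letters of the star of [J.1]; an edge of it that changes
    the sector of [K] is dual to [K], which then equals or crosses [J]. *)
Lemma sec_car_const J K x y : ~ same J K -> ~ cross J K -> car J x -> car J y ->
  sec K x = sec K y.
Proof.
move=> nS nC Jx Jy; rewrite -[y](mulVKg x).
apply: (@par_rind I G adj adj_sym W gp (star J.1)
  (fun s => sec K x = sec K (x * s)) _ _ _ (car_div Jx Jy)); first by rewrite mulg1.
move=> j g s Js s_ IH; rewrite mulgA.
have [->//|/eqP/sec_edge[Kj Kxs]] := eqVneq (sec K (x * s * inc g)) (sec K (x * s)).
have Jxs := car_mul Jx s_; case/orP: Js => [/eqP jJ|Js].
  by case: nS; split; [rewrite Kj | exists (x * s)].
by case: nC; split; [rewrite Kj | exists (x * s)].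
Qed.

(** Otherwise the carrier of [J], which [y] preserves, lies in one sector of [K], which [y]
    moves. *)
Lemma rot_stab J K y : stab J y -> rot K y -> same J K \/ cross J K.
Proof.
move=> Jy rK; have [|nS] := pselect (same J K); first by left.
have [|nC] := pselect (cross J K); first by right.
case: (iffLR (rotP J.2 rK.1) rK).
exact: sec_car_const nS nC Jy (car_self J).
Qed.

Lemma rot_tr g J y : rot J y -> rot (tr g J) (g * y * g^-1).
Proof.
move=> rJ; have gJ := stab_tr_conj g rJ.1; apply/(rotP (g * 1) gJ).
rewrite !sec_tr (_ : g^-1 * (g * y * g^-1 * (g * 1)) = y * 1).
  by rewrite mulKg; apply/(rotP 1 rJ.1).
by rewrite !mulg1 mulgVK mulKg.
Qed.

(** [y] rotates the translate of [J] by [x] as well, and two hyperplanes of the same type cannot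
    cross, so [rot_stab] makes them equal. *)
Lemma rot_comm J x y : rot J y -> x * y = y * x -> stab J x.
Proof.
move=> rJ xy; apply/stab_same.
have rxJ : rot (tr x J) y.
  by have := rot_tr x rJ; rewrite xy mulgK.
by have [|[]] := rot_stab rJ.1 rxJ; rewrite //= adj_irr.
Qed.

Lemma ver_conj J y : ver J y -> exists g : G J.1, J.2^-1 * (y * J.2) = inc g.
Proof. by move=> [g ->]; exists g; rewrite mulgVK mulKg. Qed.

Lemma ver_stab J y : ver J y -> stab J y.
Proof.
move=> /ver_conj[g e]; rewrite /stab /car e; apply: par_inc => //; exact: star_self.
Qed.

Lemma ver_rot J y : ver J y -> y != 1 -> rot J y.
Proof.
move=> vy y1; split; first exact: ver_stab.
have [g e] := ver_conj vy; rewrite /sec e head_self; apply: contraNneq y1 => g1.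
by move: e; rewrite g1 inc1 => /(canRL (mulVKg _)) /(canRL (mulgK _)) ->; rewrite mulg1 mulgV.
Qed.

Lemma ver_same J K y : same J K -> ver J y -> ver K y.
Proof.
case: J K => i g [j h] JK; have := same_car JK (car_self _).
move: JK.1 => /= ij; case: _ / ij h {JK} => h; rewrite /car /ver /= => hg [a ->].
move: hg; have : g = h * (h^-1 * g) by rewrite mulVKg.
move: (h^-1 * g) => s -> {g} sP.
have := star_split adj_sym sP; set b := head i s.
have : s = inc b * (inc b^-1 * s) by rewrite incV mulVKg.
move: (inc b^-1 * s) => l sE ll; exists (b * a * b^-1).
rewrite invgM -!mulgA; congr (_ * _); rewrite !mulgA; congr (_ * _).
rewrite sE invgM !incM incV -!mulgA; congr (_ * _).
by rewrite !mulgA -(link_comm a ll) mulgK.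
Qed.

Lemma cross_rep J K : cross J K -> exists z, same J (J.1, z) /\ same K (K.1, z).
Proof. by move=> [_ [z Jz Kz]]; exists z; split; exact: same_rep. Qed.

Lemma ver_inj J K y : ver J y -> ver K y -> y != 1 -> same J K.
Proof.
move=> vJ vK y1; have [//|JK] := rot_stab (ver_stab vJ) (ver_rot vK y1).
have [z [/ver_same/(_ vJ) [/= a ya] /ver_same/(_ vK) [/= b yb]]] := cross_rep JK.
have ab : inc a = inc b.
  by apply: (mulgI z); apply: (mulIg z^-1); rewrite -ya -yb.
have JK1 : J.1 != K.1 by apply: contraTneq JK.1 => ->; rewrite adj_irr.
have := congr1 (head J.1) ab; rewrite head_self (head_other gp b JK1) => a1.
by move: y1; rewrite ya a1 inc1 mulg1 mulgV eqxx.
Qed.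

Lemma cross_ver_stab J K y : cross J K -> ver J y -> stab K y.
Proof.
move=> JK vJ; have [z [/ver_same/(_ vJ) [/= a ya] Kz]] := cross_rep JK.
apply: same_stab (same_sym Kz) _; rewrite /stab /car /= ya mulgVK mulKg.
by apply: par_inc => //; rewrite /star adj_sym JK.1 orbT.
Qed.

End Hyperplanes.

(** * Intersections of hyperplane stabilizers *)

Section Intersections.
Context (I : finType) (G : I -> groupType) (adj : rel I).
Context (adj_irr : irreflexive adj) (adj_sym : symmetric adj).
Context (W : groupType) (gp : graph_product G adj W).
Context (G_nt : forall i, exists g : G i, g != 1).
Context (adj_tri : forall i j k, adj i j -> adj i k -> ~~ adj j k).
Context (adj_sq : forall i k a b, i != k -> adj i a -> adj k a -> adj i b -> adj k b -> a = b).
Context (adj_two : forall i, exists b c, [/\ b != c, adj i b & adj i c]).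
Local Notation inc := (inc gp).
Local Notation head := (head gp).
Local Notation par := (par gp).
Local Notation star := (star adj).
Local Notation link := (link adj).
Local Notation car := (car gp).
Local Notation sec := (sec gp).
Local Notation same := (same gp).
Local Notation cross := (cross gp).
Local Notation stab := (stab gp).
Local Notation rot := (rot gp).
Local Notation lnk := (lnk gp).
Local Notation ver := (ver gp).
Implicit Types (i j k : I) (x y z s : W) (J K L : (I * W)%type).

Lemma headless_par_eq1 (A : pred I) x :
  par A x -> (forall a, A a -> head a x = 1) -> x = 1.
Proof.
case=> // i g {}x Ai g1 xi _ /(_ i Ai) /eqP.
by rewrite head_inc xi mulg1 (negbTE g1).
Qed.

(** The two points realise the distance between the carriers. *)
Lemma bridge J K : exists z1 z2, [/\ car J z1, car K z2,
  (forall b, star J.1 b -> head b (z1^-1 * z2) = 1) &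
  (forall b, star K.1 b -> head b (z2^-1 * z1) = 1)].
Proof.
have ex : exists m, `[< exists z1 z2, [/\ car J z1, car K z2 & len gp (z1^-1 * z2) = m] >].
  exists (len gp (J.2^-1 * K.2)); apply/asboolP.
  by exists J.2, K.2; split => //; exact: car_self.
case: (ex_minnP ex) => m /asboolP[z1 [z2 [Jz1 Kz2 <-]]] min.
exists z1, z2; split=> // b bs; apply/eqP; apply: contraT => h1.
  have := min (len gp ((z1 * inc (head b (z1^-1 * z2)))^-1 * z2)).
  rewrite invgM -incV -mulgA (len_head h1) ltnn; apply; apply/asboolP.
  exists (z1 * inc (head b (z1^-1 * z2))), z2; split=> //.
    by apply: car_mul => //; exact: par_inc.
  by rewrite invgM -incV -mulgA.
have lenE : len gp (z1^-1 * z2) = len gp (z2^-1 * z1).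
  by rewrite -[RHS]lenV invgM invgK.
set h := head b (z2^-1 * z1) in h1.
have := min (len gp (z1^-1 * (z2 * inc h))).
have e : len gp (z1^-1 * (z2 * inc h)) = len gp (inc h^-1 * (z2^-1 * z1)).
  by rewrite -[RHS]lenV !invgM -incV !invgK mulgA.
rewrite e lenE (len_head h1) ltnn; apply; apply/asboolP.
exists z1, (z2 * inc h); split=> //.
by apply: car_mul => //; exact: par_inc.
Qed.

(** An element [y] fixing both hyperplanes moves the ends [z1], [z2] of a bridge inside the
    carriers. The hyperplane dual to a first edge of the bridge, of type [t], has the carrier of [K]
    in one sector, so [t] still heads the path from [z1] to [y * z2]; hence it commutes past
    [z1^-1 * (y * z1)]. If the bridge is trivial, [t] is the type of [K]. *)
Lemma stab_inter J K : ~ same J K -> ~ cross J K -> exists z t,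
  [/\ car J z, t != J.1, ~~ adj J.1 t, (forall a, adj J.1 a -> ~ same (a, z) K) &
   forall y, stab J y -> stab K y -> par (fun b => adj J.1 b && adj t b) (z^-1 * (y * z))].
Proof.
move=> nS nC; have [z1 [z2 [Jz1 Kz2 hJ hK]]] := bridge J K.
set g := z1^-1 * z2 in hJ.
have stabz y : stab J y -> par (star J.1) (z1^-1 * (y * z1)).
  by move=> Jy; apply: (car_div adj_sym (gp := gp)) => //; exact: stab_car.
have [g1|g1] := eqVneq g 1.
  have z12 : z1 = z2 by rewrite -[z2](mulVKg z1) -/g g1 mulg1.
  have nt : K.1 != J.1.
    by apply/eqP => e; apply: nS; split=> //; exists z1; rewrite // z12.
  have nA : ~~ adj J.1 K.1.
    by apply/negP => e; apply: nC; split=> //; exists z1; rewrite // z12.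
  exists z1, K.1; split=> //.
    by move=> a Ja [/= aK _]; rewrite -aK Ja in nA.
  move=> y Jy Ky; have Jz := stabz y Jy.
  have Kz : par (star K.1) (z1^-1 * (y * z1)).
    by rewrite z12; apply: (car_div adj_sym (gp := gp)) => //; exact: stab_car.
  apply: par_sub (parI adj_sym Jz Kz) => b /andP[].
  rewrite /star; case: eqVneq => [->|_] /=.
    by rewrite eq_sym (negbTE nt) adj_sym (negbTE nA).
  by move=> Jb /orP[/eqP e|->]; [rewrite e (negbTE nA) in Jb | rewrite Jb].
have [t tg] := exists_head adj_sym gp g1.
have tJ : ~~ star J.1 t by apply: contra tg => /hJ ->.
have gV : g^-1 = z2^-1 * z1 by rewrite invgM invgK.
have notKz1 : ~ car K z1.
  move=> Kz1; move: g1; rewrite -invg_eq1 gV (headless_par_eq1 _ hK) ?eqxx//.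
  exact: (car_div adj_sym Kz2 Kz1).
(* If the carriers met, [g] would lie in the link subgroup of [t], and [t] could not be a head of
   it. *)
have noT : star K.1 t -> ~ meets gp K (t, z1).
  move=> Kt [w Kw Tw].
  have s'P := par_inv adj_sym (car_div adj_sym Kz2 Kw).
  have : par (star t) ((z2^-1 * w)^-1 * g^-1).
    rewrite gV (_ : _ * _ = (z1^-1 * w)^-1); first exact: par_inv Tw.
    by rewrite !invgM !invgK -mulgA mulVKg.
  move=> /(par_mul_cancel adj_sym s'P)[|_ tgV].
    by move=> a /hK; rewrite gV.
  have : head t g^-1 = 1 by rewrite gV; exact: hK.
  move=> /(star_headless tgV) /(par_inv adj_sym); rewrite invgK.
  by move=> /(link_head adj_irr adj_sym) /eqP; rewrite (negbTE tg).
exists z1, t; split=> //.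
- by apply: contraNneq tJ => ->; exact: star_self.
- by apply: contra tJ; rewrite /star => ->; rewrite orbT.
- move=> a _ /(same_car adj_sym) aK; apply/notKz1/aK.
  exact: (@car_self _ _ _ _ gp (a, z1)).
move=> y Jy Ky; have secT : sec (t, z1) (y * z2) = sec (t, z1) z2.
  apply: (sec_car_const adj_sym (J := K)) => //.
  - by move=> [e m]; apply: noT m; rewrite e star_self.
  - by move=> [e m]; apply: noT m; rewrite /star e orbT.
  - exact: stab_car.
have Jz := stabz y Jy.
have : par (predI (star J.1) (adj t)) (z1^-1 * (y * z1)).
  apply: (par_head_link Jz hJ tJ).
  rewrite (_ : _ * g = z1^-1 * (y * z2)); last by rewrite -!mulgA mulVKg.
  by move: secT; rewrite /sec /= => ->.
apply: par_sub => b /andP[]; rewrite /star; case: eqVneq => [->|_] /=.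
  by move=> _ tJ1; case/negP: tJ; rewrite /star adj_sym tJ1 orbT.
by move=> -> ->.
Qed.

(** Without squares, the distinct types [J.1] and [t] have at most one common neighbour [a]. If they
    have none, the intersection is trivial and any neighbour of [J.1] serves. *)
Lemma disjoint_stab_inter J K : ~ same J K -> ~ cross J K -> exists L,
  [/\ ~ same L J, ~ same L K & forall y, stab J y -> stab K y -> ver L y].
Proof.
move=> nS nC; have [z [t [Jz tJ Jt aK yP]]] := stab_inter nS nC.
have [a aJ aP] : exists2 a, adj J.1 a & forall b, adj J.1 b && adj t b -> b = a.
  have [[a /andP[Ja ta]]|no] := pselect (exists a, adj J.1 a && adj t a).
    exists a => // b /andP[Jb tb]; apply: (@adj_sq J.1 t) => //.
    by rewrite eq_sym.
  have [a [_ [_ Ja _]]] := adj_two J.1; exists a => // b bP.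
  by case: no; exists b.
exists (a, z); split.
- by move=> [/= e _]; rewrite e adj_irr in aJ.
- exact: aK.
move=> y Jy Ky; have [|g e] := @par_pred1 _ _ _ _ gp a (z^-1 * (y * z)).
  by apply: par_sub (yP y Jy Ky) => b /aP ->; rewrite /= eqxx.
by exists g => /=; rewrite -e mulVKg mulgK.
Qed.

Lemma ver_nontrivial J : exists2 y, ver J y & y != 1.
Proof.
have [g g1] := G_nt J.1; exists (J.2 * inc g * J.2^-1); first by exists g.
rewrite -(inc_eq1 gp) in g1; apply: contraNneq g1 => /(canRL (mulgVK _)).
by rewrite mul1g -{2}[J.2]mulg1 => /mulgI ->.
Qed.

Lemma cross_stab_inter J K L y : cross L J -> cross L K -> ~ same J K ->
  ~ cross J K -> stab J y -> stab K y -> ver L y.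
Proof.
move=> LJ LK nS nC Jy Ky; have [L' [_ _ L'P]] := disjoint_stab_inter nS nC.
have [y0 Ly0 y01] := ver_nontrivial L.
have L'y0 : ver L' y0 by apply: L'P; apply: (cross_ver_stab adj_sym _ Ly0).
have L'L := ver_inj adj_irr adj_sym L'y0 Ly0 y01.
by apply: (ver_same adj_sym L'L); exact: L'P.
Qed.

Lemma same_lnk J K y : same J K -> lnk J y -> lnk K y.
Proof.
move=> JK Jy; apply: stab_lnk; first exact: same_stab JK (lnk_stab Jy).
by move/(rot_same adj_sym (same_sym JK)); exact: lnk_not_rot Jy.
Qed.

Lemma cross_lnk_eq1 J K y : cross J K -> lnk J y -> lnk K y -> y = 1.
Proof.
move=> JK Jy Ky; have [z [Jz Kz]] := cross_rep JK.
have {}Jy : par (link J.1) (z^-1 * (y * z)) := same_lnk Jz Jy.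
have {}Ky : par (link K.1) (z^-1 * (y * z)) := same_lnk Kz Ky.
have : z^-1 * (y * z) = 1.
  apply: (par0 (parI adj_sym Jy Ky)) => b; apply/negP => /andP[Jb Kb].
  have := adj_tri JK.1 Jb; apply/negP; rewrite negbK; exact: Kb.
by move/(canRL (mulVKg _))/(canRL (mulgK _)); rewrite mulg1 mulgV.
Qed.

(** If [x] moved [J], then [y] would fix two hyperplanes of the same type, and [disjoint_stab_inter]
    would make it rotate a third. *)
Lemma lnk_comm_stab J x y : lnk J y -> y != 1 -> (forall K, ~ rot K y) ->
  x * y = y * x -> stab J x.
Proof.
move=> Jy y1 nr xy; apply/(stab_same adj_sym); apply: contrapT => nS.
have nC : ~ cross J (tr x J) by move=> []; rewrite /= adj_irr.
have [L [_ _ LP]] := disjoint_stab_inter nS nC.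
apply: (nr L); apply: ver_rot => //; apply: LP; first exact: lnk_stab.
by have := stab_tr_conj x (lnk_stab Jy); rewrite xy mulgK.
Qed.

(** The vertex conjugate at [L] fixes both hyperplanes, whose stabilizers share only the conjugate
    by [x] of one vertex group. *)
Lemma cross_pair j t x L : j != t -> ~~ adj j t -> cross L (j, x) ->
  cross L (t, x) -> exists a, [/\ adj j a, adj t a & same L (a, x)].
Proof.
move=> jt Njt Lj Lt; have [y Ly y1] := ver_nontrivial L.
have jy : par (star j) (x^-1 * (y * x)) := cross_ver_stab adj_sym Lj Ly.
have ty : par (star t) (x^-1 * (y * x)) := cross_ver_stab adj_sym Lt Ly.
have both b : star j b -> star t b -> adj j b /\ adj t b.
  rewrite /star; case: eqVneq => [->|_] /=; last first.
    move=> jb /orP[/eqP bt|tb]; last by split.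
    by move: Njt; rewrite -bt jb.
  by move=> _; rewrite (negbTE jt) [adj t j]adj_sym (negbTE Njt).
have yx1 : x^-1 * (y * x) != 1.
  by apply: contraNneq y1 => /(canRL (mulVKg _))/(canRL (mulgK _)) ->; rewrite mulg1 mulgV.
have [a ha] := exists_head adj_sym gp yx1.
have [[sja _] [sta _]] := (par_head adj_sym jy ha, par_head adj_sym ty ha).
have [ja ta] := both a sja sta; exists a; split=> //.
apply: (ver_inj adj_irr adj_sym Ly) (y1).
have [|g e] := @par_pred1 _ _ _ _ gp a (x^-1 * (y * x)).
  apply: par_sub (parI adj_sym jy ty) => b /andP[jb tb].
  have [Jb Tb] := both b jb tb; apply/eqP; exact: (@adj_sq j t).
by exists g => /=; rewrite -e mulVKg mulgK.
Qed.

(** A second neighbour of [J.1] excludes crossing, as it would give a triangle. If the two are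
    disjoint, a single [L] would contain the vertex conjugates of both [J] and a hyperplane crossing
    it. *)
Lemma stab_sub_same J K : (forall y, stab J y -> stab K y) -> same J K.
Proof.
move=> JK; apply: contrapT => nS; have [JcK|nC] := pselect (cross J K).
  have [z [Jz Kz]] := cross_rep JcK.
  have [b [bK Jb]] : exists b, b != K.1 /\ adj J.1 b.
    have [b [c [bc Jb Jc]]] := adj_two J.1; have [e|] := eqVneq b K.1; last by exists b.
    by exists c; rewrite -e eq_sym.
  have [g g1] := G_nt b; have by_ : ver (b, z) (z * inc g * z^-1) by exists g.
  have Jy : stab J (z * inc g * z^-1).
    apply: same_stab (same_sym Jz) _ => //; apply: cross_ver_stab by_ => //.
    by apply: cross_at; rewrite adj_sym.
  have := same_stab adj_sym Kz (JK _ Jy); rewrite /stab /car /= mulgVK mulKg.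
  move=> /(par_head adj_sym (i := b)); rewrite head_self => /(_ g1)[].
  rewrite /star (negbTE bK) => /= Kb _.
  by have := adj_tri JcK.1 Jb; rewrite Kb.
have [L [_ _ LP]] := disjoint_stab_inter nS nC.
have [y Jy y1] := ver_nontrivial J.
have JL := ver_inj adj_irr adj_sym Jy (LP _ (ver_stab adj_sym Jy) (JK _ (ver_stab adj_sym Jy))) y1.
have [b [_ [_ Jb _]]] := adj_two J.1.
have [x bx x1] := ver_nontrivial (b, J.2).
have Jx : stab J x.
  apply: (cross_ver_stab adj_sym _ bx); split; first by rewrite adj_sym.
  by exists J.2; [exact: (@car_self _ _ _ _ gp (b, J.2)) | exact: car_self].
have bL := ver_inj adj_irr adj_sym bx (LP _ Jx (JK _ Jx)) x1.
by move: Jb; rewrite JL.1 -bL.1 adj_irr.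
Qed.

(** A product of nontrivial rotations about [J] and [K] rotates both; if [L] is fixed by it and
    equal to neither, it crosses both, which makes a triangle. *)
Lemma cross_maximal J K L : cross J K ->
  (forall y, stab J y -> stab K y -> stab L y) -> same L J \/ same L K.
Proof.
move=> JK JKL; have [z [Jz Kz]] := cross_rep JK.
set i := J.1 in Jz; set j := K.1 in Kz; have ij : adj i j by exact: JK.1.
have [[g g1] [h h1]] := (G_nt i, G_nt j).
pose y := z * (inc g * inc h) * z^-1.
have yz : z^-1 * (y * z) = inc g * inc h by rewrite /y mulgVK mulKg.
have Jy : stab (i, z) y.
  rewrite /stab /car /= yz; apply: par_mul => //; apply: par_inc => //.
    exact: star_self.
  by rewrite /star ij orbT.
have Ky : stab (j, z) y.
  rewrite /stab /car /= yz; apply: par_mul => //; apply: par_inc => //.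
    by rewrite /star adj_sym ij orbT.
  exact: star_self.
have rJ : rot (i, z) y.
  by split=> //; rewrite /sec /= yz head_inc (head_other gp h (adj_neq adj_irr ij)) mulg1.
have rK : rot (j, z) y.
  split=> //; rewrite /sec /= yz incC// head_inc (head_other gp g) ?mulg1//.
  by rewrite eq_sym (adj_neq adj_irr ij).
have Ly : stab L y.
  by apply: JKL; [exact: same_stab (same_sym Jz) Jy | exact: same_stab (same_sym Kz) Ky].
have [LJ|LJ] := rot_stab adj_sym Ly rJ.
  by left; exact: (same_trans adj_sym LJ (same_sym Jz)).
have [LK|LK] := rot_stab adj_sym Ly rK.
  by right; exact: (same_trans adj_sym LK (same_sym Kz)).
by have := adj_tri LJ.1 LK.1; rewrite ij.
Qed.

(** Crossing is read off the stabilizers alone: for disjoint hyperplanes, [disjoint_stab_inter]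
    supplies a third one whose stabilizer contains the intersection. *)
Lemma crossP J K : cross J K <-> [/\ ~ same J K &
  forall L, (forall y, stab J y -> stab K y -> stab L y) -> same L J \/ same L K].
Proof.
split=> [JK|[nS max]].
  split; last by move=> L; exact: cross_maximal.
  by move/(same_not_cross adj_irr); apply.
apply: contrapT => nC; have [L [LJ LK LP]] := disjoint_stab_inter nS nC.
have [y Jy Ky|//|//] := max L.
by apply: ver_stab => //; exact: LP.
Qed.

End Intersections.

Local Open Scope classical_set_scope.

(** * Half-spaces and the elements skewering them *)

Section HalfSpaces.
Context (I : finType) (G : I -> groupType) (adj : rel I).
Context (adj_irr : irreflexive adj) (adj_sym : symmetric adj).
Context (W : groupType) (gp : graph_product G adj W).
Context (G_nt : forall i, exists g : G i, g != 1).
Context (adj_tri : forall i j k, adj i j -> adj i k -> ~~ adj j k).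
Context (adj_sq : forall i k a b, i != k -> adj i a -> adj k a -> adj i b -> adj k b -> a = b).
Context (adj_two : forall i, exists b c, [/\ b != c, adj i b & adj i c]).
Local Notation inc := (inc gp).
Local Notation head := (head gp).
Local Notation car := (car gp).
Local Notation sec := (sec gp).
Local Notation same := (same gp).
Local Notation cross := (cross gp).
Local Notation stab := (stab gp).
Local Notation rot := (rot gp).
Local Notation lnk := (lnk gp).
Implicit Types (i j k : I) (x y z s : W) (J K L : (I * W)%type).

(** The sector containing [J.2]; the other sectors of the same hyperplane come from other base
    points. *)
Definition hs J : set W := [set x | sec J x = 1].

Lemma hs_tr g J x : hs (tr g J) x = hs J (g^-1 * x).
Proof. by rewrite /hs /= sec_tr. Qed.

Lemma hs_self J : hs J J.2.
Proof. by rewrite /hs /sec /= mulVg head1. Qed.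

Lemma tr_tr g h J : tr g (tr h J) = tr (g * h) J.
Proof. by rewrite /tr /= mulgA. Qed.

Lemma tr1 J : tr 1 J = J.
Proof. by case: J => i g; rewrite /tr mul1g. Qed.

Lemma hs_trS g J K : hs J `<=` hs K -> hs (tr g J) `<=` hs (tr g K).
Proof. by move=> JK x; rewrite !hs_tr; exact: JK. Qed.

Lemma hs_trP g J K : hs J `<` hs K -> hs (tr g J) `<` hs (tr g K).
Proof.
move=> [JK KJ]; split; first exact: hs_trS.
by move=> /(hs_trS (g := g^-1)); rewrite !tr_tr mulVg !tr1.
Qed.

Lemma hs_car J x : car J x -> hs J x -> hs J = hs (J.1, x).
Proof.
move=> Jx hx; have l := par_inv adj_sym (star_headless Jx hx).
apply/seteqP; split=> z; rewrite /hs /sec /=;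
  by rewrite (_ : x^-1 * z = (J.2^-1 * x)^-1 * (J.2^-1 * z)) ?(head_link_mul _ l)//
       invgM invgK -mulgA mulVKg.
Qed.

(** Along a path from [p] to [q], each edge leaves at most one half-space. *)
Lemma sep_finite p q : exists L : seq (set W), forall J, hs J p -> ~ hs J q -> hs J \in L.
Proof.
rewrite -[q](mulVKg p).
apply: (@par_rind I G adj adj_sym W gp predT (fun s => exists L : seq (set W),
  forall J, hs J p -> ~ hs J (p * s) -> hs J \in L) _ _ _ (parT adj_sym gp (p^-1 * q))).
  by exists [::] => J; rewrite mulg1.
move=> i g s _ _ [L LP]; exists (hs (i, p * s) :: L) => J Jp.
rewrite mulgA inE => Jq; have [Js|Js] := pselect (hs J (p * s)); last by rewrite LP ?orbT.
have [|Ji cJ] := @sec_edge _ _ _ adj_sym _ gp J (p * s) i g.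
  by move=> e; apply: Jq; rewrite /hs /= e.
by rewrite (hs_car cJ Js) Ji eqxx.
Qed.

Lemma no_infinite_sep (f : nat -> I * W) p q : (forall N, hs (f N) p) ->
  (forall N, ~ hs (f N) q) -> (forall N M, (N < M)%N -> hs (f N) <> hs (f M)) -> False.
Proof.
move=> fp fq finj; have [L LP] := sep_finite p q.
have : uniq [seq hs (f N) | N <- iota 0 (size L).+1].
  rewrite map_inj_uniq ?iota_uniq// => N M e.
  by have [/finj|/finj/(_ (esym e))|] := ltngtP N M.
move=> U; have /(uniq_leq_size U) : {subset [seq hs (f N) | N <- iota 0 (size L).+1] <= L}.
  by move=> _ /mapP[N _ ->]; exact: LP.
by rewrite size_map size_iota ltnn.
Qed.

Lemma hs_inj J K : hs J = hs K -> same J K.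
Proof.
move=> JK; have [g g1] := G_nt J.1.
have KJ : hs K J.2 by rewrite -JK; exact: hs_self.
have nK : ~ hs K (J.2 * inc g).
  by rewrite -JK /hs /sec /= mulKg head_self; apply/eqP.
have [|KJ1 cK] := @sec_edge _ _ _ adj_sym _ gp K J.2 J.1 g.
  by move=> e; apply: nK; rewrite /hs /= e.
by split=> //; exists J.2 => //; exact: car_self.
Qed.

Lemma hs_expS y J N : hs J `<=` hs (tr y J) -> hs J `<=` hs (tr (y ^+ N) J).
Proof.
move=> sub; elim: N => [|N IH]; first by rewrite expg0 tr1.
apply: (subset_trans IH); rewrite expgSr -tr_tr; exact: hs_trS.
Qed.

(** Otherwise infinitely many translates would separate [J.2] from [p]. *)
Lemma hs_asc y J p : hs J `<` hs (tr y J) -> exists N, hs (tr (y ^+ N) J) p.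
Proof.
move=> sub; have sub1 : hs J `<=` hs (tr y J) by case: sub.
apply: contrapT => no; have {}no N : ~ hs (tr (y ^+ N) J) p by move=> h; apply: no; exists N.
apply: (no_infinite_sep (f := fun N => tr (y ^+ N) J) (p := J.2) (q := p)) => //.
  by move=> N; exact: (@hs_expS y J N sub1 _ (hs_self J)).
move=> N M NM; have [_] := hs_trP (y ^+ N) sub; rewrite tr_tr -expgSr => nsub e.
apply: nsub; rewrite e -(subnKC NM) expgnDr -tr_tr; apply: hs_trS.
exact: hs_expS sub1.
Qed.

Lemma hs_desc z K p : hs (tr z K) `<` hs K -> exists N, ~ hs (tr (z ^+ N) K) p.
Proof.
move=> sub; have sub1 : hs (tr z K) `<=` hs K by case: sub.
apply: contrapT => no; have {}no N : hs (tr (z ^+ N) K) p.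
  by apply: contrapT => h; apply: no; exists N.
have [q Kq zKq] : exists2 q, hs K q & ~ hs (tr z K) q.
  apply: contrapT => nq; case: sub => _; apply => q Kq.
  by apply: contrapT => zq; apply: nq; exists q.
have expS N M : (N <= M)%N -> hs (tr (z ^+ M) K) `<=` hs (tr (z ^+ N) K).
  move=> /subnKC <-; elim: (M - N)%N => [|k IH]; first by rewrite addn0.
  apply: subset_trans IH; rewrite addnS expgSr -tr_tr; exact: hs_trS.
apply: (no_infinite_sep (f := fun N => tr (z ^+ N.+1) K) (p := p) (q := q)) => //.
  by move=> N zq; apply: zKq; have := expS 1%N N.+1 isT q zq; rewrite expg1.
move=> N M NM; have [_] := hs_trP (z ^+ N.+1) sub; rewrite tr_tr -expgSr => nsub e.
by apply: nsub; rewrite e; exact: expS.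
Qed.

Lemma hs_incrV y K : hs K `<` hs (tr y K) -> hs (tr y^-1 K) `<` hs K.
Proof. by move=> /(hs_trP y^-1); rewrite tr_tr mulVg tr1. Qed.

Lemma hs_decrV y K : hs (tr y K) `<` hs K -> hs K `<` hs (tr y^-1 K).
Proof. by move=> /(hs_trP y^-1); rewrite tr_tr mulVg tr1. Qed.

(** An edge changes the sector of [J] only on the carrier of [J], which lies in one sector of [K],
    and conversely; a path from [K.2] therefore never leaves both facing sectors. *)
Lemma quadrants J K x : ~ same J K -> ~ cross J K ->
  sec J x = sec J K.2 \/ sec K x = sec K J.2.
Proof.
move=> nS nC; rewrite -[x](mulVKg K.2).
apply: (@par_rind I G adj adj_sym W gp predT
  (fun s => sec J (K.2 * s) = sec J K.2 \/ sec K (K.2 * s) = sec K J.2)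
  _ _ _ (parT adj_sym gp (K.2^-1 * x))); first by left; rewrite mulg1.
move=> i g s _ _; rewrite mulgA; set u := K.2 * s => IH.
have nS' : ~ same K J by move/(same_sym).
have nC' : ~ cross K J by move/(cross_sym adj_sym).
have [Ju|/eqP/(sec_edge adj_sym)[Ji cJ]] := eqVneq (sec J (u * inc g)) (sec J u).
  have [Ku|/eqP/(sec_edge adj_sym)[Ki cK]] := eqVneq (sec K (u * inc g)) (sec K u).
    by rewrite Ju Ku.
  left; rewrite Ju; exact: (sec_car_const adj_sym nS' nC' cK (car_self _ _)).
have [Ku|/eqP/(sec_edge adj_sym)[Ki cK]] := eqVneq (sec K (u * inc g)) (sec K u); last first.
  by case: nS; split; [rewrite Ji Ki | exists u].
by right; rewrite Ku; exact: (sec_car_const adj_sym nS nC cJ (car_self _ _)).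
Qed.

(** Being of the same type, the hyperplanes do not cross. The powers of [y] provide a point of both
    half-spaces and a point of neither, so the half-spaces are not disjoint and do not cover [W];
    only nesting remains. *)
Lemma hs_chain y J K : J.1 = K.1 -> hs J `<` hs (tr y J) -> hs K `<` hs (tr y K) ->
  hs J `<=` hs K \/ hs K `<=` hs J.
Proof.
move=> JK1 yJ yK; have yJ1 : hs J `<=` hs (tr y J) by case: yJ.
have [x0 Jx0 Kx0] : exists2 x, hs J x & hs K x.
  have [N KN] := hs_asc J.2 yK; exists ((y ^+ N)^-1 * J.2); rewrite -hs_tr//.
  exact: (@hs_expS y J N yJ1 _ (hs_self J)).
have [x1 Jx1 Kx1] : exists2 x, ~ hs J x & ~ hs K x.
  have [g g1] := G_nt J.1; have [N KN] := hs_desc (J.2 * inc g) (hs_incrV yK).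
  exists ((y^-1 ^+ N)^-1 * (J.2 * inc g)); rewrite -hs_tr//.
  have sub := @hs_trS ((y ^+ N)^-1) _ _ (@hs_expS y J N yJ1).
  rewrite expVgn => /sub; rewrite tr_tr mulVg tr1 /hs /sec /= mulKg head_self.
  by apply/eqP.
have [sJK|nS] := pselect (same J K).
  left=> x Jx; have e : sec J x = sec J x0.
    by rewrite (Jx : sec J x = 1) (Jx0 : sec J x0 = 1).
  by have := same_sec adj_sym sJK e; rewrite (Kx0 : sec K x0 = 1).
have nC : ~ cross J K by move=> []; rewrite JK1 adj_irr.
have quad x := quadrants x nS nC.
have [JK|/eqP JK] := eqVneq (sec J K.2) 1; have [KJ|/eqP KJ] := eqVneq (sec K J.2) 1.
- by case: (quad x1); rewrite ?JK ?KJ => h; [case: Jx1 | case: Kx1].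
- by right=> x Kx; case: (quad x); rewrite ?JK// => h; case: KJ; rewrite -h.
- by left=> x Jx; case: (quad x); rewrite ?KJ// => h; case: JK; rewrite -h.
- by case: (quad x0) => h; [case: JK | case: KJ]; rewrite -h.
Qed.

Lemma hs_skew J y : ~ stab J y -> sec J (y * J.2) <> 1 -> sec J (y^-1 * J.2) = 1 ->
  hs J `<` hs (tr y J).
Proof.
move=> nst y1 yV1; have nS : ~ same J (tr y J) by move/(stab_same adj_sym).
have nC : ~ cross J (tr y J) by move=> []; rewrite /= adj_irr.
split=> [x Jx|].
  have [h|] := quadrants x nS nC; first by case: y1; rewrite -Jx h.
  by rewrite /hs /= => ->; rewrite sec_tr.
by move=> /(_ (y * J.2)); rewrite hs_tr mulKg => /(_ (hs_self J)).
Qed.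

Definition generic y := forall J, ~ stab J y.
Definition skews y J := hs J `<` hs (tr y J) \/ hs (tr y J) `<` hs J.

Lemma generic_inv y : generic y -> generic y^-1.
Proof. by move=> gy J /(stab_inv adj_sym); rewrite invgK; exact: gy. Qed.

Lemma generic_conj y w : generic y -> generic (w^-1 * y * w).
Proof.
by move=> gy J; rewrite -stab_tr; exact: gy.
Qed.

Lemma skewsV y J : skews y^-1 J <-> skews y J.
Proof.
by split=> -[/hs_incrV|/hs_decrV]; rewrite ?invgK => h; rewrite /skews; tauto.
Qed.

(** If [x] fixed a hyperplane, so would [y]: one that [x] rotates, by [rot_comm], or, if [x] rotates
    none, the same one by [lnk_comm_stab]. *)
Lemma generic_comm x y : generic y -> x * y = y * x -> x != 1 -> generic x.
Proof.
move=> gy xy x1 J Jx; have [[K rK]|nr] := pselect (exists K, rot K x).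
  by apply: (gy K); apply: rot_comm rK _.
have {}nr K : ~ rot K x by move=> r; apply: nr; exists K.
apply: (gy J); apply: (lnk_comm_stab adj_irr adj_sym adj_sq adj_two _ x1 nr) => //.
exact: stab_lnk Jx (nr J).
Qed.

(** A conjugate of minimal length is cyclically reduced, and its first letter gives
    a skewered half-space. *)
Lemma generic_skews (i0 : I) y : generic y -> exists J, skews y J.
Proof.
move=> gy.
have ex : exists m, `[< exists w, len gp (w^-1 * y * w) = m >].
  by exists (len gp (1^-1 * y * 1)); apply/asboolP; exists 1.
case: (ex_minnP ex) => m /asboolP[w <-] min.
have gy' := generic_conj (w := w) gy; set y' := w^-1 * y * w in gy' min.
have y'1 : y' != 1.
  by apply/eqP => e; apply: (gy' (i0, 1)); rewrite e; exact: stab1.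
have [j] := exists_head adj_sym gp y'1; set s := head j y' => s1.
exists (j, w); left; apply: hs_skew; first exact: gy.
  by rewrite /sec /= mulgA; apply/eqP.
rewrite /sec /= mulgA (_ : _ * w = y'^-1); last by rewrite !invgM invgK mulgA.
apply/eqP; apply: contraT => r1.
pose u := inc s^-1 * y'.
have uV : head j u^-1 = head j y'^-1.
  rewrite invgM -incV invgK; have [//|[_ y'j]] := head_mulr adj_sym gp y'^-1 j s.
  by case: (generic_inv gy' (J := (j, 1))); rewrite /stab /car /= invg1 mul1g mulg1.
have lenu : len gp y' = (len gp u).+1 := len_head s1.
set r := head j u^-1 in uV; rewrite -uV in r1.
have lenu' := len_head r1; rewrite lenV -/r in lenu'.
(* If [y'^-1] also began in [G j], conjugating [y'] by [inc s] would merge its two end letters and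
   shorten it. *)
have := min (len gp (u * inc s)).
have -> : u * inc s = (inc (s^-1 * r) * (inc r^-1 * u^-1))^-1.
  by rewrite !incM !incV !invgM !invgK -!mulgA mulVKg.
rewrite lenV => /(_ _)/leq_trans/(_ (len_cons_le _ _ _)).
rewrite -lenu' lenu ltnn; apply; apply/asboolP; exists (w * inc s).
rewrite (_ : _ * _ * _ = u * inc s); last by rewrite /u /y' incV invgM !mulgA.
by rewrite -lenV; congr len; rewrite !incM !incV !invgM !invgK -!mulgA mulVKg.
Qed.

Lemma skews_comm x y J : generic x -> generic y -> x * y = y * x -> skews y J -> skews x J.
Proof.
move=> gx gy xy.
wlog yJ : y gy xy / hs J `<` hs (tr y J).
  move=> H [yJ|/hs_decrV yJ]; first by apply: (H y) => //; left.
  apply: (H y^-1) => //; last by left.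
    exact: generic_inv.
  by apply: (mulIg y); rewrite mulgVK -mulgA xy mulKg.
move=> _; have yxJ : hs (tr x J) `<` hs (tr y (tr x J)).
  by rewrite tr_tr -xy -tr_tr; exact: hs_trP.
have nxJ : hs J <> hs (tr x J) by move/hs_inj/(stab_same adj_sym); exact: gx.
have [JxJ|xJJ] := hs_chain (erefl : J.1 = (tr x J).1) yJ yxJ; [left|right]; split=> // h;
  by apply: nxJ; apply/seteqP.
Qed.

(** Let [z] be in [lnk J], so that it preserves [hs J]. By invariance the half-space of [tr y J] and
    its translate by [z] are skewered in the same direction, hence nested; a strict nesting would
    iterate down past [J.2], so they are equal. Then [lnk J] fixes two disjoint hyperplanes and lies
    in one vertex conjugate, though it contains those of two neighbours. *)
Lemma skews_not_invariant y J : generic y -> skews y J ->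
  ~ (forall w K, skews y K -> skews y (tr w K)).
Proof.
move=> gy; wlog yJ : y gy / hs J `<` hs (tr y J).
  move=> H [yJ|/hs_decrV yJ] inv; first by apply: (H y gy yJ) => //; left.
  apply: (H y^-1 (generic_inv gy) yJ); first by left.
  by move=> w K /skewsV/(inv w)/skewsV.
move=> _ inv.
have yJ1 : hs J `<=` hs (tr y J) by case: yJ.
have lV z : lnk J z -> lnk J z^-1.
  rewrite /lnk (_ : _ * (z^-1 * _) = (J.2^-1 * (z * J.2))^-1); first exact: par_inv.
  by rewrite !invgM invgK mulgA.
have hz z : lnk J z -> hs (tr z J) = hs J.
  move=> zJ; apply/seteqP; split=> x; rewrite hs_tr /hs /=;
    by rewrite (lnk_sec adj_irr adj_sym x (lV z zJ)).
have hzN z N : lnk J z -> hs (tr (z ^+ N) J) = hs J.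
  move=> zJ; elim: N => [|N IH]; first by rewrite expg0 tr1.
  rewrite expgS -tr_tr -[RHS](hz z zJ); apply/seteqP.
  by split; apply: hs_trS; rewrite IH.
have nodesc z : lnk J z -> ~ hs (tr z (tr y J)) `<` hs (tr y J).
  move=> zJ /(hs_desc J.2)[N]; apply.
  have : hs (tr (z ^+ N) J) `<=` hs (tr (z ^+ N) (tr y J)) by exact: hs_trS.
  by rewrite hzN// => /(_ _ (hs_self J)).
have key z : lnk J z -> stab (tr y J) z.
  move=> zJ; apply/(stab_same adj_sym)/hs_inj.
  have yyJ : hs (tr y J) `<` hs (tr y (tr y J)) by exact: hs_trP.
  have [yzy|zyy] : skews y (tr z (tr y J)) by apply: inv; left.
    have [sub|sub] := hs_chain (erefl : (tr y J).1 = (tr z (tr y J)).1) yyJ yzy;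
      apply/seteqP; split=> //; apply: contrapT => nsub.
      apply: (nodesc z^-1 (lV z zJ)); apply: hs_incrV; split=> //.
    by apply: (nodesc z zJ); split.
  have [N] := hs_desc J.2 zyy; case.
  have sub : hs J `<=` hs (tr z (tr y J)) by rewrite -(hz z zJ); exact: hs_trS.
  exact: (@hs_trS (y ^+ N) _ _ sub) (@hs_expS y J N yJ1 _ (hs_self J)).
have nS : ~ same J (tr y J) by move/(stab_same adj_sym); exact: gy.
have nC : ~ cross J (tr y J) by move=> []; rewrite /= adj_irr.
have [L [_ _ LP]] := disjoint_stab_inter adj_irr adj_sym adj_sq adj_two nS nC.
have [b [c [bc Jb Jc]]] := adj_two J.1.
have sL a : adj J.1 a -> same (a, J.2) L.
  move=> Ja; have [z za z1] := ver_nontrivial gp G_nt (a, J.2).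
  apply: (ver_inj adj_irr adj_sym za _ z1).
  have zJ : lnk J z.
    have [g e] := ver_conj za; rewrite /= in e; rewrite /lnk e; exact: par_inc.
  exact: LP _ (lnk_stab zJ) (key z zJ).
have /= bL := (sL b Jb).1; have /= cL := (sL c Jc).1.
by move: bc; rewrite bL cL eqxx.
Qed.

End HalfSpaces.

(** * Automorphisms and hyperplanes *)

Section StarRigidity.
Context (I : finType) (G : I -> groupType) (adj : rel I).
Context (adj_irr : irreflexive adj) (adj_sym : symmetric adj).
Context (W : groupType) (gp : graph_product G adj W).
Context (G_nt : forall i, exists g : G i, g != 1).
Context (adj_tri : forall i j k, adj i j -> adj i k -> ~~ adj j k).
Context (adj_sq : forall i k a b, i != k -> adj i a -> adj k a -> adj i b -> adj k b -> a = b).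
Context (adj_two : forall i, exists b c, [/\ b != c, adj i b & adj i c]).
Local Notation inc := (inc gp).
Local Notation head := (head gp).
Local Notation par := (par gp).
Local Notation star := (star adj).
Local Notation link := (link adj).
Local Notation same := (same gp).
Local Notation cross := (cross gp).
Local Notation stab := (stab gp).
Local Notation rot := (rot gp).
Local Notation lnk := (lnk gp).
Implicit Types (i j k : I) (x y z s : W) (J K L : (I * W)%type).

(* No star and no clique separates the graph. *)
Context (no_sep : forall C Q : I -> Prop,
  (exists m, forall i, C i <-> star m i) \/ (forall k l, C k -> C l -> k = l \/ adj k l) ->
  (forall k l, adj k l -> ~ C k -> ~ C l -> Q k -> Q l) ->
  forall k l, ~ C k -> ~ C l -> Q k -> Q l).
Local Notation generic := (generic gp).
Local Notation skews := (skews gp).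

Context (phi psi : W -> W) (phiM : forall x y, phi (x * y) = phi x * phi y).
Context (phiK : cancel phi psi) (psiK : cancel psi phi).

Lemma mor1 : phi 1 = 1.
Proof. by apply: (mulgI (phi 1)); rewrite -phiM !mulg1. Qed.

Lemma morV x : phi x^-1 = (phi x)^-1.
Proof. by apply: (mulgI (phi x)); rewrite -phiM !mulgV mor1. Qed.

Lemma mor_neq1 x : x != 1 -> phi x != 1.
Proof. by apply: contraNneq => e; apply/eqP/(can_inj phiK); rewrite e mor1. Qed.

Lemma mor_inc_neq1 i (g : G i) : g != 1 -> phi (inc g) != 1.
Proof. by move=> g1; apply: mor_neq1; rewrite inc_eq1. Qed.

(** Commuting generic elements skewer the same half-spaces.  As the graph is
    connected, all the images of vertex group elements would skewer the same ones,
    and these would be invariant under all of [W]. *)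
Lemma mor_not_generic i0 (h0 : G i0) : h0 != 1 -> ~ generic (phi (inc h0)).
Proof.
set y0 := phi (inc h0) => h01 gy0.
pose P i := forall h : G i, h != 1 ->
  generic (phi (inc h)) /\ forall J, skews (phi (inc h)) J <-> skews y0 J.
have gen_adj i j (g : G i) (h : G j) : adj i j -> h != 1 -> generic (phi (inc g)) ->
    generic (phi (inc h)) /\ forall J, skews (phi (inc h)) J <-> skews (phi (inc g)) J.
  move=> ij h1 gg; have hg : phi (inc h) * phi (inc g) = phi (inc g) * phi (inc h).
    by rewrite -!phiM (incC _ _ _ ij).
  have gh : generic (phi (inc h)).
    exact: (@generic_comm _ _ _ adj_irr adj_sym _ _ adj_sq adj_two _ _ gg hg (mor_inc_neq1 h1)).
  split=> // J; split.
    exact: (skews_comm adj_irr adj_sym G_nt gg gh (esym hg)).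
  exact: (skews_comm adj_irr adj_sym G_nt gh gg hg).
have Padj i j : adj i j -> P i -> P j.
  move=> ij Pi h h1; have [g g1] := G_nt i; have [gg ggJ] := Pi g g1.
  have [gh ghJ] := gen_adj i j g h ij h1 gg.
  by split=> // J; rewrite ghJ; exact: ggJ.
have Pall i : P i.
  have [b [_ [_ i0b _]]] := adj_two i0.
  apply: (no_sep (C := fun=> False) (Q := P) _ _ (k := b)) => //; first by right.
    by move=> k l kl _ _; exact: Padj.
  by move=> h h1; exact: gen_adj.
have [J yJ] := generic_skews adj_irr adj_sym i0 gy0.
apply: (skews_not_invariant adj_irr adj_sym G_nt adj_sq adj_two gy0 yJ) => w.
rewrite -[w]psiK; elim/(inc_ind (g0 := gp)): (psi w) => [|i g x IH] K yK.
  by rewrite mor1 tr1.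
rewrite phiM -tr_tr; have [->|g1] := eqVneq g 1; first by rewrite inc1 mor1 tr1; exact: IH.
have [_ gJ] := Pall i g g1; apply/gJ; have /gJ := IH K yK.
by move=> -[|]; [left | right]; exact: hs_trP.
Qed.

(** The vertex group and its link commute, so a hyperplane rotated by the image of one is fixed by
    the image of the other. The cases below look for a hyperplane that serves both. *)
Lemma mor_star i : exists J, forall w, par (star i) w -> stab J (phi w).
Proof.
suff [J Ji Jl] : exists2 J, (forall g : G i, stab J (phi (inc g))) &
    forall w, par (link i) w -> stab J (phi w).
  exists J => w wi; rewrite -[w](mulVKg (inc (head i w))) -incV phiM.
  by apply: (stab_mul adj_sym); [exact: Ji | apply: Jl; exact: star_split].
have commil (g : G i) w : par (link i) w -> phi (inc g) * phi w = phi w * phi (inc g).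
  by move=> wl; rewrite -!phiM link_comm.
have [h h1] := G_nt i; set y := phi (inc h); have y1 : y != 1 := mor_inc_neq1 h1.
have comml w : par (link i) w -> phi w * y = y * phi w by move=> wl; rewrite commil.
have [b [_ [_ ib _]]] := adj_two i; have [hb hb1] := G_nt b.
have bl : par (link i) (inc hb) by exact: par_inc.
have b1 : phi (inc hb) != 1 := mor_inc_neq1 hb1.
have [J0 J0y] : exists J, stab J y.
  by apply: contrapT => no; apply: (mor_not_generic h1) => J Jy; apply: no; exists J.
(* If [y] rotates nothing, it lies in [lnk] of every hyperplane that it fixes, and its centralizer
   fixes [J0]. *)
have [[J rJ]|nr] := pselect (exists J, rot J y); last first.
  have {}nr K : ~ rot K y by move=> r; apply: nr; exists K.
  have ly := stab_lnk J0y (nr J0).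
  have J0l w : par (link i) w -> stab J0 (phi w).
    by move=> wl; apply: (lnk_comm_stab adj_irr adj_sym adj_sq adj_two ly y1 nr); exact: comml.
  exists J0 => // g.
  have [[w [wl rw]]|nrl] := pselect (exists w, par (link i) w /\ rot J0 (phi w)).
    by apply: (rot_comm adj_sym rw); exact: commil.
  have lx : lnk J0 (phi (inc hb)).
    by apply: stab_lnk; [exact: J0l | move=> r; apply: nrl; exists (inc hb)].
  apply: (lnk_comm_stab adj_irr adj_sym adj_sq adj_two lx b1); last exact: commil.
  (* [phi (inc hb)] rotates nothing either: [y] would fix such a [J1] and lie in [lnk] of both [J0]
     and [J1]. These cannot coincide, crossing makes [y] trivial, and disjointness makes it rotate
     some [L]. *)
  move=> J1 r1; have J1y : stab J1 y.
    by apply: (rot_comm adj_sym r1); rewrite comml.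
  have ly1 := stab_lnk J1y (nr J1).
  have [s01|n01] := pselect (same J0 J1).
    by apply: (lnk_not_rot adj_irr adj_sym lx); exact: (rot_same adj_sym (same_sym s01) r1).
  have [c01|m01] := pselect (cross J0 J1).
    by move/eqP: y1; apply; exact: (cross_lnk_eq1 adj_irr adj_sym adj_tri c01 ly ly1).
  have [L [_ _ LP]] := disjoint_stab_inter adj_irr adj_sym adj_sq adj_two n01 m01.
  by apply: (nr L); apply: ver_rot => //; exact: LP.
have Jl w : par (link i) w -> stab J (phi w).
  by move=> wl; apply: (rot_comm adj_sym rJ); exact: comml.
have [[w [wl rw]]|nrl] := pselect (exists w, par (link i) w /\ rot J (phi w)).
  by exists J => // g; apply: (rot_comm adj_sym rw); exact: commil.
have lJ w : par (link i) w -> lnk J (phi w).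
  by move=> wl; apply: stab_lnk; [exact: Jl | move=> r; apply: nrl; exists w].
have [[x [xl x1 nrx]]|allr] :=
    pselect (exists x, [/\ par (link i) x, x != 1 & forall K, ~ rot K (phi x)]).
  exists J => // g.
  apply: (lnk_comm_stab adj_irr adj_sym adj_sq adj_two (lJ x xl) (mor_neq1 x1) nrx).
  exact: commil.
have {}allr x : par (link i) x -> x != 1 -> exists2 K, rot K (phi x) & cross J K.
  move=> xl x1; have [K rK] : exists K, rot K (phi x).
    by apply: contrapT => no; apply: allr; exists x; split=> // K r; apply: no; exists K.
  exists K => //; have [s|//] := rot_stab adj_sym (Jl x xl) rK.
  by case: (lnk_not_rot adj_irr adj_sym (lJ x xl)); exact: (rot_same adj_sym (same_sym s) rK).
have inc_b1 : inc hb != 1 by rewrite inc_eq1.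
have [J1 r1 c1] := allr _ bl inc_b1.
have KJ1 (g : G i) : stab J1 (phi (inc g)).
  by apply: (rot_comm adj_sym r1); exact: commil.
(* Either [J1] serves, or a link element rotates some [J2] disjoint from [J1]; the image of [G i]
   then fixes two disjoint hyperplanes crossing [J], so it lies in [ver J]. *)
have [M1|] := pselect (forall w, par (link i) w -> stab J1 (phi w)); first by exists J1.
move=> /existsNP[x2 /not_implyP[x2l nx2]].
have x21 : x2 != 1 by apply: contra_notN nx2 => /eqP ->; rewrite mor1; exact: stab1.
have [J2 r2 c2] := allr _ x2l x21.
have n12 : ~ same J1 J2.
  by move=> s; apply: nx2; apply: (same_stab adj_sym (same_sym s)) r2.1.
have m12 : ~ cross J1 J2 by move=> [A12 _]; have := adj_tri c1.1 c2.1; rewrite A12.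
exists J => // g; apply: ver_stab => //.
apply: (cross_stab_inter adj_irr adj_sym G_nt adj_sq adj_two c1 c2 n12 m12) => //.
by apply: (rot_comm adj_sym r2); exact: commil.
Qed.

End StarRigidity.

(** * The hyperplanes under an automorphism *)

Section Correspondence.
Context (I : finType) (G : I -> groupType) (adj : rel I).
Context (adj_irr : irreflexive adj) (adj_sym : symmetric adj).
Context (W : groupType) (gp : graph_product G adj W).
Context (G_nt : forall i, exists g : G i, g != 1).
Context (adj_tri : forall i j k, adj i j -> adj i k -> ~~ adj j k).
Context (adj_sq : forall i k a b, i != k -> adj i a -> adj k a -> adj i b -> adj k b -> a = b).
Context (adj_two : forall i, exists b c, [/\ b != c, adj i b & adj i c]).
Local Notation inc := (inc gp).
Local Notation head := (head gp).
Local Notation par := (par gp).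
Local Notation star := (star adj).
Local Notation car := (car gp).
Local Notation sec := (sec gp).
Local Notation same := (same gp).
Local Notation cross := (cross gp).
Local Notation stab := (stab gp).
Local Notation ver := (ver gp).
Implicit Types (i j k : I) (x y z s : W) (J K L : (I * W)%type).

Context (no_sep : forall C Q : I -> Prop,
  (exists m, forall i, C i <-> star m i) \/ (forall k l, C k -> C l -> k = l \/ adj k l) ->
  (forall k l, adj k l -> ~ C k -> ~ C l -> Q k -> Q l) ->
  forall k l, ~ C k -> ~ C l -> Q k -> Q l).
Local Notation stab_sub_same := (stab_sub_same adj_irr adj_sym G_nt adj_tri adj_sq adj_two).
Local Notation crossP := (crossP adj_irr adj_sym gp G_nt adj_tri adj_sq adj_two).
Local Notation mor_star := (mor_star adj_irr adj_sym gp G_nt adj_tri adj_sq adj_two no_sep).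
Local Notation cross_stab_inter := (cross_stab_inter adj_irr adj_sym G_nt adj_sq adj_two).

Definition corr (f : W -> W) J K := forall z, stab J z <-> stab K (f z).

Section OneAutomorphism.
Context (phi psi : W -> W) (phiM : forall x y, phi (x * y) = phi x * phi y).
Context (phiK : cancel phi psi) (psiK : cancel psi phi).

Lemma corr_sym J K : corr phi J K -> corr psi K J.
Proof. by move=> JK z; rewrite JK psiK. Qed.

Lemma corr_tr g J K : corr phi J K -> corr phi (tr g J) (tr (phi g) K).
Proof. by move=> JK z; rewrite !stab_tr -(morV phiM) -!phiM. Qed.

Lemma inv_mor x y : psi (x * y) = psi x * psi y.
Proof. by apply: (can_inj phiK); rewrite phiM !psiK. Qed.

(** [mor_star] gives only an inclusion. Applied also to the inverse, it leads back to a stabilizer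
    containing the first one, and [stab_sub_same] turns the inclusions into equalities. *)
Lemma corr_ex J : exists K, corr phi J K.
Proof.
suff [K JK] : exists K, corr phi (J.1, 1) K.
  by exists (tr (phi J.2) K); have := corr_tr J.2 JK; case: (J) => i g; rewrite /tr /= mulg1.
have [K iK] := mor_star phiM phiK psiK J.1.
have [J' KJ'] := mor_star inv_mor psiK phiK K.1.
have stabi w : stab (J.1, 1) w = par (star J.1) w by rewrite /stab /car /= invg1 mul1g mulg1.
have KJ'' u : stab K u -> stab (tr (psi K.2) J') (psi u).
  by move/KJ'; rewrite stab_tr -(morV inv_mor) -!inv_mor !mulgA.
have sJ : same (J.1, 1) (tr (psi K.2) J').
  by apply: stab_sub_same => w; rewrite stabi => /iK/KJ''; rewrite phiK.
exists K => z; split=> [|/KJ'']; first by rewrite stabi; exact: iK.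
by rewrite phiK; exact: same_stab (same_sym sJ).
Qed.

Lemma corr_same J K J' K' : corr phi J K -> corr phi J' K' -> same J J' <-> same K K'.
Proof.
move=> JK JK'; split=> s; apply: stab_sub_same => y.
  by rewrite -[y]psiK => /JK/(same_stab adj_sym s)/JK'.
by move=> /JK/(same_stab adj_sym s)/JK'.
Qed.

Lemma corr_cross_sub J K J' K' : (forall L, exists L0, corr phi L0 L) ->
  corr phi J K -> corr phi J' K' -> cross J J' -> cross K K'.
Proof.
move=> surj JK JK' /crossP[nS max]; apply/crossP; split.
  by rewrite -(corr_same JK JK').
move=> L LP; have [L0 L0L] := surj L.
rewrite -(corr_same L0L JK) -(corr_same L0L JK'); apply: max => y Jy Jy'.
by apply/L0L/LP; [apply/JK | apply/JK'].
Qed.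

End OneAutomorphism.

Section InverseAutomorphisms.
Context (phi psi : W -> W) (phiM : forall x y, phi (x * y) = phi x * phi y).
Context (phiK : cancel phi psi) (psiK : cancel psi phi).
Let psiM : forall x y, psi (x * y) = psi x * psi y := inv_mor phiM phiK psiK.

Lemma corr_surj K : exists J, corr phi J K.
Proof.
by have [J KJ] := corr_ex psiM psiK phiK K; exists J; apply: corr_sym KJ.
Qed.

Lemma corr_cross J K J' K' : corr phi J K -> corr phi J' K' ->
  cross J J' <-> cross K K'.
Proof.
move=> JK JK'; split; first exact: (corr_cross_sub psiK corr_surj).
apply: (corr_cross_sub phiK); [|exact: corr_sym JK|exact: corr_sym JK'].
by move=> L; have [K0 LK0] := corr_ex phiM phiK psiK L; exists K0; apply: corr_sym LK0.
Qed.

(** Two neighbours of [J.1] give disjoint hyperplanes crossing [J] and fixed by [ver J]. Their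
    images are disjoint and cross [K], and what fixes both is in [ver K]. *)
Lemma corr_ver_sub J K z : corr phi J K -> ver J z -> ver K (phi z).
Proof.
move=> JK Jz; have [b [c [bc Jb Jc]]] := adj_two J.1.
have [Kb bKb] := corr_ex phiM phiK psiK (b, J.2).
have [Kc cKc] := corr_ex phiM phiK psiK (c, J.2).
have cb : cross J (b, J.2) by case: (J) Jb => i g; exact: cross_at.
have cc : cross J (c, J.2) by case: (J) Jc => i g; exact: cross_at.
apply: (cross_stab_inter (J := Kb) (K := Kc)).
- by rewrite -(corr_cross JK bKb).
- by rewrite -(corr_cross JK cKc).
- by rewrite -(corr_same psiK bKb cKc) => -[/= e]; rewrite e eqxx in bc.
- by rewrite -(corr_cross bKb cKc) => -[/= e]; rewrite (negbTE (adj_tri Jb Jc)) in e.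
- by apply/bKb; exact: cross_ver_stab Jz.
- by apply/cKc; exact: cross_ver_stab Jz.
Qed.

End InverseAutomorphisms.

Lemma corr_ver (phi psi : W -> W) J K z : (forall x y, phi (x * y) = phi x * phi y) ->
  cancel phi psi -> cancel psi phi -> corr phi J K -> ver J z <-> ver K (phi z).
Proof.
move=> phiM phiK psiK JK; split; first exact: corr_ver_sub JK.
rewrite -{2}[z]phiK; apply: (corr_ver_sub (inv_mor phiM phiK psiK) psiK phiK).
exact: corr_sym JK.
Qed.

Lemma dist_exists x J : exists m, `[< exists2 c, car J c & len gp (x^-1 * c) = m >].
Proof. by exists (len gp (x^-1 * J.2)); apply/asboolP; exists J.2 => //; exact: car_self. Qed.

Definition dist x J := ex_minn (dist_exists x J).

Lemma distP x J : exists2 c, car J c & len gp (x^-1 * c) = dist x J.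
Proof. by rewrite /dist; case: ex_minnP => m /asboolP. Qed.

Lemma dist_le x J c : car J c -> (dist x J <= len gp (x^-1 * c))%N.
Proof. by move=> Jc; rewrite /dist; case: ex_minnP => m _; apply; apply/asboolP; exists c. Qed.

(** If [T] is one of the hyperplanes at [1], those it equals or crosses form a star. If it is not,
    [cross_pair] prevents it from crossing two nonadjacent ones. *)
Lemma near_star_or_clique T :
  let C i := same T (i, 1) \/ cross T (i, 1) in
  (exists m, forall i, C i <-> star m i) \/ (forall k l, C k -> C l -> k = l \/ adj k l).
Proof.
move=> C; have [[i Ti]|nT] := pselect (exists i, same T (i, 1)); [left | right].
  exists i => k; split=> [[Tk|Tk]|].
  - by have := Tk.1; rewrite Ti.1 /= => ->; exact: star_self.
  - by have := Tk.1; rewrite Ti.1 /= /star => ->; rewrite orbT.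
  case/orP => [/eqP ->|ik]; first by left.
  by right; apply: (same_cross adj_sym (same_sym Ti)); exact: cross_at.
move=> k l [Tk|Tk]; first by case: nT; exists k.
move=> [Tl|Tl]; first by case: nT; exists l.
have [->|kl] := eqVneq k l; first by left.
have [|nkl] := boolP (adj k l); first by right.
have [a [_ _ Ta]] := cross_pair adj_irr adj_sym G_nt adj_sq kl nkl Tk Tl.
by case: nT; exists a.
Qed.

(** At a point [x] minimising the sum of the distances, a hyperplane [T] adjacent to
    [x] on the way to some [K i1] not containing [x] would have all the [K i] that
    are neither equal to it nor crossing it on its other side, by [no_sep]; moving
    through [T] would decrease the sum. *)
Lemma common_chamber (phi psi : W -> W) (K : I -> I * W) :
  (forall x y, phi (x * y) = phi x * phi y) -> cancel phi psi -> cancel psi phi ->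
  (forall i, corr phi (i, 1) (K i)) -> exists x, forall i, car (K i) x.
Proof.
move=> phiM phiK psiK Kc.
have ex : exists m, `[< exists x, (\sum_i dist x (K i) = m)%N >].
  by exists (\sum_i dist 1 (K i))%N; apply/asboolP; exists 1.
case: (ex_minnP ex) => m /asboolP[x <-] min; exists x => i1; apply: contrapT => nx.
have [c cK cd] := distP x (K i1); set g := x^-1 * c in cd.
have g1 : g != 1.
  by apply: contra_notN nx => /eqP g1; rewrite -[x]mulg1 -g1 mulVKg.
have [t s1] := exists_head adj_sym gp g1; set s := head t g in s1.
pose T := (t, x) : I * W; pose x' := x * inc s.
(* A rotation about [T] preserves the carrier of a [K l] crossing [T], so passing from [x] to [x']
   does not increase the distance to it. *)
have shift l (r : G t) b : cross T (K l) -> car (K l) b -> car (K l) (x * inc r * x^-1 * b).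
  move=> Tl; apply: (stab_car adj_sym); apply: (cross_ver_stab adj_sym Tl).
  by exists r.
pose C i := same T (K i) \/ cross T (K i).
pose Q i := forall b, car (K i) b -> sec T b = s.
have secC l b b' : ~ C l -> car (K l) b -> car (K l) b' -> sec T b = sec T b'.
  move=> nC; apply: (sec_car_const adj_sym) => h; apply: nC; [left | right].
    exact: same_sym.
  exact: cross_sym.
have n1 : ~ C i1.
  case=> [s_|cr]; first by apply: nx; apply: (same_car adj_sym s_); exact: (@car_self _ _ _ _ gp T).
  have := dist_le x (shift i1 s^-1 c cr cK).
  rewrite -cd (len_head s1) -!mulgA mulKg -/g.
  by rewrite ltnn.
have Q1 : Q i1 by move=> b bK; rewrite (secC i1 b c).
have QC l : ~ C l -> Q l.
  (* [near_star_or_clique] concerns the hyperplanes at [1], so it is applied to the preimage of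
     [T]. *)
  have [T0 T0T] := corr_surj phiM phiK psiK T.
  move=> nl; apply: (no_sep (C := C) (Q := Q) _ _ (k := i1)) => //.
    have CE i : C i <-> same T0 (i, 1) \/ cross T0 (i, 1).
      rewrite /C (corr_same psiK T0T (Kc i)).
      by rewrite (corr_cross phiM phiK psiK T0T (Kc i)).
    have [[j jP]|cl] := near_star_or_clique T0; [left | right].
      by exists j => i; rewrite CE.
    by move=> k j /CE kC /CE; exact: cl.
  move=> k j kj nk nj Qk b bj.
  have [_ [z kz jz]] : cross (K k) (K j).
    by rewrite -(corr_cross phiM phiK psiK (Kc k) (Kc j)); exact: cross_at.
  by rewrite (secC j b z) //; exact: Qk.
have dQ l : Q l -> (dist x' (K l) < dist x (K l))%N.
  move=> Ql; have [b bK <-] := distP x (K l); apply: leq_ltn_trans (dist_le x' bK) _.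
  have bs : head t (x^-1 * b) = s := Ql b bK.
  have := @len_head _ _ _ _ gp t (x^-1 * b); rewrite bs => /(_ s1) ->.
  by rewrite invgM -incV -mulgA ltnS.
have dC l : (dist x' (K l) <= dist x (K l))%N.
  have [[sl|cl]|/QC/dQ/ltnW//] := pselect (C l).
    have x'K : car (K l) x'.
      apply: (same_car adj_sym sl); apply: (car_mul adj_sym); first exact: (@car_self _ _ _ _ gp T).
      by apply: (par_inc adj_sym); exact: star_self.
    by apply: leq_trans (dist_le x' x'K) _; rewrite mulVg len1.
  have [b bK <-] := distP x (K l); apply: leq_trans (dist_le x' (shift l s b cl bK)) _.
  by rewrite -mulgA mulKg.
have := min (\sum_i dist x' (K i))%N; rewrite leqNgt => /(_ _)/negP; apply.
  by apply/asboolP; exists x'.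
rewrite (bigD1 i1)// [X in (_ < X)%N](bigD1 i1)//= -addSn leq_add// ?dQ//.
by apply: leq_sum => i _; exact: dC.
Qed.
End Correspondence.

(** * The action of automorphisms on half-spaces *)

Section HalfSpaceAction.
Context (I : finType) (G : I -> groupType) (adj : rel I).
Context (adj_irr : irreflexive adj) (adj_sym : symmetric adj).
Context (W : groupType) (gp : graph_product G adj W).
Context (G_nt : forall i, exists g : G i, g != 1).
Context (adj_tri : forall i j k, adj i j -> adj i k -> ~~ adj j k).
Context (adj_sq : forall i k a b, i != k -> adj i a -> adj k a -> adj i b -> adj k b -> a = b).
Context (adj_two : forall i, exists b c, [/\ b != c, adj i b & adj i c]).
Local Notation inc := (inc gp).
Local Notation head := (head gp).
Local Notation par := (par gp).
Local Notation star := (star adj).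
Local Notation car := (car gp).
Local Notation sec := (sec gp).
Local Notation same := (same gp).
Local Notation stab := (stab gp).
Local Notation ver := (ver gp).
Implicit Types (i j k : I) (x y z s : W) (J K L : (I * W)%type).

Context (no_sep : forall C Q : I -> Prop,
  (exists m, forall i, C i <-> star m i) \/ (forall k l, C k -> C l -> k = l \/ adj k l) ->
  (forall k l, adj k l -> ~ C k -> ~ C l -> Q k -> Q l) ->
  forall k l, ~ C k -> ~ C l -> Q k -> Q l).
Local Notation hs := (hs gp).
Local Notation corr := (corr gp).
Local Notation corr_ex :=
  (corr_ex adj_irr adj_sym gp G_nt adj_tri adj_sq adj_two no_sep).
Local Notation corr_ver :=
  (corr_ver adj_irr adj_sym G_nt adj_tri adj_sq adj_two no_sep).
Local Notation common_chamber :=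
  (common_chamber adj_irr adj_sym G_nt adj_tri adj_sq adj_two no_sep).
Local Notation corr_same := (corr_same adj_irr adj_sym G_nt adj_tri adj_sq adj_two).
Local Notation corr_cross := (corr_cross adj_irr adj_sym G_nt adj_tri adj_sq adj_two no_sep).

Lemma star_compl a : exists k, ~~ star k a.
Proof.
have [b [_ [_ ab _]]] := adj_two a; have ba : adj b a by rewrite adj_sym.
have [d da bd] : exists2 d, d != a & adj b d.
  have [c [d [cd bc bd]]] := adj_two b; have [e|] := eqVneq c a; last by exists c.
  by exists d => //; rewrite -e eq_sym.
exists d; rewrite /star negb_or eq_sym da /=.
exact: adj_tri bd ba.
Qed.

Lemma star_inter_eq1 x : (forall k, par (star k) x) -> x = 1.
Proof.
move=> xk; apply/eqP; apply: contraT => /(exists_head adj_sym gp)[a xa].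
have [k] := star_compl a; have [-> //] := par_head adj_sym (xk k) xa.
Qed.

(** For an automorphism [a], [moves a (s, w)] says that [a] maps the star subgroup
    of every [i] to the conjugate by [w] of the star subgroup of [s i]. *)
Definition moves (a : W -> W) (d : (I -> I) * W) := forall i, corr a (i, 1) (d.1 i, d.2).

Lemma moves_exists (a : group_aut W) : exists d, moves a d.
Proof.
have [b aK bK] := aut_bij a.
have [K Kc] := choice (corr_ex (autM a) aK bK).
have [x xK] := common_chamber (autM a) aK bK (fun i => Kc (i, 1)).
exists (fun i => (K (i, 1)).1, x) => i z; rewrite Kc /=.
by split; apply: (same_stab adj_sym); [|apply: same_sym]; exact: same_rep.
Qed.

Lemma moves_inj (a b : W -> W) d : cancel b a -> moves a d -> injective d.1.
Proof.
move=> bK ad i j e; have : same (d.1 i, d.2) (d.1 j, d.2) by rewrite e; exact: same_refl.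
by rewrite -(corr_same bK (ad i) (ad j)) => -[].
Qed.

Lemma moves_unique (a b : W -> W) d d' : cancel b a -> moves a d -> moves a d' -> d.2 = d'.2.
Proof.
move=> bK ad ad'; have dI := moves_inj bK ad.
suff /(canRL (mulVKg _)) -> : d.2^-1 * d'.2 = 1 by rewrite mulg1.
apply: star_inter_eq1 => k; have [s sK Ks] := injF_bij dI.
have : same (d.1 (s k), d.2) (d'.1 (s k), d'.2).
  by rewrite -(corr_same bK (ad (s k)) (ad' (s k))); exact: same_refl.
move=> /same_sym/(same_car adj_sym)/(_ (@car_self _ _ _ _ gp _)).
by rewrite /car /= Ks.
Qed.

Lemma moves_comp (a : group_aut W) (b : W -> W) d d' : moves a d -> moves b d' ->
  moves (a \o b) (d.1 \o d'.1, a d'.2 * d.2).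
Proof.
move=> ad bd' i z; rewrite (bd' i z) /=.
have := corr_tr (autM a) d'.2 (ad (d'.1 i)).
by rewrite /tr /= mulg1; apply.
Qed.

Lemma moves_conj u : moves (fun x => u * x * u^-1) (id, u).
Proof.
move=> i z; rewrite (_ : (id i, u) = tr u (i, 1)) ?stab_tr /tr ?mulg1//=.
by rewrite -!mulgA mulKg mulVg mulg1.
Qed.

(** Conjugated back by [d.2], [a] maps each [G k] into [G (d.1 k)] and respects adjacency, so it
    carries decompositions without cancellation to such decompositions. *)
Lemma moves_head (a b : W -> W) d i z : (forall x y, a (x * y) = a x * a y) ->
  cancel a b -> cancel b a -> moves a d ->
  (head (d.1 i) (d.2^-1 * a z * d.2) == 1) = (head i z == 1).
Proof.
move=> aM aK bK ad; have dI := moves_inj bK ad.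
pose c x := d.2^-1 * a x * d.2.
have cM x y : c (x * y) = c x * c y by rewrite /c aM -!mulgA mulVKg.
have cinc k (g : G k) : g != 1 -> exists2 g' : G (d.1 k), g' != 1 & c (inc g) = inc g'.
  move=> g1; have vg : ver (k, 1) (inc g) by exists g; rewrite /= mul1g invg1 mulg1.
  have [g' gg'] := iffLR (corr_ver _ aM aK bK (ad k)) vg.
  exists g'; last by rewrite /c gg' /= !mulgA mulVg mul1g mulgVK.
  apply: contraNneq g1 => e; rewrite -(inc_eq1 gp) -(inj_eq (can_inj aK)) gg' e inc1 mulg1 mulgV.
  by rewrite (mor1 aM).
have adjE k l : adj k l = adj (d.1 k) (d.1 l).
  have := corr_cross aM aK bK (ad k) (ad l) => -[h1 h2]; apply/idP/idP => h.
    by case: (h1 (cross_at gp 1 h)).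
  by case: (h2 (cross_at gp d.2 h)).
have fwd k y : head k y = 1 -> head (d.1 k) (c y) = 1.
  elim: (parT adj_sym gp y) k => [|l g {}y _ g1 yl _ IH] k.
    by move=> _; rewrite /c (mor1 aM) mulg1 mulVg head1.
  have [g' g'1 gE] := cinc l g g1; rewrite cM gE.
  have [->|kl] := eqVneq k l; first by rewrite head_inc yl mulg1 => e; rewrite e eqxx in g1.
  have [A|N] := boolP (adj k l).
    by rewrite !head_adj -?adjE//; exact: IH.
  by move=> _; rewrite head_nonadj -?adjE// ?(inj_eq dI)// IH.
apply/eqP/eqP => [|/fwd//]; apply: contraPP => /eqP z1.
have [g' g'1 gE] := cinc i _ z1.
have := fwd i (inc (head i z)^-1 * z); rewrite head_inc mulVg => /(_ erefl) h.
rewrite -/(c z) -[z](mulVKg (inc (head i z))) -incV cM gE head_inc h mulg1.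
exact/eqP.
Qed.

Definition dat (a : group_aut W) := sval (cid (moves_exists a)).
(** The action on chambers: [a] takes the hyperplanes at [1] to those at [(dat a).2], hence those at
    [x] to those at [a x * (dat a).2]. Conjugations act as left translations. *)
Definition mv (a : group_aut W) (x : W) : W := a x * (dat a).2.

Lemma dat_moves (a : group_aut W) : moves a (dat a).
Proof. by rewrite /dat; case: cid. Qed.

Lemma mv_eq (a : group_aut W) d x : moves a d -> mv a x = a x * d.2.
Proof.
by have [b _ bK] := aut_bij a; move=> ad; rewrite /mv (moves_unique bK (dat_moves a) ad).
Qed.

Lemma mv1 x : mv 1 x = x.
Proof. by rewrite (mv_eq (d := (id, 1)))// mulg1. Qed.

Lemma mvM a b x : mv (a * b) x = mv a (mv b x).
Proof.
have ab := moves_comp (dat_moves a) (dat_moves b).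
by rewrite (mv_eq _ (ab : moves (a * b) _)) /= /mv autM mulgA.
Qed.

Lemma mvK a : cancel (mv a) (mv a^-1).
Proof. by move=> x; rewrite -mvM mulVg mv1. Qed.

Lemma mv_hs a J : exists K, forall x, hs K (mv a x) <-> hs J x.
Proof.
have [b aK bK] := aut_bij a; have ad := dat_moves a.
exists ((dat a).1 J.1, mv a J.2) => x; rewrite /hs /sec /=.
have := moves_head J.1 (J.2^-1 * x) (autM a) aK bK ad.
have -> : (dat a).2^-1 * a (J.2^-1 * x) * (dat a).2 = (mv a J.2)^-1 * mv a x.
  by rewrite autM (morV (autM a)) /mv invgM !mulgA.
by move=> e; split=> /eqP h; apply/eqP; rewrite ?e// -e.
Qed.

(** Acting on all subsets of [W] avoids a separate type of half-spaces; [through1] singles out the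
    relevant ones. *)
Definition act (a : group_aut W) (A : set W) : set W := mv a @` A.

Lemma act1 : act 1 =1 id.
Proof. by move=> A; rewrite /act (eq_imagel (f' := id)) ?image_id// => x _; exact: mv1. Qed.

Lemma actM a b : act (a * b) =1 act a \o act b.
Proof.
move=> A; rewrite /act /= image_comp; apply: eq_imagel => x _ /=.
exact: mvM.
Qed.

Lemma act_mem a A x : act a A (mv a x) <-> A x.
Proof.
by split=> [[y Ay /(can_inj (mvK a)) <-]|Ax]; [|exists x].
Qed.

Lemma act_hs a J : exists K, act a (hs J) = hs K.
Proof.
have [K KP] := mv_hs a J; exists K; apply/seteqP; split=> x.
  by move=> [y Jy <-]; apply/KP.
by rewrite -[x](mvK a^-1) invgK => /KP /act_mem.
Qed.

Lemma act_mulK a A : act a (act a^-1 A) = A.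
Proof. by have := actM a a^-1 A; rewrite mulgV act1. Qed.

Definition through1 (A : set W) : bool := `[< A 1 /\ exists J, A = hs J >].

(** The sets concerned are half-spaces containing exactly one of [1] and [mv a 1]. *)
Lemma through1_finite a : exists L : seq (set W),
  forall A, through1 A (+) through1 (act a^-1 A) -> A \in L.
Proof.
have [L1 L1P] := sep_finite adj_sym gp 1 (mv a 1).
have [L2 L2P] := sep_finite adj_sym gp (mv a 1) 1.
have shift A : act a^-1 A 1 <-> A (mv a 1).
  by rewrite -[X in act _ _ X](mvK a); exact: act_mem.
exists (L1 ++ L2) => A; rewrite mem_cat.
have [/asboolP[A1 [J AJ]] /= nA|nA /asboolP[A1 [J AJ]]] :=
    boolP (through1 A); apply/orP.
  left; rewrite AJ; apply: L1P; first by rewrite -AJ.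
  rewrite -AJ => Aa; case/asboolP: nA; split; first exact/shift.
  by rewrite AJ; exact: act_hs.
have [K AK] := act_hs a J; have {}AK : A = hs K by rewrite -AK -AJ act_mulK.
right; rewrite AK; apply: L2P; first by rewrite -AK; exact/shift.
by rewrite -AK => A1'; case/asboolP: nA; split=> //; exists K.
Qed.

Definition separating (a : group_aut W) : seq (set W) :=
  [seq A <- undup (sval (cid (through1_finite a))) | through1 A (+) through1 (act a^-1 A)].

Lemma separating_uniq a : uniq (separating a).
Proof. by rewrite filter_uniq ?undup_uniq. Qed.

Lemma mem_separating a A : (A \in separating a) = through1 A (+) through1 (act a^-1 A).
Proof.
rewrite mem_filter mem_undup andb_idr//.
by case: cid => L /= LP; exact: LP.
Qed.

Lemma conj_autM u : {morph (fun x : W => u * x * u^-1) : x y / x * y}.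
Proof. by move=> x y; rewrite !mulgA mulgVK. Qed.

Lemma conj_aut_bij u : bijective (fun x : W => u * x * u^-1).
Proof.
exists (fun x => u^-1 * x * u) => x; first by rewrite !mulgA mulVg mul1g mulgVK.
by rewrite !mulgA mulgV mul1g mulgK.
Qed.

Definition conj_aut u := GroupAut (conj_autM u) (conj_aut_bij u).

Lemma mv_conj u x : mv (conj_aut u) x = u * x.
Proof. by rewrite (mv_eq _ (moves_conj u : moves (conj_aut u) _)) /= mulgVK. Qed.

Lemma separating_unbounded (i0 : I) N : exists a, (N <= size (separating a))%N.
Proof.
have [q] := star_compl i0; set p := i0; rewrite /star negb_or => /andP[pq Nqp].
have Npq : ~~ adj p q by rewrite adj_sym.
have [[g g1] [h h1]] := (G_nt p, G_nt q).
pose y := inc g * inc h; pose J := (p, 1 : W).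
have hp : head p (inc h) = 1 by exact: head_other.
have hy : head p y = g by rewrite head_inc hp mulg1.
have skew : hs J `<` hs (tr y J).
  apply: (hs_skew adj_irr adj_sym).
  - rewrite /stab /car /= invg1 mul1g mulg1 => /(par_head adj_sym (i := p)).
    rewrite hy incV mulKg => /(_ g1)[_ /(par_head adj_sym (i := q))].
    rewrite head_self => /(_ h1)[]; rewrite /star eq_sym (negbTE pq) /=.
    by rewrite (negbTE Npq).
  - by rewrite /sec /= invg1 mul1g mulg1 hy; apply/eqP.
  rewrite /sec /= invg1 mul1g mulg1 invgM -!incV; apply: head_nonadj => //.
    by rewrite invg_eq1.
  by apply: head_other; rewrite eq_sym.
have sub : hs J `<=` hs (tr y J) by case: skew.
have ny M : (0 < M)%N -> ~ hs J (y ^+ M).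
  case: M => // M _ /(hs_expS M sub); rewrite hs_tr expgSr mulKg.
  by rewrite /hs /sec /= invg1 mul1g hy; apply/eqP.
pose A (k : nat) := hs (tr (y ^+ k) J).
have inj (k l : nat) : (k < l)%N -> A k <> A l.
  move=> kl e; have [_] := hs_trP (y ^+ k) skew; rewrite tr_tr -expgSr; apply.
  rewrite -/(A k) e -(subnKC kl) /A expgnDr -tr_tr; apply: hs_trS.
  exact: hs_expS.
pose a := conj_aut (y ^+ N); exists a.
have U : uniq [seq A k | k : nat <- iota 0 N].
  rewrite map_inj_uniq ?iota_uniq// => k l e.
  by have [/inj|/inj/(_ (esym e))|] := ltngtP k l.
move: (@uniq_leq_size _ _ (separating a) U); rewrite size_map size_iota; apply.
move=> B /mapP[k]; rewrite mem_iota add0n => /andP[_ kN] -> {B}.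
rewrite mem_separating; have -> : through1 (A k).
  by apply/asboolP; split; [exact: (hs_expS k sub (hs_self gp J)) | exists (tr (y ^+ k) J)].
apply/negP => /asboolP[]; rewrite -[X in act _ _ X](mvK a) => /act_mem.
rewrite mv_conj mulg1 /A hs_tr -[in y ^+ N](subnKC (ltnW kN)) expgnDr mulKg.
by move=> /ny h2; case: h2; rewrite subn_gt0.
Qed.

Lemma aut_not_property_T (R : realType) (i0 : I) : ~ property_T R (group_aut W).
Proof.
exact: (not_property_T act1 actM separating_uniq mem_separating (separating_unbounded i0)).
Qed.

End HalfSpaceAction.

(** * Cyclic products *)

Section CyclicGraph.
Local Open Scope ring_scope.
Context (n : nat) (n_ge5 : (5 <= n)%N).
Implicit Types (i j k l : 'Z_n) (e : int).

Definition cyc_adj : rel 'Z_n := fun i j => (j == i + 1) || (i == j + 1).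

Lemma cyc_adj_sym : symmetric cyc_adj.
Proof. by move=> i j; rewrite /cyc_adj orbC. Qed.

Lemma intr_Zp_eq0 e : `|e| < n%:Z -> e%:~R = 0 :> 'Z_n -> e = 0.
Proof.
have nat0 m : (m < n)%N -> m%:R = 0 :> 'Z_n -> m = 0%N.
  move=> mn /(congr1 val) /=; rewrite val_Zp_nat ?modn_small//.
  exact: leq_trans n_ge5.
case: e => m; first by move=> mn /nat0 ->.
rewrite NegzE => mn; rewrite intrN => /eqP; rewrite oppr_eq0 => /eqP /nat0 -> //.
Qed.

(** With integer offsets, [shift_inj] reduces questions about the cycle to linear arithmetic as long
    as the offsets differ by less than [n]. *)
Lemma cyc_adjP i j : reflect (exists2 e, j = i + e%:~R & e = 1 \/ e = -1) (cyc_adj i j).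
Proof.
apply: (iffP orP) => [[/eqP ->|/eqP ->]|[e ->] [|] ->].
- by exists 1; [|left].
- by exists (-1); [rewrite addrK | right].
- by left.
- by right; rewrite subrK.
Qed.

Lemma cyc_adj_irr : irreflexive cyc_adj.
Proof.
move=> i; apply/cyc_adjP => -[e /eqP]; rewrite addrC -subr_eq subrr eq_sym => /eqP /intr_Zp_eq0.
by move=> h [] e1; move: h; rewrite e1 => /(_ _)/eqP; lia.
Qed.

Lemma shift_inj i e e' : i + e%:~R = i + e'%:~R -> `|e - e'| < n%:Z -> e = e'.
Proof.
move=> /addrI /eqP; rewrite -subr_eq0 -intrB => /eqP ee lt.
by apply/eqP; rewrite -subr_eq0; apply/eqP; exact: intr_Zp_eq0.
Qed.

Lemma cyc_adj_tri i j k : cyc_adj i j -> cyc_adj i k -> ~~ cyc_adj j k.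
Proof.
move=> /cyc_adjP[e1 -> h1] /cyc_adjP[e2 -> h2]; apply/cyc_adjP => -[e3 /esym + h3].
by rewrite -addrA -intrD => /shift_inj; lia.
Qed.

(** Going round a square adds up four unit steps, with total at most 4 in absolute value; as this is
    less than [n], the total vanishes already in the integers. *)
Lemma cyc_adj_sq i k a b : i != k -> cyc_adj i a -> cyc_adj k a -> cyc_adj i b ->
  cyc_adj k b -> a = b.
Proof.
rewrite ![cyc_adj k _]cyc_adj_sym.
move=> /eqP ik /cyc_adjP[e1 -> h1] /cyc_adjP[e2 kE h2] /cyc_adjP[e3 -> h3] /cyc_adjP[e4 kE' h4].
congr (_ + _%:~R); apply: contrapT => ne; apply: ik.
move: kE'; rewrite {}kE -!addrA -!intrD => /shift_inj h.
have -> : e1 + e2 = 0 by lia.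
by rewrite addr0.
Qed.

Lemma cyc_adj_two i : exists b c, [/\ b != c, cyc_adj i b & cyc_adj i c].
Proof.
exists (i + 1%:~R), (i + (-1)%:~R); split.
- by apply/eqP => /shift_inj; lia.
- by apply/cyc_adjP; exists 1 => //; left.
- by apply/cyc_adjP; exists (-1) => //; right.
Qed.

Lemma cyc_walk (C Q : 'Z_n -> Prop) (d : int) i (m : nat) : d = 1 \/ d = -1 ->
  (forall k l, cyc_adj k l -> ~ C k -> ~ C l -> Q k -> Q l) ->
  (forall t : nat, (t <= m)%N -> ~ C (i + (d * t%:Z)%:~R)) -> Q i ->
  Q (i + (d * m%:Z)%:~R).
Proof.
move=> d1 QC; elim: m => [|m IH] nC Qi; first by rewrite mulr0 addr0.
apply: QC (IH _ Qi); [|exact: nC|exact: nC|].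
  apply/cyc_adjP; exists d => //; rewrite -addrA -intrD; congr (_ + _%:~R); lia.
by move=> t tm; apply: nC; exact: leqW.
Qed.

(** Two vertices outside [C] can only be separated by vertices of [C] on each of the
    two arcs between them. *)
Lemma cyc_no_sep (C Q : 'Z_n -> Prop) :
  (exists m, forall i, C i <-> star cyc_adj m i) \/
    (forall k l, C k -> C l -> k = l \/ cyc_adj k l) ->
  (forall k l, cyc_adj k l -> ~ C k -> ~ C l -> Q k -> Q l) ->
  forall k l, ~ C k -> ~ C l -> Q k -> Q l.
Proof.
move=> CP QC k l nk nl Qk; apply: contrapT => nQ.
have n0 : n%:Z%:~R = 0 :> 'Z_n.
  by apply: val_inj; rewrite /= val_Zp_nat ?modnn// (leq_trans _ n_ge5).
have [m mn lE] : exists2 m : nat, (m < n)%N & l = k + m%:Z%:~R.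
  exists (val (l - k)); last by rewrite [X in _ + X]natr_Zp addrC subrK.
  have := ltn_ord (l - k); rewrite {2}Zp_cast//; exact: leq_trans n_ge5.
have lE' : l = k + (-1 * (n - m)%N%:Z)%:~R.
  rewrite lE; have -> : -1 * (n - m)%N%:Z = m%:Z - n%:Z by lia.
  by rewrite intrB n0 subr0.
have [a am Ca] : exists2 a : nat, (0 < a < m)%N & C (k + a%:Z%:~R).
  apply: contrapT => no; apply: nQ; rewrite lE -[m%:Z]mul1r.
  apply: (cyc_walk (C := C)) => //; first by left.
  move=> t; rewrite mul1r leq_eqVlt => /predU1P[->|tm]; first by rewrite -lE.
  case: t tm => [|t] tm; first by rewrite addr0.
  by move=> Ct; apply: no; exists t.+1.
have [b bm Cb] : exists2 b : nat, (0 < b < n - m)%N & C (k + (- b%:Z)%:~R).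
  apply: contrapT => no; apply: nQ; rewrite lE'.
  apply: (cyc_walk (C := C)) => //; first by right.
  move=> t; rewrite leq_eqVlt => /predU1P[->|tm]; first by rewrite -lE'.
  case: t tm => [|t] tm; first by rewrite addr0.
  by move=> Ct; apply: no; exists t.+1; rewrite // -mulN1r.
have starE c i : star cyc_adj c i -> exists2 e, i = c + e%:~R & `|e| <= 1.
  case/orP=> [/eqP ->|/cyc_adjP[e -> h]]; first by exists 0; rewrite ?addr0.
  by exists e => //; lia.
case: CP => [[c cP]|cl]; last first.
  have : star cyc_adj (k + (- b%:Z)%:~R) (k + a%:Z%:~R).
    by rewrite /star; have [->|->] := cl _ _ Cb Ca; rewrite ?eqxx ?orbT.
  by move=> /starE[e + he]; rewrite -addrA -intrD => /shift_inj; lia.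
have [ea aE ha] := starE _ _ (iffLR (cP _) Ca).
have [eb bE hb] := starE _ _ (iffLR (cP _) Cb).
have Cc : C c by apply/cP; exact: star_self.
have cE : c = k + (a%:Z - ea)%:~R by rewrite intrB addrA aE addrK.
have := bE; rewrite cE -addrA -intrD => /shift_inj h.
(* A star meeting both open arcs has its centre at [k] or at [l]: its ends are on either side of the
   centre, which is [k] when [ea = 1] and [eb = -1], and [l] otherwise. *)
have [e2|e2] := eqVneq (ea - eb) 2.
  apply: nk; move: Cc; rewrite cE (_ : a%:Z - ea = 0) ?addr0//.
  by lia.
apply: nl; move: Cc; rewrite cE lE (_ : a%:Z - ea = m%:Z)//.
by lia.
Qed.

End CyclicGraph.

(** * The cyclic product as a graph product *)

Section CyclicProduct.
Context (n : nat) (n_ge5 : (5 <= n)%N) (G : 'Z_n -> groupType).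
Local Notation adj := (@cyc_adj n).
Local Notation reachable := (@reachable 'Z_n G adj).
Local Notation W := (cyclic_product G).
Let irr := cyc_adj_irr n_ge5.
Let sym := @cyc_adj_sym n.
Implicit Types (i j : 'Z_n) (x y : W).

Definition cyc_inc i (g : G i) : W := \pi_(congr_quot (@cyclic_rel n G))%qT (fp_in g).
Definition cyc_act x T := fp_act adj (repr x) T.
(** The table obtained by acting on the empty one is the normal form of [x]; [fp_act_congr] makes it
    independent of the representatives chosen by [repr]. *)
Definition cyc_head i x : G i := thead adj i (cyc_act x (@tnil _ G)).

Lemma fp_act_congr (x y : free_product G) T : congr_closure (@cyclic_rel n G) x y ->
  reachable T -> fp_act adj x T = fp_act adj y T.
Proof.
move=> xy; elim: xy T => {x y} [x y [i g h]|//|x y _ IH|x y z _ IH _ IH'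
  |x y u v _ IH _ IH'] T rT.
- rewrite !(fp_actM irr sym)// !(fp_act_in irr sym)//; last exact: (reachable_tact irr sym).
    by apply: (tactC irr sym) => //; rewrite /cyc_adj eqxx.
  exact: (reachable_tact irr sym).
- by rewrite IH.
- by rewrite IH// IH'.
- by rewrite !(fp_actM irr sym)// IH'// IH//; exact: (reachable_fp_act irr sym).
Qed.

Lemma cyc_act_inc i (g : G i) x : cyc_act (cyc_inc g * x) (@tnil _ G) =
  tact adj g (cyc_act x (@tnil _ G)).
Proof.
have r0 := @reachable0 _ G adj.
rewrite /cyc_act -[x in LHS]reprK -congr_quot_piM.
rewrite (fp_act_congr (congr_quot_reprP _ _))// (fp_actM irr sym)// (fp_act_in irr sym)//.
exact: (reachable_fp_act irr sym).
Qed.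

Lemma reachable_cyc_act x : reachable (cyc_act x (@tnil _ G)).
Proof. by apply: (reachable_fp_act irr sym); exact: reachable0. Qed.

Lemma cyc_incM i (g h : G i) : cyc_inc (g * h) = cyc_inc g * cyc_inc h.
Proof.
rewrite /cyc_inc -congr_quot_piM; congr (\pi_(congr_quot _)%qT _).
by rewrite /fp_in -congr_quot_piM; apply/esym/congr_quotP/asboolP/congr_base/fp_relM.
Qed.

Lemma cyc_incC i j (g : G i) (h : G j) : adj i j ->
  cyc_inc g * cyc_inc h = cyc_inc h * cyc_inc g.
Proof.
rewrite /cyc_inc -[LHS]congr_quot_piM -[RHS]congr_quot_piM => /orP[] /eqP ij.
  by move: h; rewrite ij => h; apply/congr_quotP/asboolP/congr_base; exact: CyclicRel.
by move: g; rewrite ij => g; apply/esym/congr_quotP/asboolP/congr_base; exact: CyclicRel.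
Qed.

Lemma cyc_inc_ind (P : W -> Prop) : P 1 ->
  (forall i (g : G i) x, P x -> P (cyc_inc g * x)) -> forall x, P x.
Proof.
move=> P1 PM x; rewrite -[x]reprK; elim/fp_ind: (repr x) => [|i g y IH]; first exact: P1.
by rewrite congr_quot_piM; exact: PM.
Qed.

Lemma cyc_head1 i : cyc_head i 1 = 1.
Proof.
apply: thead_headless; rewrite /cyc_act.
rewrite (fp_act_congr (congr_quot_reprP _ _)); last exact: reachable0.
by rewrite (fp_act_pi irr sym); [exact: headless_trace0 | exact: reachable0].
Qed.

Definition cyclic_graph_product : graph_product G adj W.
Proof.
apply: (@GraphProduct _ G adj W cyc_inc cyc_head cyc_incM cyc_incC cyc_inc_ind cyc_head1)
  => [i g x|i j g x ij|i j g x ij Nij g1 xj].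
- rewrite /cyc_head cyc_act_inc (thead_tact irr sym)//; exact: reachable_cyc_act.
- rewrite /cyc_head cyc_act_inc (thead_tact_adj irr sym)//; exact: reachable_cyc_act.
- rewrite /cyc_head cyc_act_inc; apply: (thead_tact_nonadj irr sym) => //.
  exact: reachable_cyc_act.
Qed.

End CyclicProduct.

Theorem theoremE (R : realType) (n : nat) (n_ge5 : (5 <= n)%N)
    (G : 'Z_n -> groupType)
    (G_nontrivial : forall i : 'Z_n, exists g : G i, g != 1%g) :
  ~ property_T R (group_aut (cyclic_product G)).
Proof.
apply: (aut_not_property_T (cyc_adj_irr n_ge5) (@cyc_adj_sym n)
  (cyclic_graph_product n_ge5 G) G_nontrivial (cyc_adj_tri n_ge5)
  (cyc_adj_sq n_ge5) (cyc_adj_two n_ge5) (cyc_no_sep n_ge5)).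
exact: 0%R.
Qed.
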